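(* The first Segal-Bargmann type transform $T$, defined for $\varphi\in L^2(\mathbb{R}^2)$ by $$T(\varphi)(z,\overline{z})=\int_{\mathbb{R}^2}A_z(x)A_{\overline{z}}(y)\varphi(x,y)\,dx\,dy,\qquad z\in\mathbb C,$$ defines an isometric isomorphism from $L^2(\mathbb{R}^2)$ onto $\mathcal{SF}(\mathbb{C})$.
   Context: For $z\in\mathbb C$, $x\in\mathbb R$, $A_z(x)=A(z,x)=\sum_{n=0}^\infty\frac{z^n}{\sqrt{n!}}\psi_n(x)=\pi^{-1/4}e^{-\frac12(z^2+x^2)+\sqrt2zx}$, where $(\psi_n)_{n\ge0}$ are the normalized Hermite functions (an orthonormal basis of $L^2(\mathbb R)$). $\mathcal{F}(\mathbb{C})$ is the classical Fock space of entire functions $h$ with $\|h\|^2_{\mathcal F(\mathbb C)}=\frac1\pi\int_{\mathbb C}|h(z)|^2e^{-|z|^2}dA(z)<\infty$. The polyanalytic Fock space of infinite order $\mathcal{SF}(\mathbb{C})$ is the set of functions $f(z)=\sum_{n=0}^{\infty}\overline{z}^nf_n(z)$ with $f_n\in\mathcal{F}(\mathbb{C})$ for all $n\ge0$ and $\|f\|^2_{\mathcal{SF}(\mathbb{C})}=\sum_{n=0}^{\infty}n!\,\|f_n\|^2_{\mathcal{F}(\mathbb{C})}<\infty$, with scalar product $\langle f,g\rangle_{\mathcal{SF}(\mathbb{C})}=\sum_{k}k!\,\langle f_k,g_k\rangle_{\mathcal{F}(\mathbb{C})}$. *)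

(* Defs.v *)
From HB Require Import structures.
From mathcomp Require Import all_boot all_order all_algebra.
From mathcomp Require Import complex.
From mathcomp Require Import all_classical all_reals all_analysis.

Set Implicit Arguments.
Unset Strict Implicit.
Unset Printing Implicit Defensive.

Import Order.TTheory GRing.Theory Num.Theory numFieldNormedType.Exports Normc.

Local Open Scope classical_set_scope.
Local Open Scope complex_scope.
Local Open Scope ring_scope.

(* Analysis over R[i] is done in R[i]^o, which carries the normed-module
   topology of the field R[i]; R[i] itself has no canonical topology in the
   library. *)

Definition leb2 (R : realType)
    : {measure set (measurableTypeR R * measurableTypeR R) -> \bar R} :=
  (@lebesgue_measure R \x @lebesgue_measure R)%E.
Arguments leb2 R : clear implicits.

Section Integral.
Context d (T : measurableType d) (R : realType).
Variable mu : {measure set T -> \bar R}.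

Definition cmeasurable (f : T -> R[i]) :=
  measurable_fun setT (fun x => complex.Re (f x)) /\
  measurable_fun setT (fun x => complex.Im (f x)).

Definition cintegrable (f : T -> R[i]) :=
  mu.-integrable setT (fun x => (complex.Re (f x))%:E) /\
  mu.-integrable setT (fun x => (complex.Im (f x))%:E).

Definition cintegral (f : T -> R[i]) : R[i] :=
  (\int[mu]_x complex.Re (f x)) +i* (\int[mu]_x complex.Im (f x)).

Definition L2_normsq (f : T -> R[i]) : \bar R :=
  (\int[mu]_x (normc (f x) ^+ 2)%:E)%E.

(* Square-integrable representatives; elements of the Hilbert space L^2 are
   their classes modulo equality mu-almost everywhere. *)
Definition L2 : set (T -> R[i]) :=
  [set f | cmeasurable f /\ (L2_normsq f < +oo)%E].

Definition L2_norm (f : T -> R[i]) : R := Num.sqrt (fine (L2_normsq f)).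

End Integral.

Section Fock.
Variable R : realType.

Definition entire (h : R[i] -> R[i]) :=
  forall z : R[i]^o, derivable (h : R[i]^o -> R[i]^o) z 1.

(* dA is the Lebesgue measure on the plane, z = p.1 + i p.2 *)
Definition fock_normsq (h : R[i] -> R[i]) : \bar R :=
  ((pi^-1)%:E * \int[leb2 R]_p
    (normc (h (p.1 +i* p.2)) ^+ 2
     * expR (- normc (p.1 +i* p.2) ^+ 2))%:E)%E.

Definition fock : set (R[i] -> R[i]) :=
  [set h | entire h /\ (fock_normsq h < +oo)%E].

Definition SF_coef_normsq (c : nat -> R[i] -> R[i]) : \bar R :=
  (\sum_(0 <= n <oo) (n`!%:R)%:E * fock_normsq (c n))%E.

Definition SF_expansion (f : R[i] -> R[i]) (c : nat -> R[i] -> R[i]) :=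
  [/\ forall n, fock (c n),
      (SF_coef_normsq c < +oo)%E &
      forall z : R[i],
        series (fun n => (conjc z ^+ n * c n z : R[i]^o)) @ \oo
          --> (f z : R[i]^o)].

Definition SF : set (R[i] -> R[i]) := [set f | exists c, SF_expansion f c].

(* The coefficient functions of f in SF are unique: the series
   \sum_n w^n f_n(z) is entire in (z, w), hence determined by its values on
   w = conj z.  So the choice made by xget is immaterial. *)
Definition SF_coef (f : R[i] -> R[i]) : nat -> R[i] -> R[i] :=
  xget (fun _ _ => 0) [set c | SF_expansion f c].

Definition SF_norm (f : R[i] -> R[i]) : R :=
  Num.sqrt (fine (SF_coef_normsq (SF_coef f))).

Definition cexp (w : R[i]) : R[i] :=
  (expR (complex.Re w) * cos (complex.Im w))
    +i* (expR (complex.Re w) * sin (complex.Im w)).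

Definition SB_kernel (z : R[i]) (x : R) : R[i] :=
  (pi `^ (- 4^-1))%:C
  * cexp (- 2^-1 * (z ^+ 2 + x%:C ^+ 2) + (Num.sqrt 2)%:C * z * x%:C).

Definition SB_integrand (phi : R * R -> R[i]) (z : R[i]) (p : R * R) : R[i] :=
  SB_kernel z p.1 * SB_kernel (conjc z) p.2 * phi p.

Definition SB_transform (phi : R * R -> R[i]) (z : R[i]) : R[i] :=
  cintegral (leb2 R) (SB_integrand phi z).

End Fock.

(* Main.v *)
(* An entire function has its value at 0 as mean over circles (Goursat in
   logarithmic coordinates), hence also against the rotation invariant Gaussian
   measure; applied to h(z + w) exp(- conj z w) this is the reproducing formula,
   which shows that a function h of the Fock space is the sum of its Taylor
   series \sum_m a_m z^m and that its squared norm is \sum_m m! |a_m|^2.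

   The Hermite functions satisfy A_z = \sum_m h_m z^m with h_m = psi_m / sqrt (m!),
   and their orthogonality is read off \int A_t A_w = exp(t w). Expanding both
   kernels, T phi = \sum_n conj z ^ n \sum_m c_mn z^m, where sqrt (m! n!) c_mn is
   the coefficient of phi along psi_m (x) psi_n. Bessel's inequality puts T phi in
   SF, and Riesz-Fischer gives each f in SF a preimage of the same norm; so both
   surjectivity and the isometry follow once T is injective.

   If T phi = 0, then G = phi exp(- (x^2 + y^2) / 2) integrates to zero against
   exp(s (x + y) + i t (x - y)) for all real s and t. Comparing powers of s, this
   persists for imaginary s, so the Fourier transform of G vanishes. The same then
   holds for G times a trigonometric polynomial, and by bounded limits for G times
   the indicator of any Borel set; hence G = 0 almost everywhere. *)
Require Import Defs.
From HB Require Import structures.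
From mathcomp Require Import all_boot all_order all_algebra.
From mathcomp Require Import complex.
From mathcomp Require Import all_classical all_reals all_analysis.
From mathcomp Require Import measurable_realfun.
From mathcomp Require Import ring lra.

Set Implicit Arguments.
Unset Strict Implicit.
Unset Printing Implicit Defensive.

Import Order.TTheory GRing.Theory Num.Theory numFieldNormedType.Exports Normc.

Local Open Scope classical_set_scope.
Local Open Scope complex_scope.
Local Open Scope ring_scope.

(** * Complex sequences, series and derivatives *)

(** Completeness of the Hermite functions enters only as injectivity of the transform. [L2_to_SF]
    yields no more than Bessel's inequality. The norm of [SF] is moreover read from coefficients
    picked by [xget]. [SF_to_L2] therefore starts from an arbitrary expansion and returns a preimage
    whose norm is computed from that very expansion. Applied to the picked one, and combined with
    injectivity, it forces the value of the norm whatever was picked.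

    Gaussian means are taken without polar coordinates: rotations preserve area because they factor
    into shears, and Fubini exchanges the average over all rotations with the integral, which
    produces circle means.

    The Hilbert space arguments are real. Bessel and Riesz-Fischer are applied separately to real
    and imaginary parts, along an enumeration of the doubly indexed Hermite system. The limit in
    Riesz-Fischer is made to exist everywhere, by cutting off a null set, so that Fatou applies to
    plain pointwise limits. *)

Section ComplexModulus.
Variable R : realType.
Implicit Types (z w : R[i]) (x : R).

Lemma normc_ge0 z : 0 <= normc z.
Proof. by case: z => a b /=; rewrite sqrtr_ge0. Qed.

Lemma sqr_normcE z : normc z ^+ 2 = complex.Re z ^+ 2 + complex.Im z ^+ 2.
Proof. by case: z => a b /=; rewrite sqr_sqrtr// addr_ge0// sqr_ge0. Qed.

Lemma ler_Re_normc z : `|complex.Re z| <= normc z.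
Proof.
rewrite -(@ler_pXn2r _ 2) ?nnegrE ?normc_ge0// sqr_normcE real_normK ?num_real//.
by rewrite lerDl sqr_ge0.
Qed.

Lemma ler_Im_normc z : `|complex.Im z| <= normc z.
Proof.
rewrite -(@ler_pXn2r _ 2) ?nnegrE ?normc_ge0// sqr_normcE real_normK ?num_real//.
by rewrite lerDr sqr_ge0.
Qed.

Lemma normc_real x : normc x%:C = `|x|.
Proof. by rewrite /= expr0n addr0 sqrtr_sqr. Qed.

Lemma normc_le_ReIm z : normc z <= `|complex.Re z| + `|complex.Im z|.
Proof.
rewrite -(@ler_pXn2r _ 2) ?nnegrE ?normc_ge0 ?addr_ge0// sqr_normcE sqrrD.
rewrite !real_normK ?num_real// lerD2r lerDl; apply: mulrn_wge0.
by rewrite mulr_ge0.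
Qed.

Lemma normc_conjc z : normc (conjc z) = normc z.
Proof. by case: z => a b /=; rewrite sqrrN. Qed.

Lemma normcX z n : normc (z ^+ n) = normc z ^+ n.
Proof. by elim: n => [|n IH]; rewrite ?expr0 ?normc1// !exprS normcM IH. Qed.

Lemma normc_natr n : normc (n%:R : R[i]) = n%:R.
Proof. by rewrite -(rmorph_nat (real_complex R)) normc_real ger0_norm. Qed.

Lemma le_normc_sum (I : Type) (s : seq I) (P : pred I) (f : I -> R[i]) :
  normc (\sum_(i <- s | P i) f i) <= \sum_(i <- s | P i) normc (f i).
Proof.
elim/big_rec2 : _ => [|i y1 y2 _ IH]; first by rewrite normc0.
by rewrite (le_trans (le_normcD _ _))// lerD2l.
Qed.

Lemma normC_normc z : `|z| = (normc z)%:C.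
Proof. by rewrite normc_def; case: z. Qed.

Lemma normc_distC z w : normc (z - w) = normc (w - z).
Proof. by rewrite -normcN opprB. Qed.

Lemma le_normcB z w : normc z - normc w <= normc (z - w).
Proof. by rewrite lerBlDr (le_trans _ (le_normcD _ _))// subrK. Qed.

Lemma normc_eq0P z : normc z = 0 <-> z = 0.
Proof. by split=> [/eq0_normc//|->]; rewrite normc0. Qed.

Lemma cReD z w : complex.Re (z + w) = complex.Re z + complex.Re w.
Proof. by case: z w => ? ? []. Qed.
Lemma cImD z w : complex.Im (z + w) = complex.Im z + complex.Im w.
Proof. by case: z w => ? ? []. Qed.
Lemma cReN z : complex.Re (- z) = - complex.Re z.
Proof. by case: z. Qed.
Lemma cImN z : complex.Im (- z) = - complex.Im z.
Proof. by case: z. Qed.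
Lemma cReM z w : complex.Re (z * w) = complex.Re z * complex.Re w - complex.Im z * complex.Im w.
Proof. by case: z w => ? ? []. Qed.
Lemma cImM z w : complex.Im (z * w) = complex.Re z * complex.Im w + complex.Im z * complex.Re w.
Proof. by case: z w => ? ? []. Qed.

Lemma cRe_sum (I : Type) (s : seq I) (P : pred I) (f : I -> R[i]) :
  complex.Re (\sum_(i <- s | P i) f i) = \sum_(i <- s | P i) complex.Re (f i).
Proof. by elim/big_rec2 : _ => // i y1 y2 _ <-; rewrite cReD. Qed.
Lemma cIm_sum (I : Type) (s : seq I) (P : pred I) (f : I -> R[i]) :
  complex.Im (\sum_(i <- s | P i) f i) = \sum_(i <- s | P i) complex.Im (f i).
Proof. by elim/big_rec2 : _ => // i y1 y2 _ <-; rewrite cImD. Qed.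

Lemma conjcM z w : conjc (z * w) = conjc z * conjc w.
Proof. exact: rmorphM. Qed.

Lemma mulc_conjc z : z * conjc z = (normc z ^+ 2)%:C.
Proof. by rewrite sqr_normcE; case: z => a b /=; rewrite /GRing.mul/=; congr (_ +i* _); ring. Qed.

End ComplexModulus.

Section ComplexLimits.
Variable R : realType.
Implicit Types (u v : nat -> R[i]) (l z : R[i]).

(** Convergence is expressed by a real sequence tending to 0, so that squeeze and order arguments
    over [R] apply. [ctendsP] is the bridge to the topology of [R[i]^o] used in [SF_expansion]. *)
Definition ctends u l := (fun n => normc (u n - l)) @ \oo --> (0 : R).

Lemma ctendsP u l : ctends u l <-> (u : nat -> R[i]^o) @ \oo --> (l : R[i]^o).
Proof.
split.
  move=> /cvgrPdist_lt h; apply/cvgrPdist_lt => e e0.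
  have e0' : 0 < complex.Re e by move: e0; rewrite ltcE => /andP[].
  (* A positive element of [R[i]] is real, so epsilon can be replaced by its real part. *)
  have eE : e = (complex.Re e)%:C.
    by move: e0; rewrite ltcE /=; case: (e) => a b /= /andP[/eqP -> _].
  apply: filterS (h _ e0') => n.
  by rewrite sub0r normrN ger0_norm ?normc_ge0// normc_distC normC_normc eE ltcR.
move=> /cvgrPdist_lt h; apply/cvgrPdist_lt => e e0.
have e0' : 0 < e%:C by rewrite ltcR.
apply: filterS (h _ e0') => n.
by move=> un; rewrite sub0r normrN ger0_norm ?normc_ge0//; move: un; rewrite normC_normc ltcR normc_distC.
Qed.

Lemma squeeze0 (u v : nat -> R) : (forall n, 0 <= u n <= v n) ->
  v @ \oo --> (0 : R) -> u @ \oo --> (0 : R).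
Proof.
move=> uv v0; apply: (@squeeze_cvgr _ _ _ _ (cst 0) v) => //; last exact: cvg_cst.
by apply: nearW.
Qed.

Lemma ctends_ReIm u l : ctends u l <->
  ((fun n => complex.Re (u n)) @ \oo --> complex.Re l) /\
  ((fun n => complex.Im (u n)) @ \oo --> complex.Im l).
Proof.
split=> [h|[hr hi]].
  split; apply/subr_cvg0; apply/norm_cvg0P.
  - apply: squeeze0 h => n; rewrite normr_ge0/=.
    by rewrite -cReN -cReD ler_Re_normc.
  - apply: squeeze0 h => n; rewrite normr_ge0/=.
    by rewrite -cImN -cImD ler_Im_normc.
have {}hr : (fun n => `|complex.Re (u n) - complex.Re l|) @ \oo --> (0 : R).
  by apply/norm_cvg0P; apply/subr_cvg0.
have {}hi : (fun n => `|complex.Im (u n) - complex.Im l|) @ \oo --> (0 : R).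
  by apply/norm_cvg0P; apply/subr_cvg0.
have h : (fun n => `|complex.Re (u n) - complex.Re l| + `|complex.Im (u n) - complex.Im l|) @ \oo --> (0 : R).
  by rewrite -[0]addr0; exact: cvgD.
rewrite /ctends; apply: squeeze0 h => n; rewrite normc_ge0/=.
by rewrite (le_trans (normc_le_ReIm _))// cReD cImD cReN cImN.
Qed.

Lemma ctends_unique u l l' : ctends u l -> ctends u l' -> l = l'.
Proof.
move=> /ctends_ReIm[h1 h2] /ctends_ReIm[h3 h4].
have := cvg_unique _ h1 h3; have := cvg_unique _ h2 h4.
by case: l l' {h1 h2 h3 h4} => ? ? [? ?] /= -> // ->.
Qed.

Lemma ctendsD u v l l' : ctends u l -> ctends v l' ->
  ctends (fun n => u n + v n) (l + l').
Proof.
move=> h1 h2.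
have h : (fun n => normc (u n - l) + normc (v n - l')) @ \oo --> (0 : R).
  by rewrite -[0]addr0; exact: cvgD.
rewrite /ctends; apply: squeeze0 h => n; rewrite normc_ge0/=.
by rewrite (le_trans _ (le_normcD _ _))// opprD addrACA.
Qed.

Lemma ctendsMl z u l : ctends u l -> ctends (fun n => z * u n) (z * l).
Proof.
move=> h1.
have h : (fun n => normc z * normc (u n - l)) @ \oo --> (0 : R).
  by rewrite -[0](mulr0 (normc z)); apply: cvgMr; exact: h1.
rewrite /ctends; apply: squeeze0 h => n; rewrite normc_ge0/=.
by rewrite -mulrBr normcM.
Qed.

Lemma ctends_cst l : ctends (fun=> l) l.
Proof. by rewrite /ctends; under eq_fun do rewrite subrr normc0; exact: cvg_cst. Qed.

Lemma ctendsN u l : ctends u l -> ctends (fun n => - u n) (- l).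
Proof. by move=> /(ctendsMl (-1)); under eq_fun do rewrite mulN1r; rewrite mulN1r. Qed.

Lemma ctendsB u v l l' : ctends u l -> ctends v l' ->
  ctends (fun n => u n - v n) (l - l').
Proof. by move=> h1 /ctendsN; exact: ctendsD. Qed.

Lemma ctends_normc u l : ctends u l -> (fun n => normc (u n)) @ \oo --> normc l.
Proof.
move=> h; apply/subr_cvg0; apply/norm_cvg0P; apply: squeeze0 h => n.
rewrite normr_ge0/= ler_norml; apply/andP; split; last exact: le_normcB.
by rewrite lerNl opprB normc_distC le_normcB.
Qed.

Lemma ctendsM u v l l' : ctends u l -> ctends v l' ->
  ctends (fun n => u n * v n) (l * l').
Proof.
move=> h1 h2.
have h : (fun n => normc (u n) * normc (v n - l') + normc l' * normc (u n - l)) @ \oo --> (0 : R).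
  rewrite -[0]addr0 -[X in X + _](mulr0 (normc l)) -[X in _ + X](mulr0 (normc l')).
  by apply: cvgD; [apply: cvgM => //; exact: ctends_normc|apply: cvgMr; exact: h1].
rewrite /ctends; apply: squeeze0 h => n; rewrite normc_ge0/=.
rewrite -!normcM (le_trans _ (le_normcD _ _))//.
by rewrite mulrBr mulrBr addrA (mulrC l') subrK (mulrC l').
Qed.

Lemma ctends_sqz u l (e : nat -> R) : (forall n, normc (u n - l) <= e n) ->
  e @ \oo --> (0 : R) -> ctends u l.
Proof. by move=> h1 h; rewrite /ctends; apply: squeeze0 h => n; rewrite normc_ge0/=. Qed.

Lemma ctends_shift u l : ctends (fun n => u n.+1) l <-> ctends u l.
Proof. by split; rewrite /ctends; rewrite -(cvg_shiftS (fun n => normc (u n - l))). Qed.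

Lemma ctends_real (x : nat -> R) (y : R) : x @ \oo --> y ->
  ctends (fun n => (x n)%:C) y%:C.
Proof.
move=> h; apply/ctends_ReIm; split => //=; exact: cvg_cst.
Qed.

Arguments ctends_cst l : clear implicits.

Section Series.
Variable a : nat -> R[i].

Definition csummable := cvgn (series (fun n => normc (a n))).
Definition csum : R[i] := limn (series (fun n => complex.Re (a n)))
  +i* limn (series (fun n => complex.Im (a n))).

Lemma Re_series n : complex.Re (series a n) = series (fun n => complex.Re (a n)) n.
Proof. by rewrite /series/= cRe_sum. Qed.
Lemma Im_series n : complex.Im (series a n) = series (fun n => complex.Im (a n)) n.
Proof. by rewrite /series/= cIm_sum. Qed.

Lemma csum_ctends : csummable -> ctends (series a) csum.
Proof.
move=> h; apply/ctends_ReIm; split => /=.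
- under eq_fun do rewrite Re_series.
  apply: normed_cvg; apply: (series_le_cvg _ _ _ h) => n //=; [exact: normc_ge0|exact: ler_Re_normc].
- under eq_fun do rewrite Im_series.
  apply: normed_cvg; apply: (series_le_cvg _ _ _ h) => n //=; [exact: normc_ge0|exact: ler_Im_normc].
Qed.

End Series.

Lemma csummable_le (a : nat -> R[i]) (b : nat -> R) :
  (forall n, normc (a n) <= b n) -> cvgn (series b) -> csummable a.
Proof.
move=> ab; apply: series_le_cvg => // n; first exact: normc_ge0.
by rewrite (le_trans (normc_ge0 _) (ab n)).
Qed.
End ComplexLimits.

(** * Cauchy products of absolutely convergent series *)

Section CauchyProduct.
Variable R : realType.

Definition convol (K : pzRingType) (a b : nat -> K) n := \sum_(j < n.+1) a j * b (n - j)%N.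

Lemma series_conv (K : pzRingType) (a b : nat -> K) n :
  series (convol a b) n = \sum_(0 <= j < n) \sum_(0 <= k < n | (j + k < n)%N) a j * b k.
Proof.
rewrite /series /= /convol.
under eq_bigr => i _ do rewrite -(big_mkord xpredT (fun j => a j * b (i - j)%N)).
transitivity (\sum_(0 <= i < n) \sum_(0 <= j < n | (j <= i)%N) a j * b (i - j)%N).
  apply: eq_big_nat => i /andP[_ ni].
  by rewrite (big_nat_widen _ _ _ _ _ ni)/=; apply: eq_bigl => j; rewrite ltnS.
rewrite (exchange_big_dep_nat xpredT)//=; apply: eq_big_nat => j /andP[_ jn].
rewrite (_ : \sum_(0 <= i < n | (j <= i)%N) a j * b (i - j)%N =
  \sum_(0 + j <= i < n) a j * b (i - j)%N); last first.
  by rewrite [RHS](big_nat_widenl _ 0).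
rewrite big_addn.
rewrite [RHS](_ : _ = \sum_(0 <= k < n - j) a j * b k); last first.
  rewrite (big_nat_widen 0 (n - j) n)/=; last exact: leq_subr.
  by apply: eq_bigl => k; rewrite ltn_subRL.
by apply: eq_bigr => k _; rewrite addnK.
Qed.

Lemma series_mul (K : pzRingType) (a b : nat -> K) n :
  series a n * series b n = \sum_(0 <= j < n) \sum_(0 <= k < n) a j * b k.
Proof.
by rewrite /series/= big_distrl/=; apply: eq_bigr => j _; rewrite big_distrr.
Qed.

Lemma series_mulB_conv (K : pzRingType) (a b : nat -> K) n :
  series a n * series b n - series (convol a b) n =
  \sum_(0 <= j < n) \sum_(0 <= k < n | ~~ (j + k < n)%N) a j * b k.
Proof.
rewrite series_mul series_conv -sumrB; apply: eq_bigr => j _.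
by rewrite [X in X - _](bigID (fun k => (j + k < n)%N))/= addrAC subrr add0r.
Qed.

(** The triangle j + k < n lies in the square of side n, and that square lies in the triangle of
    size 2n. For nonnegative terms the two inclusions pin the limit. *)
Lemma series_conv_cvg_ge0 (a b : nat -> R) (A B : R) : (forall n, 0 <= a n) ->
  (forall n, 0 <= b n) -> series a @ \oo --> A -> series b @ \oo --> B ->
  series (convol a b) @ \oo --> A * B.
Proof.
move=> a0 b0 aA bB.
have c0 n : 0 <= convol a b n by apply: sumr_ge0 => i _; rewrite mulr_ge0.
have sle n : series (convol a b) n <= series a n * series b n.
  rewrite -subr_ge0 series_mulB_conv; do 2 (apply: sumr_ge0 => ? _).
  by rewrite mulr_ge0.
have les n : series a n * series b n <= series (convol a b) (n + n)%N.
  rewrite series_mul series_conv (big_cat_nat (leq0n n) (leq_addl n n))/=.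
  apply: (@le_trans _ _ (\sum_(0 <= j < n) \sum_(0 <= k < n + n | (j + k < n + n)%N) a j * b k)).
    apply: ler_sum_nat => j /andP[_ jn].
    rewrite (big_cat_nat (leq0n n) (leq_addl n n))/=.
    rewrite [X in X + _](_ : _ = \sum_(0 <= i < n) a j * b i).
      by rewrite lerDl sumr_ge0// => ? _; rewrite mulr_ge0.
    rewrite big_mkcond/=; apply: eq_big_nat => k /andP[_ kn].
    by rewrite (leq_trans _ (leq_add jn (ltnW kn)))// addSn ltnS.
  by rewrite lerDl; do 2 (apply: sumr_ge0 => ? _); rewrite mulr_ge0.
have AB : (fun n => series a n * series b n) @ \oo --> A * B by exact: cvgM.
have nd : nondecreasing_seq (series (convol a b)) by apply: nondecreasing_series => n _ _.
have ndAB : nondecreasing_seq (fun n => series a n * series b n).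
  move=> m n mn; apply: ler_pM; try by apply: sumr_ge0.
    exact: (nondecreasing_series (fun n _ _ => a0 n)).
  exact: (nondecreasing_series (fun n _ _ => b0 n)).
have ub n : series (convol a b) n <= A * B.
  rewrite (le_trans (sle n))// -(cvg_lim _ AB)//.
  by apply: (nondecreasing_cvgn_le ndAB); apply/cvg_ex; exists (A * B).
have cC : cvgn (series (convol a b)).
  by apply: nondecreasing_is_cvgn => //; exists (A * B) => _ [n _ <-].
have -> : A * B = limn (series (convol a b)); last exact: cC.
apply/eqP; rewrite eq_le; apply/andP; split; last first.
  by apply: limr_le => //; apply: nearW.
rewrite -(cvg_lim _ AB)//; apply: limr_le; first by apply/cvg_ex; exists (A * B).
apply: nearW => n; rewrite (le_trans (les n))//.
exact: (nondecreasing_cvgn_le nd cC).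
Qed.

(** The defect between the product of the partial sums and the partial sum of the product is a sum
    over the same index pairs for a, b as for their moduli. It is thus dominated by the defect of
    the moduli, which tends to 0 by the nonnegative case. *)
Lemma ctends_conv (a b : nat -> R[i]) A B : csummable a -> csummable b ->
  ctends (series a) A -> ctends (series b) B -> ctends (series (convol a b)) (A * B).
Proof.
move=> ca cb aA bB.
have := ctendsB (ctendsM aA bB); set na := fun n => normc (a n); set nb := fun n => normc (b n).
have h : (fun n => series na n * series nb n - series (convol na nb) n) @ \oo --> (0 : R).
  rewrite -[0](subrr (limn (series na) * limn (series nb))).
  apply: cvgB; first exact: cvgM.
  by apply: series_conv_cvg_ge0 => //; move=> n; exact: normc_ge0.
have d0 : ctends (fun n => series a n * series b n - series (convol a b) n) 0.
  apply: ctends_sqz h => n; rewrite subr0 !series_mulB_conv.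
  rewrite (le_trans (le_normc_sum _ _ _))//; apply: ler_sum => j _.
  rewrite (le_trans (le_normc_sum _ _ _))//; apply: ler_sum => k _.
  by rewrite normcM.
move=> /(_ _ _ d0); rewrite subr0.
by under [X in ctends X]eq_fun do rewrite opprB addrC subrK.
Qed.

End CauchyProduct.

Section ComplexExponential.
Variable R : realType.
Implicit Types (z w : R[i]) (x : R).

Definition cexp_term w n : R[i] := w ^+ n / n`!%:R.

Lemma normc_cexp_term w n : normc (cexp_term w n) = exp_coeff (normc w) n.
Proof. by rewrite /cexp_term normcM normcV normcX normc_natr. Qed.

Lemma csummable_cexp w : csummable (cexp_term w).
Proof.
rewrite /csummable; under eq_fun do rewrite normc_cexp_term.
exact: is_cvg_series_exp_coeff.
Qed.

Arguments csummable_cexp w : clear implicits.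

Lemma cexpE (a b : R) : cexp (a +i* b) = (expR a)%:C * (cos b +i* sin b).
Proof. by rewrite /cexp /= /GRing.mul/= !mul0r subr0 addr0. Qed.

Lemma cexp_term_conv z w : cexp_term (z + w) = convol (cexp_term z) (cexp_term w).
Proof.
apply/funext => n; rewrite /cexp_term /convol addrC exprDn mulr_suml.
apply: eq_bigr => j _; rewrite -mulrnAl.
have jn : (j <= n)%N by rewrite -ltnS.
rewrite -(bin_fact jn) !natrM !invfM.
have h m : m`!%:R != 0 :> R[i] by rewrite pnatr_eq0 -lt0n fact_gt0.
have hb : 'C(n, j)%:R != 0 :> R[i] by rewrite pnatr_eq0 -lt0n bin_gt0.
rewrite -mulr_natr.
by field; rewrite !h hb.
Qed.

Lemma ctends_cexp_imag (b : R) : ctends (series (cexp_term (0 +i* b))) (cos b +i* sin b).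
Proof.
have -> : cexp_term (0 +i* b) = fun n => cos_coeff b n +i* sin_coeff b n.
  apply/funext => n; rewrite /cexp_term.
  have -> : 0 +i* b = b%:C * 'i by apply/eqP; rewrite eq_complex /=; apply/andP; split; apply/eqP; ring.
  rewrite exprMn /cos_coeff /sin_coeff /=.
  have -> : n`!%:R = (n`!%:R)%:C :> R[i] by rewrite rmorph_nat.
  rewrite -[X in 'i ^+ X](odd_double_half n) exprD -mul2n exprM sqr_i.
  rewrite -rmorphXn -rmorphV; last by rewrite unitfE pnatr_eq0 -lt0n fact_gt0.
  have -> : (- 1 : R[i]) ^+ n./2 = ((- 1) ^+ n./2)%:C by rewrite rmorphXn rmorphN1.
  have [on|en] := boolP (odd n); rewrite /= ?expr0 ?expr1.
    have -> : n.-1./2 = n./2.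
      by rewrite -[in LHS](odd_double_half n) on add1n /= half_double.
    by apply/eqP; rewrite eq_complex /=; apply/andP; split; apply/eqP; rewrite -?exprnP; ring.
  by apply/eqP; rewrite eq_complex /=; apply/andP; split; apply/eqP; rewrite -?exprnP; ring.
apply/ctends_ReIm; split => /=.
- under eq_fun do rewrite Re_series /=.
  by rewrite unlock; exact: is_cvg_series_cos_coeff.
- under eq_fun do rewrite Im_series /=.
  by rewrite unlock; exact: is_cvg_series_sin_coeff.
Qed.

Lemma ctends_cexp w : ctends (series (cexp_term w)) (cexp w).
Proof.
case: w => a b.
have -> : a +i* b = a%:C + (0 +i* b) by rewrite /GRing.add /= addr0 add0r.
rewrite cexp_term_conv.
have -> : cexp (a%:C + (0 +i* b)) = (expR a)%:C * (cos b +i* sin b).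
  by rewrite -cexpE /GRing.add /= addr0 add0r.
apply: ctends_conv; [exact: csummable_cexp|exact: csummable_cexp| |exact: ctends_cexp_imag].
have -> : series (cexp_term a%:C) = fun n => (series (exp_coeff a) n)%:C.
  apply/funext => n; rewrite /series/= rmorph_sum; apply: eq_bigr => k _.
  by rewrite /exp_coeff/= /cexp_term rmorphM rmorphXn fmorphV rmorph_nat.
by apply: ctends_real; exact: is_cvg_series_exp_coeff.
Qed.

Arguments ctends_cexp w : clear implicits.

(** By the binomial theorem the exponential terms of z + w are the convolution of those of z and of
    w, so both sides are limits of one series. *)
Lemma cexpD z w : cexp (z + w) = cexp z * cexp w.
Proof.
apply: (ctends_unique (ctends_cexp _)); rewrite cexp_term_conv.
by apply: ctends_conv; [exact: csummable_cexp..|exact: ctends_cexp|exact: ctends_cexp].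
Qed.

Lemma cexp0 : cexp (0 : R[i]) = 1.
Proof. by rewrite /cexp /= expR0 cos0 sin0 mulr1 mulr0. Qed.

Lemma normc_cexp w : normc (cexp w) = expR (complex.Re w).
Proof.
rewrite /cexp; case: w => a b /=.
by rewrite !exprMn -mulrDr cos2Dsin2 mulr1 sqrtr_sqr ger0_norm// expR_ge0.
Qed.

Lemma cexp_real x : cexp x%:C = (expR x)%:C.
Proof. by rewrite cexpE cos0 sin0 -[RHS]mulr1. Qed.

(** Removing two terms of the series leaves w^2 times a series dominated by that of exp |w|, because
    (k + 2)! is at least k!. This remainder makes [cexp] its own derivative. *)
Lemma normc_cexp_sub1 w : normc (cexp w - 1 - w) <= normc w ^+ 2 * expR (normc w).
Proof.
have h : ctends (fun n => series (cexp_term w) n.+2 - 1 - w) (cexp w - 1 - w).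
  apply: ctendsB; last exact: ctends_cst.
  apply: ctendsB; last exact: ctends_cst.
  exact: (ctends_shift (fun n => series (cexp_term w) n.+1) _).2 ((ctends_shift _ _).2 (ctends_cexp w)).
have h1 := ctends_normc h.
rewrite -(cvg_lim _ h1)//; apply: limr_le; first by apply/cvg_ex; eexists; exact: h1.
apply: nearW => n.
rewrite /series /= !big_nat_recl// /cexp_term fact0 expr0 expr1 invr1 !mulr1.
rewrite [X in normc X](_ : _ = \sum_(0 <= i < n) w ^+ i.+2 / i.+2`!%:R); last by ring.
rewrite (le_trans (le_normc_sum _ _ _))//.
apply: (@le_trans _ _ (normc w ^+ 2 * series (exp_coeff (normc w)) n)); last first.
  apply: ler_wpM2l; first by rewrite sqr_ge0.
  apply: (nondecreasing_cvgn_le _ (is_cvg_series_exp_coeff _)).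
  apply: nondecreasing_series => k _ _.
  by rewrite /exp_coeff/= mulr_ge0// ?invr_ge0// exprn_ge0// normc_ge0.
rewrite /series /= mulr_sumr; apply: ler_sum_nat => k _.
rewrite normcM normcV normcX normc_natr /exp_coeff/=.
rewrite (_ : normc w ^+ k.+2 = normc w ^+ 2 * normc w ^+ k); last by rewrite -exprD.
rewrite -mulrA.
rewrite ler_wpM2l ?sqr_ge0// ler_wpM2l ?exprn_ge0 ?normc_ge0//.
by rewrite lef_pV2 ?posrE ?ltr0n ?fact_gt0// ler_nat !factS mulnA leq_pmull// muln_gt0.
Qed.
End ComplexExponential.

(** * Complex differentiability as a first-order expansion *)

Section ComplexDerivative.
Variable R : realType.
Implicit Types (f g : R[i] -> R[i]) (z w d : R[i]) (e r : R).

(** Real epsilon and delta, with the quotient multiplied out: the case w = 0 is harmless and the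
    product and chain rules become norm estimates. [entireP] relates it to [derivable]. *)
Definition cdiff f z d := forall e, 0 < e -> exists2 r, 0 < r &
  forall w, normc w < r -> normc (f (z + w) - f z - d * w) <= e * normc w.

Definition ccont f z := forall e, 0 < e -> exists2 r, 0 < r &
  forall w, normc w < r -> normc (f (z + w) - f z) <= e.

Lemma entireP h : entire h <-> forall z, exists d, cdiff h z d.
Proof.
split=> [hh z|hh z].
  have /cvg_ex[/= d hd] := hh z; exists d => e e0.
  have e0' : 0 < (e%:C : R[i]) by rewrite ltcR.
  have /cvgrPdist_le /(_ _ e0') := hd.
  rewrite near_withinE => /nbhs_normP[r /= r0 hr].
  have rE : r = (complex.Re r)%:C.
    by move: r0; rewrite ltcE /=; case: (r) => a b /= /andP[/eqP -> _].
  exists (complex.Re r); first by move: r0; rewrite rE ltcR.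
  move=> w wr; have [->|w0] := eqVneq w 0.
    by rewrite addr0 subrr mulr0 subrr normc0 mulr0.
  have : `|d - w^-1 * (h (w * 1 + z) - h z)| <= e%:C.
    by apply: hr => //; rewrite /ball_ /= sub0r normrN normC_normc rE ltcR.
  rewrite normC_normc lecR mulr1 (addrC w) => hw.
  rewrite (_ : h (z + w) - h z - d * w = - ((d - w^-1 * (h (z + w) - h z)) * w)).
    by rewrite normcN normcM ler_wpM2r// normc_ge0.
  by field.
have [d hd] := hh z; apply/cvg_ex; exists d.
apply/cvgrPdist_le => e e0.
have eE : e = (complex.Re e)%:C.
  by move: e0; rewrite ltcE /=; case: (e) => a b /= /andP[/eqP -> _].
have e0' : 0 < complex.Re e by move: e0; rewrite eE ltcR.
have [r r0 hr] := hd _ e0'.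
rewrite near_withinE; apply/nbhs_normP; exists r%:C => /=; first by rewrite ltcR.
move=> w; rewrite /ball_/= sub0r normrN normC_normc ltcR => wr w0.
have {hr}hr := hr _ wr.
suff : `|d - w^-1 * (h (w * 1 + z) - h z)| <= e by [].
rewrite normC_normc eE lecR mulr1 (addrC w).
rewrite (_ : d - w^-1 * (h (z + w) - h z) = - ((h (z + w) - h z - d * w) / w)); last by field.
rewrite normcN normcM normcV ler_pdivrMr//.
by rewrite lt_neqAle normc_ge0 andbT eq_sym; apply: contra w0 => /eqP/eq0_normc ->.
Qed.

Lemma exists_small_factor (K e : R) : 0 < K -> 0 < e ->
  exists e1, [/\ 0 < e1, e1 <= 1 & K * e1 <= e].
Proof.
move=> K0 e0; exists (Num.min 1 (e / K)); split.
- by rewrite lt_min ltr01 divr_gt0.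
- by rewrite ge_min lexx.
- by rewrite mulrC -ler_pdivlMr// ge_min lexx orbT.
Qed.

Lemma cdiff_cst c z : cdiff (fun=> c) z 0.
Proof.
by move=> e e0; exists 1 => // w _; rewrite subrr mul0r subrr normc0 mulr_ge0 ?normc_ge0// ltW.
Qed.

Lemma cdiff_id z : cdiff id z 1.
Proof.
move=> e e0; exists 1 => // w _; rewrite (_ : _ - _ = 0); last by rewrite /=; ring.
by rewrite normc0 mulr_ge0 ?normc_ge0// ltW.
Qed.

Lemma cdiffD f g z d d' : cdiff f z d -> cdiff g z d' ->
  cdiff (fun w => f w + g w) z (d + d').
Proof.
move=> hf hg e e0; have e20 : 0 < e / 2 by rewrite divr_gt0.
have [r r0 {}hf] := hf _ e20; have [r' r'0 {}hg] := hg _ e20.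
exists (Num.min r r'); first by rewrite lt_min r0.
move=> w; rewrite lt_min => /andP[wr wr'].
rewrite [X in normc X](_ : _ = (f (z + w) - f z - d * w) + (g (z + w) - g z - d' * w)); last by ring.
rewrite (le_trans (le_normcD _ _))// (le_trans (lerD (hf _ wr) (hg _ wr')))//.
by rewrite -mulrDl -splitr.
Qed.

Lemma cdiffM f g z d d' : cdiff f z d -> cdiff g z d' ->
  cdiff (fun w => f w * g w) z (d * g z + f z * d').
Proof.
move=> hf hg e e0.
pose K := normc (g z) + normc (f z) + (normc d + 1) * (normc d' + 1).
have K0 : 0 < K.
  by rewrite ltr_wpDl ?addr_ge0 ?normc_ge0// mulr_gt0// ltr_wpDl// normc_ge0.
have [e1 [e10 e1le e1K]] := exists_small_factor K0 e0.
have [r r0 {}hf] := hf _ e10; have [r' r'0 {}hg] := hg _ e10.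
(* The radius is also capped by [e1], so that the second-order product of the two increments is at
   most a multiple of e1 |w|. *)
exists (Num.min e1 (Num.min r r')); first by rewrite !lt_min e10 r0.
move=> w; rewrite !lt_min => /and3P[we wr wr'].
have {}hf : normc (f (z + w) - f z - d * w) <= e1 * normc w := hf _ wr.
have {}hg : normc (g (z + w) - g z - d' * w) <= e1 * normc w := hg _ wr'.
rewrite [X in normc X](_ : _ = (f (z + w) - f z - d * w) * g z +
  f z * (g (z + w) - g z - d' * w) +
  (d * w + (f (z + w) - f z - d * w)) * (d' * w + (g (z + w) - g z - d' * w))); last by ring.
have nw := normc_ge0 w.
have bd (c rr : R[i]) : normc rr <= e1 * normc w -> normc (c * w + rr) <= (normc c + 1) * normc w.
  move=> h; rewrite (le_trans (le_normcD _ _))// normcM mulrDl mul1r lerD2l.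
  by rewrite (le_trans h)// ler_piMl.
rewrite (le_trans (le_normcD _ _))//.
apply: (@le_trans _ _ ((normc (g z) + normc (f z)) * (e1 * normc w) +
   (normc d + 1) * (normc d' + 1) * (e1 * normc w))).
  apply: lerD.
    rewrite [leRHS]mulrDl (le_trans (le_normcD _ _))// 2!normcM lerD//.
      by rewrite mulrC ler_wpM2l// normc_ge0.
    by rewrite ler_wpM2l// normc_ge0.
  rewrite normcM (le_trans (ler_pM (normc_ge0 _) (normc_ge0 _) (bd d _ hf) (bd d' _ hg)))//.
  rewrite mulrACA ler_wpM2l//; last by rewrite ler_wpM2r// ltW.
  by rewrite mulr_ge0 ?addr_ge0 ?normc_ge0.
by rewrite -mulrDl (_ : _ + _ + _ = K) ?mulrA ?ler_wpM2r// /K; ring.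
Qed.

Lemma cdiff_comp f g z d d' : cdiff g z d' -> cdiff f (g z) d ->
  cdiff (fun w => f (g w)) z (d * d').
Proof.
move=> hg hf e e0.
pose K := normc d' + 1 + normc d.
have K0 : 0 < K by rewrite ltr_pwDl ?normc_ge0// ltr_wpDl// normc_ge0.
have [e1 [e10 e1le e1K]] := exists_small_factor K0 e0.
have [r r0 {}hf] := hf _ e10; have [r' r'0 {}hg] := hg _ e10.
have d'0 : 0 < normc d' + 1 by rewrite ltr_wpDl// normc_ge0.
exists (Num.min r' (r / (normc d' + 1))); first by rewrite !lt_min r'0 divr_gt0.
move=> w; rewrite lt_min => /andP[wr' wr].
have {}hg := hg _ wr'.
have nw := normc_ge0 w.
pose w' := g (z + w) - g z.
have w'le : normc w' <= (normc d' + 1) * normc w.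
  rewrite (_ : w' = d' * w + (g (z + w) - g z - d' * w)); last by rewrite /w'; ring.
  rewrite (le_trans (le_normcD _ _))// normcM mulrDl mul1r lerD2l.
  by rewrite (le_trans hg)// ler_piMl.
have w'r : normc w' < r.
  by rewrite (le_lt_trans w'le)// mulrC -ltr_pdivlMr.
have {}hf := hf _ w'r.
rewrite (_ : g z + w' = g (z + w)) in hf; last by rewrite /w'; ring.
rewrite [X in normc X](_ : _ = (f (g (z + w)) - f (g z) - d * w') +
   d * (g (z + w) - g z - d' * w)); last by rewrite /w'; ring.
rewrite (le_trans (le_normcD _ _))//.
apply: (@le_trans _ _ (e1 * ((normc d' + 1) * normc w) + normc d * (e1 * normc w))).
  rewrite lerD//; first by rewrite (le_trans hf)// ler_wpM2l// ltW.
  by rewrite normcM ler_wpM2l// normc_ge0.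
rewrite [X in X <= _](_ : _ = K * e1 * normc w); last by rewrite /K; ring.
by rewrite ler_wpM2r.
Qed.

Lemma cdiff_cont f z d : cdiff f z d -> ccont f z.
Proof.
move=> hf e e0; have [r r0 {}hf] := hf 1 ltr01.
have d0 : 0 < normc d + 1 by rewrite ltr_wpDl// normc_ge0.
exists (Num.min r (e / (normc d + 1))); first by rewrite lt_min r0 divr_gt0.
move=> w; rewrite lt_min => /andP[wr we].
rewrite (_ : f (z + w) - f z = d * w + (f (z + w) - f z - d * w)); last by ring.
rewrite (le_trans (le_normcD _ _))// normcM (le_trans (lerD (lexx _) (hf _ wr)))//.
by rewrite -mulrDl mulrC -ler_pdivlMr// ltW.
Qed.

Lemma cdiff_cexp z : cdiff (@cexp R) z (cexp z).
Proof.
move=> e e0; have K0 : 0 < normc (cexp z) * expR 1.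
  by rewrite normc_cexp mulr_gt0// expR_gt0.
exists (Num.min 1 (e / (normc (cexp z) * expR 1))); first by rewrite lt_min ltr01 divr_gt0.
move=> w; rewrite lt_min => /andP[w1 we].
rewrite cexpD (_ : _ - _ - _ = cexp z * (cexp w - 1 - w)); last by ring.
rewrite normcM (le_trans (ler_wpM2l (normc_ge0 _) (normc_cexp_sub1 w)))//.
rewrite mulrCA mulrA -/(normc w) [X in X <= _](_ : _ =
  normc (cexp z) * expR (normc w) * normc w * normc w); last by ring.
rewrite ler_wpM2r ?normc_ge0//.
apply: (@le_trans _ _ (normc (cexp z) * expR 1 * normc w)).
  by rewrite ler_wpM2r ?normc_ge0// ler_wpM2l ?normc_ge0// ler_expR ltW.
by rewrite mulrC -ler_pdivlMr// ltW.
Qed.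

End ComplexDerivative.

Lemma cRe_conjc (R : realType) (z : R[i]) : complex.Re (conjc z) = complex.Re z.
Proof. by case: z. Qed.
Lemma cIm_conjc (R : realType) (z : R[i]) : complex.Im (conjc z) = - complex.Im z.
Proof. by case: z. Qed.

(** * Integration of complex functions *)

Section RealIntegral.
Context d (T : measurableType d) (R : realType).
Variable mu : {measure set T -> \bar R}.
Implicit Types (f g : T -> R).

Definition rintegrable f := mu.-integrable setT (fun x => (f x)%:E).

Lemma rintegrable_measurable f : rintegrable f -> measurable_fun setT f.
Proof. by move=> /(measurable_int mu)/measurable_EFinP. Qed.

Lemma rintegrable_le f g : measurable_fun setT f -> rintegrable g ->
  (forall x, `|f x| <= g x) -> rintegrable f.
Proof.
move=> mf ig fg; apply: (le_integrable measurableT _ _ ig); first exact/measurable_EFinP.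
by move=> x _ /=; rewrite lee_fin (le_trans (fg x))// ler_norm.
Qed.

Lemma rintegrableD f g : rintegrable f -> rintegrable g ->
  rintegrable (fun x => f x + g x).
Proof.
by move=> hf hg; rewrite /rintegrable; under eq_fun do rewrite EFinD; exact: integrableD.
Qed.

Lemma rintegrableZ k f : rintegrable f -> rintegrable (fun x => k * f x).
Proof.
by move=> hf; rewrite /rintegrable; under eq_fun do rewrite EFinM; exact: integrableZl.
Qed.

Lemma rintegrableB f g : rintegrable f -> rintegrable g ->
  rintegrable (fun x => f x - g x).
Proof.
by move=> hf hg; rewrite /rintegrable; under eq_fun do rewrite EFinB; exact: integrableB.
Qed.

Lemma rintegrable0 : rintegrable (fun=> 0).
Proof. exact: integrable0. Qed.

Lemma rintegrable_sum (I : Type) (s : seq I) (P : pred I) (f : I -> T -> R) :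
  (forall i, rintegrable (f i)) -> rintegrable (fun x => \sum_(i <- s | P i) f i x).
Proof.
move=> hf; elim: s => [|i s IH].
  by under eq_fun do rewrite big_nil; exact: rintegrable0.
under eq_fun do rewrite big_cons; case: (P i) => //; exact: rintegrableD.
Qed.

Lemma rintegrable_norm f : rintegrable f -> rintegrable (fun x => `|f x|).
Proof. exact: integrable_norm. Qed.

Lemma rintegrableP f : measurable_fun setT f ->
  (\int[mu]_x `|f x|%:E < +oo)%E -> rintegrable f.
Proof. by move=> mf foo; apply/integrableP; split => //; exact/measurable_EFinP. Qed.

Lemma rintegrable_ge0P f : measurable_fun setT f -> (forall x, 0 <= f x) ->
  (\int[mu]_x (f x)%:E < +oo)%E -> rintegrable f.
Proof.
move=> mf f0 foo; apply: rintegrableP => //.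
by under eq_integral do rewrite ger0_norm//.
Qed.

Lemma rintegrable_lty f : rintegrable f -> (\int[mu]_x (f x)%:E < +oo)%E.
Proof. by move=> hf; rewrite integrable_lty. Qed.

Lemma EFin_Rintegral f : rintegrable f -> (\int[mu]_x f x)%:E = (\int[mu]_x (f x)%:E)%E.
Proof. by move=> hf; rewrite /Rintegral fineK// integrable_fin_num. Qed.

Lemma Rintegral_sum (I : Type) (s : seq I) (P : pred I) (f : I -> T -> R) :
  (forall i, rintegrable (f i)) ->
  \int[mu]_x (\sum_(i <- s | P i) f i x) = \sum_(i <- s | P i) \int[mu]_x f i x.
Proof.
move=> hf; elim: s => [|i s IH].
  by rewrite big_nil; under eq_Rintegral do rewrite big_nil; rewrite /Rintegral integral0.
rewrite big_cons; under eq_Rintegral do rewrite big_cons.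
case: (P i) => //; rewrite RintegralD// ?IH//; [exact: hf|exact: rintegrable_sum].
Qed.

Lemma Rintegral_dct (f_ : nat -> T -> R) f g : (forall n, measurable_fun setT (f_ n)) ->
  (forall x, f_ ^~ x @ \oo --> f x) -> rintegrable g -> (forall n x, `|f_ n x| <= g x) ->
  rintegrable f /\ (fun n => \int[mu]_x f_ n x) @ \oo --> \int[mu]_x f x.
Proof.
move=> mf_ ff ig fg.
have mf : measurable_fun setT f by apply: (measurable_fun_cvg mf_) => x _; exact: ff.
have if_ n : rintegrable (f_ n) by exact: rintegrable_le (fg n).
have [] := @dominated_convergence _ _ _ mu setT measurableT (fun n x => (f_ n x)%:E)
   (fun x => (f x)%:E) (fun x => (g x)%:E).
- by move=> n; exact/measurable_EFinP.
- exact/measurable_EFinP.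
- by apply: aeW => x _; apply: cvg_EFin; [exact: nearW|exact: ff].
- exact: ig.
- by apply: aeW => x n _; rewrite lee_fin.
move=> if0 _ h; split => //.
have h' : (fun n => (\int[mu]_x f_ n x)%:E) @ \oo --> (\int[mu]_x f x)%:E.
  rewrite EFin_Rintegral//; apply: cvg_trans h; apply: near_eq_cvg; apply: nearW => n.
  by rewrite EFin_Rintegral.
exact: (fine_cvg h').
Qed.

Lemma Rintegral_ae_eq f g : rintegrable f -> measurable_fun setT g ->
  {ae mu, forall x, f x = g x} -> rintegrable g /\ \int[mu]_x f x = \int[mu]_x g x.
Proof.
move=> ff mg fg.
have fg' : ae_eq mu setT (fun x => (f x)%:E) (fun x => (g x)%:E).
  by move: fg; apply: filterS => x -> _.
have mf : measurable_fun setT (fun x => (f x)%:E) := measurable_int mu ff.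
have mg' : measurable_fun setT (fun x => (g x)%:E) by exact/measurable_EFinP.
split; last by rewrite /Rintegral; congr fine; apply: ae_eq_integral.
apply: rintegrableP => //.
have [_] := integrableP _ _ _ ff; congr (_ < _)%E; apply: ae_eq_integral => //.
- exact: measurableT_comp.
- by apply/measurable_EFinP; exact: measurableT_comp.
- by move: fg; apply: filterS => x -> _.
Qed.

End RealIntegral.

Section ComplexIntegral.
Context d (T : measurableType d) (R : realType).
Variable mu : {measure set T -> \bar R}.
Implicit Types (f g : T -> R[i]).

Lemma cmeasurable_cst (c : R[i]) : cmeasurable (fun _ : T => c).
Proof. by split; exact: measurable_cst. Qed.

Lemma cmeasurableD f g : cmeasurable f -> cmeasurable g ->
  cmeasurable (fun x => f x + g x).
Proof.
move=> [h1 h2] [h3 h4]; split.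
- by under eq_fun do rewrite cReD; exact: measurable_funD.
- by under eq_fun do rewrite cImD; exact: measurable_funD.
Qed.

Lemma cmeasurableM f g : cmeasurable f -> cmeasurable g ->
  cmeasurable (fun x => f x * g x).
Proof.
move=> [h1 h2] [h3 h4]; split.
- by under eq_fun do rewrite cReM; apply: measurable_funB; exact: measurable_funM.
- by under eq_fun do rewrite cImM; apply: measurable_funD; exact: measurable_funM.
Qed.

Lemma cmeasurable_real (h : T -> R) : measurable_fun setT h -> cmeasurable (fun x => (h x)%:C).
Proof. by move=> mh; split => //; exact: measurable_cst. Qed.

Lemma cmeasurable_conjc f : cmeasurable f -> cmeasurable (fun x => conjc (f x)).
Proof.
move=> [h1 h2]; split.
- by under eq_fun do rewrite cRe_conjc.
- by under eq_fun do rewrite cIm_conjc; exact: measurable_funN.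
Qed.

Lemma cmeasurableX f n : cmeasurable f -> cmeasurable (fun x => f x ^+ n).
Proof.
move=> mf; elim: n => [|n IH]; first by under eq_fun do rewrite expr0; exact: cmeasurable_cst.
by under eq_fun do rewrite exprS; exact: cmeasurableM.
Qed.

Lemma cmeasurable_sum (I : Type) (s : seq I) (P : pred I) (f : I -> T -> R[i]) :
  (forall i, cmeasurable (f i)) -> cmeasurable (fun x => \sum_(i <- s | P i) f i x).
Proof.
move=> hf; elim: s => [|i s IH].
  by under eq_fun do rewrite big_nil; exact: cmeasurable_cst.
under eq_fun do rewrite big_cons; case: (P i) => //; exact: cmeasurableD.
Qed.

Lemma cmeasurable_cexp f : cmeasurable f -> cmeasurable (fun x => cexp (f x)).
Proof.
have mc : measurable_fun setT (@cos R) by apply: continuous_measurable_fun; exact: continuous_cos.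
have ms : measurable_fun setT (@sin R) by apply: continuous_measurable_fun; exact: continuous_sin.
by move=> [h1 h2]; split => /=; apply: measurable_funM; exact: measurableT_comp.
Qed.

Lemma measurable_normc2 f : cmeasurable f -> measurable_fun setT (fun x => normc (f x) ^+ 2).
Proof.
move=> [h1 h2]; under eq_fun do rewrite sqr_normcE.
by apply: measurable_funD; apply: measurable_funX.
Qed.

Lemma measurable_normc f : cmeasurable f -> measurable_fun setT (fun x => normc (f x)).
Proof.
move=> mf; under eq_fun do rewrite -[normc _]ger0_norm ?normc_ge0// -sqrtr_sqr.
have ms : measurable_fun setT (@Num.sqrt R).
  by apply: continuous_measurable_fun; exact: sqrt_continuous.
by apply: (measurableT_comp ms); exact: measurable_normc2.
Qed.

Lemma cmeasurable_lim (f_ : nat -> T -> R[i]) f : (forall n, cmeasurable (f_ n)) ->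
  (forall x, ctends (f_ ^~ x) (f x)) -> cmeasurable f.
Proof.
move=> mf ff; split.
- apply: (@measurable_fun_cvg _ _ _ _ (fun n x => complex.Re (f_ n x))).
    by move=> n; have [] := mf n.
  by move=> x _; have /ctends_ReIm[] := ff x.
- apply: (@measurable_fun_cvg _ _ _ _ (fun n x => complex.Im (f_ n x))).
    by move=> n; have [] := mf n.
  by move=> x _; have /ctends_ReIm[] := ff x.
Qed.

Lemma cintegrable_measurable f : cintegrable mu f -> cmeasurable f.
Proof. by move=> [h1 h2]; split; exact: (@rintegrable_measurable _ _ _ mu). Qed.

Lemma cintegrable_le f (g : T -> R) : cmeasurable f -> rintegrable mu g ->
  (forall x, normc (f x) <= g x) -> cintegrable mu f.
Proof.
move=> [h1 h2] ig fg; split; apply: rintegrable_le ig _ => // x.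
- by rewrite (le_trans (ler_Re_normc _)).
- by rewrite (le_trans (ler_Im_normc _)).
Qed.

Lemma cintegrable_normc f : cintegrable mu f -> rintegrable mu (fun x => normc (f x)).
Proof.
move=> h; have mf := cintegrable_measurable h; case: h => h1 h2.
have h3 := rintegrableD (rintegrable_norm h1) (rintegrable_norm h2).
apply: rintegrable_le h3 _; first exact: measurable_normc.
by move=> x; rewrite ger0_norm ?normc_ge0// normc_le_ReIm.
Qed.

Lemma cintegrableD f g : cintegrable mu f -> cintegrable mu g ->
  cintegrable mu (fun x => f x + g x).
Proof.
move=> [h1 h2] [h3 h4]; split.
- by under eq_fun do rewrite cReD; exact: rintegrableD.
- by under eq_fun do rewrite cImD; exact: rintegrableD.
Qed.

Lemma cintegralD f g : cintegrable mu f -> cintegrable mu g ->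
  cintegral mu (fun x => f x + g x) = cintegral mu f + cintegral mu g.
Proof.
move=> [h1 h2] [h3 h4]; rewrite /cintegral.
under eq_Rintegral do rewrite cReD; under [X in _ +i* X]eq_Rintegral do rewrite cImD.
by rewrite !RintegralD.
Qed.

Lemma cintegrableZ c f : cintegrable mu f -> cintegrable mu (fun x => c * f x).
Proof.
move=> h; have h1 := rintegrableZ (normc c) (cintegrable_normc h).
apply: cintegrable_le h1 _ => [|x]; last by rewrite normcM.
by apply: cmeasurableM; [exact: cmeasurable_cst|exact: cintegrable_measurable].
Qed.

Lemma cintegralZ c f : cintegrable mu f ->
  cintegral mu (fun x => c * f x) = c * cintegral mu f.
Proof.
move=> [h1 h2]; rewrite /cintegral.
under eq_Rintegral do rewrite cReM; under [X in _ +i* X]eq_Rintegral do rewrite cImM.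
rewrite RintegralB ?RintegralD//; try exact: rintegrableZ.
rewrite !RintegralZl//.
by case: c.
Qed.

Lemma cintegrable0 : cintegrable mu (fun=> 0).
Proof. by split; exact: rintegrable0. Qed.

Lemma cintegral0 : cintegral mu (fun=> 0) = 0.
Proof. by rewrite /cintegral/= /Rintegral integral0. Qed.

Lemma cintegrable_sum (I : Type) (s : seq I) (P : pred I) (f : I -> T -> R[i]) :
  (forall i, cintegrable mu (f i)) -> cintegrable mu (fun x => \sum_(i <- s | P i) f i x).
Proof.
move=> hf; elim: s => [|i s IH].
  by under eq_fun do rewrite big_nil; exact: cintegrable0.
under eq_fun do rewrite big_cons; case: (P i) => //; exact: cintegrableD.
Qed.

Lemma cintegral_sum (I : Type) (s : seq I) (P : pred I) (f : I -> T -> R[i]) :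
  (forall i, cintegrable mu (f i)) ->
  cintegral mu (fun x => \sum_(i <- s | P i) f i x) = \sum_(i <- s | P i) cintegral mu (f i).
Proof.
move=> hf; elim: s => [|i s IH].
  by rewrite big_nil; under eq_fun do rewrite big_nil; exact: cintegral0.
rewrite big_cons; under eq_fun do rewrite big_cons.
case: (P i) => //; rewrite cintegralD// ?IH//; exact: cintegrable_sum.
Qed.

Lemma cintegrable_real (h : T -> R) : rintegrable mu h -> cintegrable mu (fun x => (h x)%:C).
Proof. by move=> hh; split => //=; exact: rintegrable0. Qed.

Lemma cintegral_real (h : T -> R) : cintegral mu (fun x => (h x)%:C) = (\int[mu]_x h x)%:C.
Proof. by rewrite /cintegral /=; congr (_ +i* _); rewrite /Rintegral integral0. Qed.

Lemma cintegral_dct (f_ : nat -> T -> R[i]) f (g : T -> R) : (forall n, cmeasurable (f_ n)) ->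
  (forall x, ctends (f_ ^~ x) (f x)) -> rintegrable mu g ->
  (forall n x, normc (f_ n x) <= g x) ->
  cintegrable mu f /\ ctends (fun n => cintegral mu (f_ n)) (cintegral mu f).
Proof.
move=> mf_ ff ig fg.
have [|x||n x|i1 c1] := @Rintegral_dct _ _ _ mu (fun n x => complex.Re (f_ n x))
   (fun x => complex.Re (f x)) g.
- by move=> n; have [] := mf_ n.
- by have /ctends_ReIm[] := ff x.
- by [].
- by rewrite (le_trans (ler_Re_normc _)).
have [|x||n x|i2 c2] := @Rintegral_dct _ _ _ mu (fun n x => complex.Im (f_ n x))
   (fun x => complex.Im (f x)) g.
- by move=> n; have [] := mf_ n.
- by have /ctends_ReIm[] := ff x.
- by [].
- by rewrite (le_trans (ler_Im_normc _)).
by split; [split|apply/ctends_ReIm; split].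
Qed.

(** Dominated convergence applied to the partial sums. The kernel expansions below are integrated
    term by term through it. *)
Lemma cintegral_series (f_ : nat -> T -> R[i]) f (g : T -> R) :
  (forall n, cmeasurable (f_ n)) -> (forall x, ctends (series (f_ ^~ x)) (f x)) ->
  rintegrable mu g ->
  (forall n x, \sum_(0 <= k < n) normc (f_ k x) <= g x) ->
  [/\ cintegrable mu f, forall n, cintegrable mu (f_ n) &
   ctends (series (fun n => cintegral mu (f_ n))) (cintegral mu f)].
Proof.
move=> mf_ ff ig fg.
have if_ n : cintegrable mu (f_ n).
  apply: cintegrable_le ig _ => // x; rewrite (le_trans _ (fg n.+1 x))//.
  by rewrite big_nat_recr//= lerDr sumr_ge0// => i _; exact: normc_ge0.
have [|x||n x|h1 h2] := @cintegral_dct (fun n x => series (f_ ^~ x) n) f g.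
- by move=> n; exact: cmeasurable_sum.
- exact: ff.
- by [].
- exact: le_trans (le_normc_sum _ _ _) (fg n x).
split => //; move: h2; congr ctends; apply/funext => n.
by rewrite /series/= cintegral_sum.
Qed.

Lemma cintegral_ae_eq f g : cintegrable mu f -> cmeasurable g ->
  {ae mu, forall x, f x = g x} -> cintegral mu f = cintegral mu g.
Proof.
move=> [h1 h2] [h3 h4] fg; rewrite /cintegral; congr (_ +i* _).
- by apply: (Rintegral_ae_eq h1 h3 _).2; move: fg; apply: filterS => x ->.
- by apply: (Rintegral_ae_eq h2 h4 _).2; move: fg; apply: filterS => x ->.
Qed.

End ComplexIntegral.

(** * Bessel's inequality and the Riesz-Fischer theorem *)

Section Fatou.
Context d (T : measurableType d) (R : realType).
Variable mu : {measure set T -> \bar R}.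

(** Fatou's lemma applied to the sequence shifted by [N]. The bound is asked only from [N] on
    because the tail estimate for orthonormal sums holds only past a given index. *)
Lemma le_integral_lim (f_ : nat -> T -> R) (f : T -> R) (B : R) N :
  (forall n, measurable_fun setT (f_ n)) -> (forall n x, 0 <= f_ n x) ->
  (forall x, f_ ^~ x @ \oo --> f x) ->
  (forall n, (N <= n)%N -> \int[mu]_x (f_ n x)%:E <= B%:E)%E ->
  (\int[mu]_x (f x)%:E <= B%:E)%E.
Proof.
move=> mf f0 ff fB.
pose g n x := (f_ (n + N)%N x)%:E.
have := @fatou _ _ _ mu setT measurableT g.
move=> /(_ (fun n => (measurable_EFinP _ _).2 (mf _))).
move=> /(_ (fun n x _ => f0 _ x)).
rewrite (_ : (fun x => limn_einf (g ^~ x)) = (fun x => (f x)%:E)); last first.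
  apply/funext => x.
  have h : g ^~ x @ \oo --> (f x)%:E.
    apply: cvg_EFin; first exact: nearW.
    by rewrite (cvg_shiftn N (fun n => f_ n x)).
  have hc : cvgn (g ^~ x) by apply/cvg_ex; exists (f x)%:E.
  by rewrite is_cvg_limn_einfE//; apply/cvg_lim.
move=> h; apply: (le_trans h).
rewrite limn_einf_lim; apply: lime_le; first exact: is_cvg_einfs.
apply: nearW => n; apply: (@le_trans _ _ (\int[mu]_x g n x)%E); last by apply: fB; exact: leq_addl.
by apply: ereal_inf_lbound; exists n => /=.
Qed.

End Fatou.

Section RealL2.
Context d (T : measurableType d) (R : realType).
Variable mu : {measure set T -> \bar R}.
Implicit Types (f g : T -> R) (c : nat -> R).

Definition rL2 f := measurable_fun setT f /\ rintegrable mu (fun x => f x ^+ 2).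

Lemma rintegrableM f g : rL2 f -> rL2 g -> rintegrable mu (fun x => f x * g x).
Proof.
move=> [mf hf] [mg hg]; apply: rintegrable_le (rintegrableD hf hg) _.
  exact: measurable_funM.
move=> x; have h1 := sqr_ge0 (f x + g x); have h2 := sqr_ge0 (f x - g x).
have h3 := sqr_ge0 (f x); have h4 := sqr_ge0 (g x).
by rewrite ler_norml; apply/andP; split; nra.
Qed.

Lemma rL2Z k f : rL2 f -> rL2 (fun x => k * f x).
Proof.
move=> [mf hf]; split; first exact: measurable_funM.
by under eq_fun do rewrite exprMn; exact: rintegrableZ.
Qed.

Lemma rL2D f g : rL2 f -> rL2 g -> rL2 (fun x => f x + g x).
Proof.
move=> hf hg; split; first by case: hf hg => [mf _] [mg _]; exact: measurable_funD.
rewrite (_ : (fun x => _) = (fun x => f x ^+ 2 + 2 * (f x * g x) + g x ^+ 2)); last first.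
  by apply/funext => x; ring.
have hfg := rintegrableM hf hg; case: hf hg => [_ hf] [_ hg].
by apply: rintegrableD hg; apply: rintegrableD hf _; exact: rintegrableZ.
Qed.

Lemma rL2B f g : rL2 f -> rL2 g -> rL2 (fun x => f x - g x).
Proof.
move=> hf /(rL2Z (-1)) hg; under eq_fun do rewrite -mulN1r; exact: rL2D.
Qed.

Lemma rL2_0 : rL2 (fun=> 0).
Proof.
by split; [exact: measurable_cst|under eq_fun do rewrite expr0n; exact: rintegrable0].
Qed.

Lemma rL2_sum (I : Type) (s : seq I) (f : I -> T -> R) : (forall i, rL2 (f i)) ->
  rL2 (fun x => \sum_(i <- s) f i x).
Proof.
move=> hf; elim: s => [|i s IH]; first by under eq_fun do rewrite big_nil; exact: rL2_0.
by under eq_fun do rewrite big_cons; exact: rL2D.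
Qed.

Variable e : nat -> T -> R.
Definition orthonormal_seq := (forall k, rL2 (e k)) /\
  forall j k, \int[mu]_x (e j x * e k x) = (j == k)%:R.

Hypothesis eON : orthonormal_seq.
Let eL2 k : rL2 (e k). Proof. by case: eON. Qed.

Definition psum c m n x := \sum_(m <= k < n) c k * e k x.

Lemma rL2_psum c m n : rL2 (psum c m n).
Proof. by apply: rL2_sum => k; exact: rL2Z. Qed.

Lemma Rintegral_mul_psum c f m n : rL2 f ->
  \int[mu]_x (f x * psum c m n x) = \sum_(m <= k < n) c k * \int[mu]_x (f x * e k x).
Proof.
move=> hf; under eq_Rintegral do rewrite /psum mulr_sumr.
rewrite Rintegral_sum; last by move=> k; apply: rintegrableM => //; exact: rL2Z.
apply: eq_bigr => k _; rewrite -RintegralZl//; last exact: rintegrableM.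
by apply: eq_Rintegral => x _; rewrite mulrCA.
Qed.

Lemma Rintegral_psum_mul c m n k : (m <= k < n)%N ->
  \int[mu]_x (psum c m n x * e k x) = c k.
Proof.
move=> kmn; under eq_Rintegral do rewrite mulrC.
rewrite Rintegral_mul_psum//.
under eq_bigr => i _ do rewrite eON.2.
rewrite (bigD1_seq k) ?mem_index_iota ?iota_uniq//= eqxx mulr1 big1 ?addr0// => i.
by rewrite eq_sym => /negbTE ->; rewrite mulr0.
Qed.

Lemma Rintegral_sqr_psum c m n :
  \int[mu]_x (psum c m n x ^+ 2) = \sum_(m <= k < n) c k ^+ 2.
Proof.
under eq_Rintegral do rewrite expr2.
rewrite Rintegral_mul_psum; last exact: rL2_psum.
by apply: eq_big_nat => k kmn; rewrite Rintegral_psum_mul.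
Qed.

Lemma Rintegral_sqr_sub f c m n : rL2 f ->
  \int[mu]_x ((f x - psum c m n x) ^+ 2) = \int[mu]_x (f x ^+ 2)
  - 2 * (\sum_(m <= k < n) c k * \int[mu]_x (f x * e k x)) + \sum_(m <= k < n) c k ^+ 2.
Proof.
move=> hf; have hp := rL2_psum c m n; have hfp := rintegrableM hf hp.
rewrite (_ : (fun x => _) = (fun x => f x ^+ 2 - 2 * (f x * psum c m n x) +
  psum c m n x ^+ 2)); last by apply/funext => x; ring.
have h1 := hf.2; have h2 := hp.2; have h3 := rintegrableZ 2 hfp.
rewrite RintegralD ?RintegralB ?RintegralZl//; last exact: rintegrableB.
by rewrite Rintegral_mul_psum// Rintegral_sqr_psum.
Qed.

Lemma bessel f n : rL2 f ->
  \sum_(0 <= k < n) (\int[mu]_x (f x * e k x)) ^+ 2 <= \int[mu]_x (f x ^+ 2).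
Proof.
move=> hf; pose c k := \int[mu]_x (f x * e k x).
have : 0 <= \int[mu]_x ((f x - psum c 0 n x) ^+ 2).
  by apply: Rintegral_ge0 => x _; exact: sqr_ge0.
rewrite Rintegral_sqr_sub// -/c.
rewrite [X in 2 * X](_ : _ = \sum_(0 <= k < n) c k ^+ 2); last first.
  by apply: eq_bigr => k _; rewrite expr2.
rewrite -[X in _ -> X <= _]/(\sum_(0 <= k < n) c k ^+ 2).
by move: (\sum_(_ <= k < _) _) => s; lra.
Qed.

Lemma bessel1 f k : rL2 f -> (\int[mu]_x (f x * e k x)) ^+ 2 <= \int[mu]_x (f x ^+ 2).
Proof.
move=> hf; apply: le_trans (bessel k.+1 hf); rewrite big_nat_recr//= lerDr.
by apply: sumr_ge0 => i _; exact: sqr_ge0.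
Qed.

Section Limit.
Variables (c : nat -> R) (nn : nat -> nat) (f : T -> R).
Hypothesis cc : cvgn (series (fun k => c k ^+ 2)).
Hypothesis nn_ge : forall j, (j <= nn j)%N.
Hypothesis ff : forall x, (fun j => psum c 0 (nn j) x) @ \oo --> f x.
Let s := series (fun k => c k ^+ 2).
Let L := limn s.

Let s_nd : nondecreasing_seq s.
Proof. by apply: nondecreasing_series => k _ _; exact: sqr_ge0. Qed.

Let sL n : s n <= L. Proof. exact: nondecreasing_cvgn_le. Qed.

Let mf : measurable_fun setT f.
Proof. by apply: (measurable_fun_cvg (fun j => (rL2_psum c 0 (nn j)).1)) => x _; exact: ff. Qed.

(** The block of the sum from n to [nn j] has squared norm s (nn j) - s n, which is at most L - s n.
    Fatou along the subsequence transfers the bound to f, so the whole sequence of partial sums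
    converges to f in mean square. *)
Let tail n : rL2 (fun x => f x - psum c 0 n x) /\
  \int[mu]_x ((f x - psum c 0 n x) ^+ 2) <= L - s n.
Proof.
have h : (\int[mu]_x ((f x - psum c 0 n x) ^+ 2)%:E <= (L - s n)%:E)%E.
  apply: (@le_integral_lim _ _ _ mu
    (fun j x => (psum c 0 (nn j) x - psum c 0 n x) ^+ 2) _ _ n).
  - move=> j; apply: measurable_funX; apply: measurable_funB; exact: (rL2_psum _ _ _).1.
  - by move=> j x; exact: sqr_ge0.
  - move=> x; rewrite expr2; under eq_fun do rewrite expr2.
    by apply: cvgM; apply: cvgB; try exact: ff; exact: cvg_cst.
  - move=> j nj; have nnj := leq_trans nj (nn_ge j).
    have E : (fun x => (psum c 0 (nn j) x - psum c 0 n x) ^+ 2) = (fun x => psum c n (nn j) x ^+ 2).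
      by apply/funext => x; rewrite /psum (big_cat_nat (leq0n n) nnj)/= addrAC subrr add0r.
    rewrite -EFin_Rintegral; last first.
      by rewrite E; exact: (rL2_psum _ _ _).2.
    rewrite E Rintegral_sqr_psum lee_fin lerBrDr.
    have <- : s (nn j) = \sum_(n <= k < nn j) c k ^+ 2 + s n.
      by rewrite /s /series/= (big_cat_nat (leq0n n) nnj)/= addrC.
    exact: sL.
have mg : measurable_fun setT (fun x => f x - psum c 0 n x).
  by apply: measurable_funB => //; exact: (rL2_psum _ _ _).1.
have ig : rintegrable mu (fun x => (f x - psum c 0 n x) ^+ 2).
  apply: rintegrable_ge0P; [exact: measurable_funX|by move=> x; exact: sqr_ge0|].
  by rewrite (le_lt_trans h)// ltry.
by split => //; rewrite -lee_fin EFin_Rintegral.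
Qed.

Let fL2 : rL2 f.
Proof.
have [h _] := tail 0%N; have := rL2D h (rL2_psum c 0 0).
by congr rL2; apply/funext => x; rewrite subrK.
Qed.

(** Once k < n, the k-th coefficient of f minus its n-th partial sum is the difference of the two
    sides. Bessel's inequality for a single function bounds its square by L - s n, which tends to
    0. *)
Lemma Rintegral_limit_mul k : \int[mu]_x (f x * e k x) = c k.
Proof.
apply/eqP; rewrite -subr_eq0 -sqrf_eq0; apply/eqP/le_anti; rewrite sqr_ge0 andbT.
have h n : (k < n)%N -> (\int[mu]_x (f x * e k x) - c k) ^+ 2 <= L - s n.
  move=> kn; have [h1 h2] := tail n; apply: le_trans h2.
  apply: le_trans (bessel1 k h1); rewrite le_eqVlt; apply/orP; left; apply/eqP.
  congr (_ ^+ 2); rewrite -{1}(@Rintegral_psum_mul c 0 n k)//.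
  rewrite -RintegralB//; [|exact: rintegrableM|by apply: rintegrableM => //; exact: rL2_psum].
  by apply: eq_Rintegral => x _; rewrite mulrBl.
have c0 : (fun n => L - s n) @ \oo --> (0 : R).
  by rewrite -[0](subrr L); apply: cvgB; [exact: cvg_cst|exact: cc].
rewrite -(cvg_lim _ c0)//; apply: limr_ge; first by apply/cvg_ex; eexists; exact: c0.
by exists k.+1 => // n /= kn; exact: h.
Qed.

(** The tail bound at n = 0 gives one inequality; nonnegativity of the residual for every n gives
    the other. *)
Lemma Rintegral_limit_sqr : \int[mu]_x (f x ^+ 2) = L.
Proof.
have h n : \int[mu]_x ((f x - psum c 0 n x) ^+ 2) = \int[mu]_x (f x ^+ 2) - s n.
  rewrite Rintegral_sqr_sub//.
  under eq_bigr do rewrite Rintegral_limit_mul -expr2.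
  rewrite (_ : s n = \sum_(0 <= k < n) c k ^+ 2)//.
  move: (\sum_(_ <= k < _) _) => t; lra.
apply/eqP; rewrite eq_le; apply/andP; split.
  have [_] := tail 0%N; rewrite h; lra.
apply: limr_le => //; apply: nearW => n; rewrite -subr_ge0 -h.
by apply: Rintegral_ge0 => x _; exact: sqr_ge0.
Qed.

Lemma rL2_limit : rL2 f. Proof. exact: fL2. Qed.

End Limit.

End RealL2.

Lemma sum_half_powers (R : realType) n :
  \sum_(0 <= k < n) 2^-1 ^+ k = 2 - 2 * 2^-1 ^+ n :> R.
Proof.
elim: n => [|n IH]; first by rewrite big_nil expr0; lra.
rewrite big_nat_recr//= IH exprS; lra.
Qed.

Section RieszFischer.
Context d (T : measurableType d) (R : realType).
Variable mu : {measure set T -> \bar R}.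

Lemma cvg_fast_subseq (s : nat -> R) (L : R) : s @ \oo --> L ->
  exists nn : nat -> nat, [/\ forall j, (j <= nn j)%N, {homo nn : m n / (m <= n)%N} &
    forall j n, (nn j <= n)%N -> `|L - s n| <= 4^-1 ^+ j].
Proof.
move=> sL.
have h j : exists N, forall n, (N <= n)%N -> `|L - s n| <= 4^-1 ^+ j.
  have e0 : 0 < 4^-1 ^+ j :> R by rewrite exprn_gt0// invr_gt0.
  by have /cvgrPdist_le /(_ _ e0)[N _ hN] := sL; exists N => n /hN.
have [N hN] := choice h.
(* Summing all thresholds up to j makes the subsequence monotone and at least [N j]; the summand j
   makes it at least the identity. *)
exists (fun j => j + \sum_(0 <= i < j.+1) N i)%N; split.
- by move=> j; exact: leq_addr.
- move=> m n mn; apply: leq_add => //.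
  by rewrite [leqRHS](big_cat_nat (leq0n m.+1))/= ?leq_addr// ltnS.
- move=> j n jn; apply: hN; apply: leq_trans jn.
  by rewrite big_nat_recr//= addnA leq_addl.
Qed.

(** Monotone convergence: the sum of the series has integral at most [B], hence is finite almost
    everywhere. *)
Lemma rintegrable_series_lty (g : nat -> T -> R) (B : R) : (forall n x, 0 <= g n x) ->
  (forall n, rintegrable mu (g n)) ->
  (forall n, \sum_(0 <= k < n) \int[mu]_x g k x <= B) ->
  {ae mu, forall x, cvgn (series (g ^~ x))}.
Proof.
move=> g0 ig gB.
have mg n : measurable_fun setT (fun x => (g n x)%:E).
  by apply/measurable_EFinP; exact: rintegrable_measurable (ig n).
have h : (\int[mu]_x (\sum_(0 <= n <oo) (g n x)%:E) <= B%:E)%E.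
  rewrite integral_nneseries//; last by move=> n x _; rewrite lee_fin.
  apply: lime_le; first by apply: is_cvg_nneseries => n _ _; apply: integral_ge0 => x _; rewrite lee_fin.
  apply: nearW => n.
  rewrite (eq_bigr (fun k => (\int[mu]_x g k x)%:E)); last by move=> k _; rewrite EFin_Rintegral.
  by rewrite sumEFin lee_fin.
have : mu.-integrable setT (fun x => \sum_(0 <= n <oo) (g n x)%:E)%E.
  apply/integrableP; split.
    by apply: ge0_emeasurable_sum => // n x _; rewrite lee_fin.
  apply: le_lt_trans (ltry B); apply: le_trans h.
  rewrite le_eqVlt; apply/orP; left; apply/eqP; apply: eq_integral => x _.
  by rewrite gee0_abs// nneseries_ge0// => n _ _; rewrite lee_fin.
move=> /(integrable_ae measurableT); apply: filterS => x /(_ Logic.I) fx.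
have nd : nondecreasing_seq (series (g ^~ x)) by apply: nondecreasing_series => n _ _.
apply: nondecreasing_is_cvgn => //; exists (fine (\sum_(0 <= n <oo) (g n x)%:E)%E).
move=> _ [n _ <-]; rewrite -lee_fin fineK//.
rewrite /series/= -sumEFin.
by apply: nneseries_lim_ge => k _; rewrite lee_fin.
Qed.

Variable e : nat -> T -> R.
Hypothesis eON : orthonormal_seq mu e.
Variable c : nat -> R.
Hypothesis cc : cvgn (series (fun k => c k ^+ 2)).

(* Along a subsequence whose tails are bounded by 4^-j, the squares of the
   blocks D_j of the partial sums satisfy \sum_j 2^j D_j^2 < oo almost everywhere,
   and |D_j| <= 2^-j + 2^j D_j^2 makes the subsequence converge there. *)
Lemma riesz_fischer : exists f, [/\ rL2 mu f,
  forall k, \int[mu]_x (f x * e k x) = c k &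
  \int[mu]_x (f x ^+ 2) = limn (series (fun k => c k ^+ 2))].
Proof.
set s := series (fun k => c k ^+ 2); set L := limn s.
have s_nd : nondecreasing_seq s by apply: nondecreasing_series => k _ _; exact: sqr_ge0.
have sL n : s n <= L by exact: nondecreasing_cvgn_le.
have [nn [nn_ge nn_nd nnL]] := cvg_fast_subseq (cc : s @ \oo --> L).
pose D j x := psum e c (nn j) (nn j.+1) x.
have ID j : \int[mu]_x (D j x ^+ 2) <= 4^-1 ^+ j.
  rewrite (Rintegral_sqr_psum eON).
  have -> : \sum_(nn j <= k < nn j.+1) c k ^+ 2 = s (nn j.+1) - s (nn j).
    rewrite /s /series/= [X in _ = X - _](big_cat_nat (leq0n (nn j)) (nn_nd _ _ (leqnSn j)))/=.
    by rewrite addrAC subrr add0r.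
  have h1 := nnL j (nn j) (leqnn _); have h2 := sL (nn j.+1).
  apply: le_trans h1; apply: le_trans (ler_norm _); rewrite lerB//.
have DL2 j : rL2 mu (D j) by exact: rL2_psum.
have : {ae mu, forall x, cvgn (series (fun j => 2 ^+ j * D j x ^+ 2))}.
  apply: (@rintegrable_series_lty _ 2).
  - by move=> n x; rewrite mulr_ge0 ?sqr_ge0// exprn_ge0.
  - by move=> n; apply: rintegrableZ; exact: (DL2 n).2.
  - move=> n; apply: (@le_trans _ _ (\sum_(0 <= k < n) 2^-1 ^+ k)).
      apply: ler_sum => k _; rewrite RintegralZl//; last exact: (DL2 k).2.
      apply: (@le_trans _ _ (2 ^+ k * 4^-1 ^+ k)); first by rewrite ler_wpM2l// exprn_ge0.
      by rewrite -exprMn (_ : 2 * 4^-1 = 2^-1)//; lra.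
    rewrite sum_half_powers.
    by rewrite lerBlDr lerDl mulr_ge0// exprn_ge0// invr_ge0.
move=> [N [mN N0 hN]].
(* Multiplying by the indicator of the complement of the null set makes the subsequence converge at
   every point, as the limit lemmas above require. Integrals are unchanged, so the modified family
   is still orthonormal. *)
pose chi x : R := \1_(~` N) x.
have mchi : measurable_fun setT chi by apply: measurable_indic; exact: measurableC.
have chiE : {ae mu, forall x, chi x = 1}.
  exists N; split => // x /= hx; apply: contrapT => nx; apply: hx.
  by rewrite /chi indicE mem_set.
pose e' k x := chi x * e k x.
have me k : measurable_fun setT (e k) := (eON.1 k).1.
have eL2 := eON.1.
have e'L2 k : rL2 mu (e' k).
  split; first exact: measurable_funM.
  apply: (Rintegral_ae_eq (eL2 k).2 _ _).1.
    by apply: measurable_funX; exact: measurable_funM.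
  by move: chiE; apply: filterS => x; rewrite /e' => ->; rewrite mul1r.
have e'ON : orthonormal_seq mu e'.
  split => // j k; rewrite -(eON.2 j k); apply/esym.
  apply: (Rintegral_ae_eq (rintegrableM (eL2 j) (eL2 k)) _ _).2.
    by apply: measurable_funM; exact: measurable_funM.
  by move: chiE; apply: filterS => x; rewrite /e' => ->; rewrite !mul1r.
have psum' m n x : psum e' c m n x = chi x * psum e c m n x.
  by rewrite /psum mulr_sumr; apply: eq_bigr => k _; rewrite /e' mulrCA.
have cv x : cvgn (fun j => psum e' c 0 (nn j) x).
  have -> : (fun j => psum e' c 0 (nn j) x) = (fun j => chi x * psum e c 0 (nn j) x).
    by apply/funext => j; rewrite psum'.
  have [xN|xN] := pselect (N x).
    have chi0 : chi x = 0 by rewrite /chi indicE memNset// => /(_ xN).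
    rewrite chi0.
    by under eq_fun do rewrite mul0r; exact: is_cvg_cst.
  apply: is_cvgMr.
  have h : cvgn (series (fun j => 2 ^+ j * D j x ^+ 2)).
    by apply: contrapT => hx; apply: xN; exact: hN.
  have hD : cvgn (series (fun j => D j x)).
    apply: normed_cvg.
    apply: (@series_le_cvg _ _ (fun j => 2^-1 ^+ j + 2 ^+ j * D j x ^+ 2)).
    - by move=> j /=.
    - move=> j; apply: addr_ge0; first by rewrite exprn_ge0// invr_ge0.
      by apply: mulr_ge0; [rewrite exprn_ge0|exact: sqr_ge0].
    - move=> j /=.
      have p0 : 0 < 2 ^+ j :> R by rewrite exprn_gt0.
      rewrite exprVn; set p : R := 2 ^+ j in p0 *.
      rewrite -(ler_pM2l p0) mulrDr divff ?gt_eqF// -(real_normK (num_real (D j x))).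
      have := sqr_ge0 (p * `|D j x| - 1); have := normr_ge0 (D j x).
      nra.
    - rewrite (_ : series _ = series (fun j => 2^-1 ^+ j) \+ series (fun j => 2 ^+ j * D j x ^+ 2)).
        apply: is_cvgD => //.
        rewrite (_ : (fun j => 2^-1 ^+ j) = geometric 1 (2^-1)); last first.
          by apply/funext => j; rewrite /geometric/= mul1r.
        apply: is_cvg_geometric_series; rewrite ger0_norm ?invr_ge0//; lra.
      by apply/funext => n; rewrite /series/= big_split.
  have E : (fun j => psum e c 0 (nn j) x) = (fun j => psum e c 0 (nn 0%N) x + series (fun j => D j x) j).
    apply/funext => j; elim: j => [|j IH]; first by rewrite /series/= big_nil addr0.
    rewrite /series/= big_nat_recr//= addrA -[X in X + _]IH.
    by rewrite /D /psum (big_cat_nat (leq0n (nn j)) (nn_nd _ _ (leqnSn j))).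
  rewrite E; apply: is_cvgD => //; exact: is_cvg_cst.
pose f x := limn (fun j => psum e' c 0 (nn j) x).
have ff x : (fun j => psum e' c 0 (nn j) x) @ \oo --> f x by exact: cv.
have fL2 := rL2_limit e'ON cc nn_ge ff.
exists f; split => //.
- move=> k; rewrite -(Rintegral_limit_mul e'ON cc nn_ge ff k); apply/esym.
  apply: (Rintegral_ae_eq (rintegrableM fL2 (e'L2 k)) _ _).2.
    by apply: measurable_funM; [exact: fL2.1|].
  by move: chiE; apply: filterS => x; rewrite /e' => ->; rewrite mul1r.
- exact: (Rintegral_limit_sqr e'ON cc nn_ge ff).
Qed.

End RieszFischer.

(** * Goursat's theorem and the mean value property *)

Section SegmentIntegral.
Variable R : realType.
Notation leb := (@lebesgue_measure R).
Implicit Types (a b m : R) (h : R -> R) (f g : R -> R[i]).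

Lemma continuous_integrable_itv h a b : continuous h ->
  leb.-integrable `[a, b] (EFin \o h).
Proof.
move=> ch; apply: continuous_compact_integrable; first exact: segment_compact.
exact: continuous_subspaceT.
Qed.

Lemma Rintegral_itv_add h a m b : continuous h -> a <= m -> m <= b ->
  \int[leb]_(x in `[a, b]) h x = \int[leb]_(x in `[a, m]) h x + \int[leb]_(x in `[m, b]) h x.
Proof.
move=> ch am mb.
have ih := continuous_integrable_itv a b ch.
have := @Rintegral_itvB _ h (BLeft a) (BRight b) m ih.
rewrite !bnd_simp => /(_ am mb) E.
have E2 : \int[leb]_(x in `]m, b]) h x = \int[leb]_(x in `[m, b]) h x.
  apply: Rintegral_itv_obnd_cbnd; apply: (integrableS _ _ _ ih) => //.
  by apply: subset_itvr; rewrite bnd_simp.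
by rewrite -E2 -E addrC subrK.
Qed.

Lemma Rintegral_itv_id a b : a <= b ->
  \int[leb]_(x in `[a, b]) x = (b ^+ 2 - a ^+ 2) / 2.
Proof.
rewrite le_eqVlt => /predU1P[->|ab]; first by rewrite set_itv1 Rintegral_set1 subrr mul0r.
have dF (x : R) : is_derive (x : R^o) (1 : R^o) (fun y : R^o => 2^-1 * y ^+ 2 : R^o) x.
  apply: is_derive_eq; rewrite /GRing.scale /=; lra.
have cF : continuous (fun y : R => 2^-1 * y ^+ 2).
  by move=> x; apply/differentiable_continuous/derivable1_diffP; exact: ex_derive.
rewrite /Rintegral (@continuous_FTC2 _ _ (fun y : R => 2^-1 * y ^+ 2))//=.
- lra.
- by apply: continuous_subspaceT => x; exact: cvg_id.
- split => [x _||]; [exact: ex_derive|exact: cvg_at_right_filter (cF a)|exact: cvg_at_left_filter (cF b)].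
- by move=> x _; rewrite derive1E derive_val.
Qed.

Lemma Rintegral_itv_cst a b k : a <= b -> \int[leb]_(x in `[a, b]) k = k * (b - a).
Proof.
move=> ab; rewrite Rintegral_cst//= lebesgue_measure_itv/= lte_fin.
by case: ltP => //= ba; have -> : b = a by [apply/le_anti; rewrite ab ba]; rewrite subrr.
Qed.

Lemma normr_Rintegral_itv_le h a b K : continuous h -> a <= b ->
  (forall x, a <= x <= b -> `|h x| <= K) -> `|\int[leb]_(x in `[a, b]) h x| <= K * (b - a).
Proof.
move=> ch ab hK; have ih := continuous_integrable_itv a b ch.
rewrite (le_trans (le_normr_Rintegral _ ih))// -Rintegral_itv_cst//.
apply: le_Rintegral => //.
- exact: integrable_norm.
- by apply: continuous_integrable_itv => x; exact: cvg_cst.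
Qed.

Definition cpath f := continuous (fun x => complex.Re (f x)) /\ continuous (fun x => complex.Im (f x)).

Definition sint a b f : R[i] :=
  (\int[leb]_(x in `[a, b]) complex.Re (f x)) +i* (\int[leb]_(x in `[a, b]) complex.Im (f x)).

Lemma sint_add f a m b : cpath f -> a <= m -> m <= b -> sint a b f = sint a m f + sint m b f.
Proof. by move=> [c1 c2] am mb; rewrite /sint (Rintegral_itv_add c1 am mb) (Rintegral_itv_add c2 am mb). Qed.

Lemma sintB f g a b : cpath f -> cpath g -> sint a b (fun x => f x - g x) = sint a b f - sint a b g.
Proof.
move=> [c1 c2] [c3 c4]; rewrite /sint.
under eq_Rintegral do rewrite cReD cReN; under [X in _ +i* X]eq_Rintegral do rewrite cImD cImN.
by rewrite !RintegralB//; exact: continuous_integrable_itv.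
Qed.

(** The factor 2 comes from estimating the real and imaginary parts separately. *)
Lemma normc_sint_le f a b K : cpath f -> a <= b ->
  (forall x, a <= x <= b -> normc (f x) <= K) -> normc (sint a b f) <= 2 * K * (b - a).
Proof.
move=> [c1 c2] ab fK; rewrite (le_trans (normc_le_ReIm _))//= -mulrA mulr_natl mulr2n.
apply: lerD; apply: normr_Rintegral_itv_le => // x /fK; apply: le_trans.
  exact: ler_Re_normc.
exact: ler_Im_normc.
Qed.

Lemma cpathB f g : cpath f -> cpath g -> cpath (fun x => f x - g x).
Proof.
move=> [c1 c2] [c3 c4]; split => x.
- by under eq_fun do rewrite cReD cReN; apply: cvgB; [exact: c1|exact: c3].
- by under eq_fun do rewrite cImD cImN; apply: cvgB; [exact: c2|exact: c4].
Qed.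

Lemma cpath_comp (g : R[i] -> R[i]) f : (forall z, ccont g z) -> cpath f -> cpath (fun x => g (f x)).
Proof.
move=> cg [c1 c2].
have h t e : 0 < e -> \forall s \near t, normc (g (f s) - g (f t)) <= e.
  move=> e0; have [r r0 hr] := cg (f t) _ e0.
  have r20 : 0 < r / 2 by rewrite divr_gt0.
  have /cvgrPdist_lt /(_ _ r20) n1 := c1 t; have /cvgrPdist_lt /(_ _ r20) n2 := c2 t.
  near=> s.
  have -> : f s = f t + (f s - f t) by rewrite addrC subrK.
  apply: hr; rewrite (le_lt_trans (normc_le_ReIm _))// cReD cReN cImD cImN [ltRHS]splitr.
  by rewrite ltrD//; rewrite distrC; near: s.
split => t; apply/cvgrPdist_le => e e0; have := h t e e0; apply: filterS => s; apply: le_trans.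
- by rewrite distrC -cReN -cReD ler_Re_normc.
- by rewrite distrC -cImN -cImD ler_Im_normc.
Unshelve. all: by end_near. Qed.

Lemma cpath_lineR (c : R) : cpath (fun x => x +i* c).
Proof. by split => x /=; [exact: cvg_id|exact: cvg_cst]. Qed.
Lemma cpath_lineI (c : R) : cpath (fun x => c +i* x).
Proof. by split => x /=; [exact: cvg_cst|exact: cvg_id]. Qed.

End SegmentIntegral.

Section Goursat.
Variable R : realType.
Implicit Types (a b c d : R) (g : R[i] -> R[i]).

(** The counterclockwise contour integral of g dz around [a, b] x [c, d], with dz = i dy on the
    vertical sides. *)
Definition rect_int g a b c d : R[i] :=
  sint a b (fun x => g (x +i* c)) + 'i * sint c d (fun y => g (b +i* y))
  - sint a b (fun x => g (x +i* d)) - 'i * sint c d (fun y => g (a +i* y)).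

Lemma cpath_hor g c : (forall z, ccont g z) -> cpath (fun x => g (x +i* c)).
Proof. by move=> cg; apply: cpath_comp => //; exact: cpath_lineR. Qed.
Lemma cpath_ver g c : (forall z, ccont g z) -> cpath (fun y => g (c +i* y)).
Proof. by move=> cg; apply: cpath_comp => //; exact: cpath_lineI. Qed.

Lemma rect_int_split g a m b c n d : (forall z, ccont g z) ->
  a <= m -> m <= b -> c <= n -> n <= d ->
  rect_int g a b c d = rect_int g a m c n + rect_int g m b c n
    + rect_int g a m n d + rect_int g m b n d.
Proof.
move=> cg am mb cn nd; rewrite /rect_int.
rewrite (sint_add (cpath_hor c cg) am mb) (sint_add (cpath_hor d cg) am mb).
rewrite (sint_add (cpath_ver a cg) cn nd) (sint_add (cpath_ver b cg) cn nd).
ring.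
Qed.

Lemma rect_intB g h a b c d : (forall z, ccont g z) -> (forall z, ccont h z) ->
  rect_int (fun z => g z - h z) a b c d = rect_int g a b c d - rect_int h a b c d.
Proof.
move=> cg ch; rewrite /rect_int !sintB; try exact: cpath_hor; try exact: cpath_ver.
ring.
Qed.

Lemma normc_i : normc ('i : R[i]) = 1.
Proof. by rewrite /= expr0n expr1n add0r sqrtr1. Qed.

Lemma normc_rect_int_le g a b c d K : (forall z, ccont g z) -> a <= b -> c <= d ->
  (forall x y, a <= x <= b -> c <= y <= d -> normc (g (x +i* y)) <= K) ->
  normc (rect_int g a b c d) <= 4 * K * ((b - a) + (d - c)).
Proof.
move=> cg ab cd gK.
have h1 : normc (sint a b (fun x => g (x +i* c))) <= 2 * K * (b - a).
  by apply: normc_sint_le => //; [exact: cpath_hor|move=> x xab; apply: gK => //; rewrite lexx cd].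
have h2 : normc (sint a b (fun x => g (x +i* d))) <= 2 * K * (b - a).
  by apply: normc_sint_le => //; [exact: cpath_hor|move=> x xab; apply: gK => //; rewrite lexx cd].
have h3 : normc (sint c d (fun y => g (b +i* y))) <= 2 * K * (d - c).
  by apply: normc_sint_le => //; [exact: cpath_ver|move=> x xab; apply: gK => //; rewrite lexx ab].
have h4 : normc (sint c d (fun y => g (a +i* y))) <= 2 * K * (d - c).
  by apply: normc_sint_le => //; [exact: cpath_ver|move=> x xab; apply: gK => //; rewrite lexx ab].
rewrite /rect_int.
set s1 := sint _ _ _ in h1 *; set s2 := sint _ _ _ in h2 *.
set s3 := sint _ _ _ in h3 *; set s4 := sint _ _ _ in h4 *.
have := le_normcD (s1 + 'i * s3 - s2) (- ('i * s4)).
have := le_normcD (s1 + 'i * s3) (- s2); have := le_normcD s1 ('i * s3).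
rewrite !normcN !normcM normc_i !mul1r => t1 t2 t3.
apply: (le_trans t3); apply: (@le_trans _ _ (2 * K * (b - a) + 2 * K * (d - c) + 2 * K * (b - a) + 2 * K * (d - c))).
  rewrite lerD//; apply: (le_trans t2); rewrite lerD//; apply: (le_trans t1); exact: lerD.
by rewrite le_eqVlt; apply/orP; left; apply/eqP; ring.
Qed.

Lemma sint_affine a b (p q : R[i]) : a <= b ->
  sint a b (fun x => p + q * x%:C) = p * (b - a)%:C + q * ((b ^+ 2 - a ^+ 2) / 2)%:C.
Proof.
move=> ab.
have ci (k : R) : lebesgue_measure.-integrable `[a, b] (fun x : R => (k * x)%:E).
  by apply: continuous_integrable_itv => x; apply: cvgMr; exact: cvg_id.
have cc (k : R) : lebesgue_measure.-integrable `[a, b] (fun _ : R => k%:E).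
  by apply: continuous_integrable_itv => x; exact: cvg_cst.
have idi : lebesgue_measure.-integrable `[a, b] (fun x : R => x%:E).
  by apply: continuous_integrable_itv => x; exact: cvg_id.
have E (k l : R) : \int[lebesgue_measure]_(x in `[a, b]) (k + l * x) =
    k * (b - a) + l * ((b ^+ 2 - a ^+ 2) / 2).
  rewrite (@RintegralD _ _ _ lebesgue_measure `[a, b]%classic (fun=> k) (fun x => l * x))//; [|exact: cc|exact: ci].
  by rewrite (@RintegralZl _ _ _ lebesgue_measure `[a, b]%classic id)// Rintegral_itv_cst// Rintegral_itv_id.
rewrite /sint.
under eq_Rintegral do rewrite cReD cReM /= mulr0 subr0.
under [X in _ +i* X]eq_Rintegral do rewrite cImD cImM /= mulr0 add0r.
rewrite !E; case: p q => p1 p2 [q1 q2].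
by apply/eqP; rewrite eq_complex /=; apply/andP; split; apply/eqP; ring.
Qed.

Lemma rect_int_affine a b c d (u v : R[i]) : a <= b -> c <= d ->
  rect_int (fun z => u + v * z) a b c d = 0.
Proof.
move=> ab cd; rewrite /rect_int.
have xyE (x y : R) : x +i* y = x%:C + 'i * y%:C := complexE (x +i* y).
have hor (y : R) : (fun x : R => u + v * (x +i* y)) = (fun x => (u + v * 'i * y%:C) + v * x%:C).
  by apply/funext => x; rewrite xyE; ring.
have ver (x : R) : (fun y : R => u + v * (x +i* y)) = (fun y => (u + v * x%:C) + (v * 'i) * y%:C).
  by apply/funext => y; rewrite xyE; ring.
rewrite !hor !ver !sint_affine// !rmorphB/=.
have i2 : 'i * 'i = -1 :> R[i] by rewrite -expr2 sqr_i.
set X := (_ / 2)%:C; set Y := (_ / 2)%:C.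
rewrite (_ : _ - _ = (b%:C - a%:C) * (d%:C - c%:C) * v * ('i - 'i)); first by rewrite subrr mulr0.
ring.
Qed.

(** The affine part of g at [z0] integrates to 0. What remains is at most e times the distance to
    [z0], hence at most e times the half-perimeter, and the length of the contour supplies the
    second factor. *)
Lemma rect_int_local g a b c d (z0 dg : R[i]) (e r : R) : (forall z, ccont g z) ->
  (forall w, normc w < r -> normc (g (z0 + w) - g z0 - dg * w) <= e * normc w) -> 0 <= e ->
  a <= complex.Re z0 <= b -> c <= complex.Im z0 <= d -> (b - a) + (d - c) < r ->
  normc (rect_int g a b c d) <= 4 * e * ((b - a) + (d - c)) ^+ 2.
Proof.
move=> cg hr e0 /andP[az zb] /andP[cz zd] lr.
have ab := le_trans az zb; have cd := le_trans cz zd.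
pose A z := (g z0 - dg * z0) + dg * z.
have cA z : ccont A z.
  apply: (@cdiff_cont _ _ _ (0 + (0 * z + dg * 1))); apply: cdiffD; first exact: cdiff_cst.
  by apply: cdiffM; [exact: cdiff_cst|exact: cdiff_id].
have cgA z : ccont (fun z => g z - A z) z.
  move=> t t0; have t20 : 0 < t / 2 by rewrite divr_gt0.
  have [r1 r10 h1] := cg z _ t20; have [r2 r20 h2] := cA z _ t20.
  exists (Num.min r1 r2); first by rewrite lt_min r10.
  move=> w; rewrite lt_min => /andP[w1 w2].
  rewrite (_ : _ - _ = (g (z + w) - g z) - (A (z + w) - A z)); last by ring.
  rewrite (le_trans (le_normcD _ _))// normcN [leRHS]splitr lerD//; [exact: h1|exact: h2].
have -> : rect_int g a b c d = rect_int (fun z => g z - A z) a b c d.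
  by rewrite rect_intB// rect_int_affine// subr0.
set l := (b - a) + (d - c).
have -> : 4 * e * l ^+ 2 = 4 * (e * l) * l by ring.
apply: normc_rect_int_le => // x y /andP[ax xb] /andP[cy yd].
pose w := (x +i* y) - z0.
have wl : normc w <= l.
  rewrite (le_trans (normc_le_ReIm _))// /w cReD cReN cImD cImN /=; apply: lerD.
    by rewrite ler_norml; apply/andP; split; lra.
  by rewrite ler_norml; apply/andP; split; lra.
have := hr w (le_lt_trans wl lr).
rewrite (_ : g (z0 + w) - g z0 - dg * w = g (x +i* y) - A (x +i* y)); last first.
  have -> : z0 + w = x +i* y by rewrite /w addrC subrK.
  rewrite /A /w; ring.
by move/le_trans; apply; rewrite ler_wpM2l.
Qed.

(** Since the four quarters add up to the whole, they cannot all have modulus below a quarter of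
    it. *)
Lemma exists_quarter g a b c d : (forall z, ccont g z) -> a <= b -> c <= d ->
  exists r : R * R * R * R, let: (a', b', c', d') := r in
  [/\ a <= a' <= b' /\ b' <= b, c <= c' <= d' /\ d' <= d,
      b' - a' = (b - a) / 2 /\ d' - c' = (d - c) / 2 &
      normc (rect_int g a b c d) <= 4 * normc (rect_int g a' b' c' d')].
Proof.
move=> cg ab cd; pose m := (a + b) / 2; pose n := (c + d) / 2.
have am : a <= m by rewrite /m; lra.
have mb : m <= b by rewrite /m; lra.
have cn : c <= n by rewrite /n; lra.
have nd : n <= d by rewrite /n; lra.
have hm : m - a = (b - a) / 2 by rewrite /m; lra.
have hm' : b - m = (b - a) / 2 by rewrite /m; lra.
have hn : n - c = (d - c) / 2 by rewrite /n; lra.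
have hn' : d - n = (d - c) / 2 by rewrite /n; lra.
rewrite (rect_int_split cg am mb cn nd).
set r1 := rect_int g a m c n; set r2 := rect_int g m b c n.
set r3 := rect_int g a m n d; set r4 := rect_int g m b n d.
have t : normc (r1 + r2 + r3 + r4) <= normc r1 + normc r2 + normc r3 + normc r4.
  by do 3 (rewrite (le_trans (le_normcD _ _))// lerD2r).
set s := normc (_ + _) in t *.
have [h1|h1] := leP s (4 * normc r1).
  by exists (a, m, c, n); split => //; split => //; apply/andP.
have [h2|h2] := leP s (4 * normc r2).
  by exists (m, b, c, n); split => //; split => //; apply/andP.
have [h3|h3] := leP s (4 * normc r3).
  by exists (a, m, n, d); split => //; split => //; apply/andP.
have [h4|h4] := leP s (4 * normc r4).
  by exists (m, b, n, d); split => //; split => //; apply/andP.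
exfalso; lra.
Qed.

(** Repeated quartering loses a factor 4 at each stage, while the half-perimeter is halved. The
    local estimate at the common point is quadratic in the half-perimeter, so the powers of 4 cancel
    exactly and an arbitrarily small multiple of l^2 is left. *)
Theorem goursat g a b c d : (forall z, exists dg, cdiff g z dg) -> a <= b -> c <= d ->
  rect_int g a b c d = 0.
Proof.
move=> dg ab cd.
have cg z : ccont g z by have [u /cdiff_cont] := dg z.
(* The orientation conditions are premises of [P], so that [choice] can be applied to all
   quadruples; reversed rectangles satisfy it vacuously. *)
pose P (r r' : R * R * R * R) := let: (a, b, c, d) := r in let: (a', b', c', d') := r' in
  a <= b -> c <= d ->
  [/\ a <= a' <= b' /\ b' <= b, c <= c' <= d' /\ d' <= d,
      b' - a' = (b - a) / 2 /\ d' - c' = (d - c) / 2 &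
      normc (rect_int g a b c d) <= 4 * normc (rect_int g a' b' c' d')].
have exP r : exists r', P r r'.
  case: r => [[[a1 b1] c1] d1]; have [ab1|ba1] := leP a1 b1; last first.
    by exists (a1, b1, c1, d1) => /=; rewrite leNgt ba1.
  have [cd1|dc1] := leP c1 d1; last first.
    by exists (a1, b1, c1, d1) => /= _; rewrite leNgt dc1.
  have [[[[a' b'] c'] d'] h] := exists_quarter cg ab1 cd1.
  by exists (a', b', c', d').
have [nxt hnxt] := choice exP.
pose q k := iter k nxt (a, b, c, d).
pose qa k := (q k).1.1.1; pose qb k := (q k).1.1.2; pose qc k := (q k).1.2; pose qd k := (q k).2.
have inv k : qa k <= qb k /\ qc k <= qd k.
  elim: k => [|k [IH1 IH2]]; first by [].
  have := hnxt (q k); move: IH1 IH2; rewrite /qa /qb /qc /qd /= -/(q k).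
  case: (q k) => [[[a1 b1] c1] d1] /= h1 h2.
  by case: (nxt _) => [[[a2 b2] c2] d2] /= /(_ h1 h2)[[/andP[_ ?] _] [/andP[_ ?] _] _ _].
have step k : [/\ qa k <= qa k.+1 /\ qb k.+1 <= qb k, qc k <= qc k.+1 /\ qd k.+1 <= qd k,
   qb k.+1 - qa k.+1 = (qb k - qa k) / 2 /\ qd k.+1 - qc k.+1 = (qd k - qc k) / 2 &
   normc (rect_int g (qa k) (qb k) (qc k) (qd k)) <=
   4 * normc (rect_int g (qa k.+1) (qb k.+1) (qc k.+1) (qd k.+1))].
  have [] := inv k; have := hnxt (q k); rewrite /qa /qb /qc /qd /= -/(q k).
  case: (q k) => [[[a1 b1] c1] d1] /=.
  case: (nxt _) => [[[a2 b2] c2] d2] /= h h1 h2.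
  by have [[/andP[? _] ?] [/andP[? _] ?] [? ?] ?] := h h1 h2.
have nested (u v : nat -> R) : (forall k, u k <= v k) ->
    (forall k, u k <= u k.+1 /\ v k.+1 <= v k) -> exists x, forall k, u k <= x <= v k.
  move=> uv hs.
  have nu : nondecreasing_seq u by apply/nondecreasing_seqP => k; exact: (hs k).1.
  have nv : nonincreasing_seq v by apply/nonincreasing_seqP => k; exact: (hs k).2.
  have le_uv j k : u j <= v k.
    have := uv (maxn j k); have := nu _ _ (leq_maxl j k); have := nv _ _ (leq_maxr j k); lra.
  have cu : cvgn u by apply: nondecreasing_is_cvgn => //; exists (v 0%N) => _ [j _ <-].
  exists (limn u) => k; rewrite nondecreasing_cvgn_le//=.
  by apply: limr_le => //; apply: nearW.
have [x0 hx0] := nested qa qb (fun k => (inv k).1) (fun k => let: And4 h _ _ _ := step k in h).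
have [y0 hy0] := nested qc qd (fun k => (inv k).2) (fun k => let: And4 _ h _ _ := step k in h).
set l := (b - a) + (d - c).
have l0 : 0 <= l by rewrite /l; lra.
have len k : (qb k - qa k) + (qd k - qc k) = l * 2^-1 ^+ k.
  elim: k => [|k IH]; first by rewrite expr0 mulr1.
  by have [_ _ [-> ->] _] := step k; rewrite -mulrDl IH exprSr mulrA.
have big k : normc (rect_int g a b c d) <= 4 ^+ k * normc (rect_int g (qa k) (qb k) (qc k) (qd k)).
  elim: k => [|k IH]; first by rewrite expr0 mul1r.
  apply: (le_trans IH); have [_ _ _ h] := step k.
  by rewrite exprSr -mulrA ler_wpM2l// exprn_ge0.
apply/normc_eq0P/le_anti; rewrite normc_ge0 andbT.
apply/ler_addgt0Pr => e e0; rewrite add0r.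
(* The cancellation below leaves 4 l^2 times the local epsilon; the added 1 keeps the divisor
   positive when the rectangle degenerates to a point. *)
have K0 : 0 < 4 * l ^+ 2 + 1 by have := sqr_ge0 l; lra.
have e1 : 0 < e / (4 * l ^+ 2 + 1) by rewrite divr_gt0.
set e' := e / _ in e1.
have [u hu] := dg (x0 +i* y0); have [r r0 hr] := hu _ e1.
have [k hk] : exists k, l * 2^-1 ^+ k < r.
  have h : (fun k => l * 2^-1 ^+ k) @ \oo --> (0 : R).
    rewrite -[0](mulr0 l); apply: cvgMr; apply: cvg_expr.
    by rewrite ger0_norm ?invr_ge0//; lra.
  have /cvgrPdist_lt /(_ _ r0)[N _ hN] := h; exists N.
  have := hN N (leqnn N); rewrite /= sub0r normrN; apply: le_lt_trans; exact: ler_norm.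
have := @rect_int_local g (qa k) (qb k) (qc k) (qd k) (x0 +i* y0) u e' r cg hr (ltW e1) (hx0 k) (hy0 k).
rewrite len => /(_ hk) h; apply: (le_trans (big k)).
apply: (@le_trans _ _ (4 ^+ k * (4 * e' * (l * 2^-1 ^+ k) ^+ 2))).
  by rewrite ler_wpM2l// exprn_ge0.
have -> : 4 ^+ k * (4 * e' * (l * 2^-1 ^+ k) ^+ 2) = e' * (4 * l ^+ 2) * (4 * 2^-1 ^+ 2) ^+ k.
  rewrite [(4 * _) ^+ k]exprMn [(2^-1 ^+ 2) ^+ k]exprAC [(l * _) ^+ 2]exprMn.
  by move: (2^-1 ^+ k) (4 ^+ k) (e' : R) (l : R) => x1 x2 x3 x4; ring.
have -> : 4 * 2^-1 ^+ 2 = 1 :> R by rewrite expr2; lra.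
rewrite expr1n mulr1 /e' mulrAC ler_pdivrMr// ler_wpM2l ?ltW//; lra.
Qed.

Lemma cexp_2pi (s y : R) : cexp (s +i* (y + pi *+ 2)) = cexp (s +i* y).
Proof. by rewrite /cexp/= cosD2pi sinD2pi. Qed.

(** Goursat for h(w e^z) on [s, 0] x [0, 2 pi]: the horizontal sides cancel by periodicity, so the
    mean over the circle of radius |w| e^s does not depend on s. For very negative s that circle is
    close to 0, where h is close to h 0. *)
Lemma sint_circle_mean (h : R[i] -> R[i]) (w : R[i]) : (forall z, exists dh, cdiff h z dh) ->
  sint 0 (pi *+ 2) (fun t : R => h (w * (cos t +i* sin t))) = (pi *+ 2)%:C * h 0.
Proof.
move=> dh; pose g z := h (w * cexp z).
have dg z : exists u, cdiff g z u.
  have [u hu] := dh (w * cexp z).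
  exists (u * (0 * cexp z + w * cexp z)).
  have h1 : cdiff (fun z => w * cexp z) z (0 * cexp z + w * cexp z).
    by apply: cdiffM; [exact: cdiff_cst|exact: cdiff_cexp].
  exact: (cdiff_comp h1 hu).
have cg z : ccont g z by have [u /cdiff_cont] := dg z.
have ch z : ccont h z by have [u /cdiff_cont] := dh z.
have i0 : ('i : R[i]) != 0.
  by apply/eqP => /(congr1 (@normc R)); rewrite normc_i normc0 => /eqP; rewrite oner_eq0.
have pi2 : 0 <= pi *+ 2 :> R by rewrite mulrn_wge0// pi_ge0.
have const s : s <= 0 -> sint 0 (pi *+ 2) (fun y => g (0 +i* y)) = sint 0 (pi *+ 2) (fun y => g (s +i* y)).
  move=> s0; have := goursat dg s0 pi2; rewrite /rect_int.
  rewrite (_ : (fun x => g (x +i* (pi *+ 2))) = (fun x => g (x +i* 0))); last first.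
    by apply/funext => x; rewrite /g -[pi *+ 2]add0r cexp_2pi.
  rewrite [X in X - 'i * _](addrAC) subrr add0r -mulrBr => /eqP; rewrite mulf_eq0 (negbTE i0) subr_eq0 => /eqP h0; exact: h0.
have -> : (fun t : R => h (w * (cos t +i* sin t))) = (fun y => g (0 +i* y)).
  by apply/funext => t; rewrite /g cexpE expR0 mul1r.
apply/eqP; rewrite -subr_eq0; apply/eqP/normc_eq0P/le_anti; rewrite normc_ge0 andbT.
apply/ler_addgt0Pr => e e0; rewrite add0r.
have K0 : 0 < 2 * (pi *+ 2) + 1 :> R by rewrite ltr_wpDl ?mulr_ge0.
have e1 : 0 < e / (2 * (pi *+ 2) + 1) by rewrite divr_gt0.
set e' := e / _ in e1.
have [r r0 hr] := ch 0 _ e1.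
(* This gives |w| e^s < r, because e^x >= 1 + x > x at x = |w| / r. *)
pose s := - (normc w / r).
have s0 : s <= 0 by rewrite oppr_le0 divr_ge0 ?normc_ge0// ltW.
rewrite (const s s0).
have -> : (pi *+ 2)%:C * h 0 = sint 0 (pi *+ 2) (fun _ => h 0).
  have := @sint_affine 0 (pi *+ 2) (h 0) 0 pi2; rewrite mul0r addr0 subr0 mulrC => <-.
  by congr sint; apply/funext => x; rewrite mul0r addr0.
have cc : cpath (fun _ : R => h 0) by split => x; exact: cvg_cst.
rewrite -sintB//; last exact: cpath_ver.
apply: (@le_trans _ _ (2 * e' * (pi *+ 2 - 0))).
  apply: normc_sint_le => //; first by apply: cpathB => //; exact: cpath_ver.
  move=> y _; have := hr (w * cexp (s +i* y)); rewrite add0r; apply.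
  rewrite normcM normc_cexp /= /s expRN.
  have wr : 0 <= normc w / r by rewrite divr_ge0 ?normc_ge0// ltW.
  rewrite -/(normc w / _) ltr_pdivrMr ?expR_gt0//.
  rewrite -ltr_pdivrMl// mulrC; have := expR_ge1Dx (normc w / r); lra.
rewrite subr0 -mulrA mulrCA /e' mulrAC ler_pdivrMr// ler_wpM2l ?ltW//; lra.
Qed.
End Goursat.

(** * Lebesgue measure on the plane *)

Section PlaneMeasurability.
Variable R : realType.
Notation RR := (measurableTypeR R).

(** A preimage is a countable union of fibres of [q], enumerated by [unpickle]. *)
Lemma measurable_fun_unpickle d (T : measurableType d) (I : countType) (q : T -> I) (F : I -> R) :
  (forall i, measurable [set x | q x = i]) -> measurable_fun setT (fun x => F (q x)).
Proof.
move=> mq _ Y mY; rewrite setTI.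
rewrite (_ : _ @^-1` Y = \bigcup_k (if unpickle k is Some i then
   [set x | q x = i /\ Y (F i)] else set0)).
  apply: bigcupT_measurable => k; case: (unpickle k) => [i|]; last exact: measurable0.
  have [YF|YF] := pselect (Y (F i)).
    rewrite (_ : [set x | _] = [set x | q x = i]); first exact: mq.
    by apply/seteqP; split => x /= => [[]|].
  rewrite (_ : [set x | _] = set0); first exact: measurable0.
  by apply/seteqP; split => x //= [].
apply/seteqP; split => x /=.
  by move=> YFx; exists (pickle (q x)) => //; rewrite pickleK.
by move=> [k _]; case: (unpickle k) => [i [-> ]|[]].
Qed.

Definition pcont (F : RR * RR -> R) := forall p e, 0 < e -> exists2 r, 0 < r &
  forall q, `|q.1 - p.1| < r -> `|q.2 - p.2| < r -> `|F q - F p| <= e.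

(** F is the pointwise limit of its values rounded down to the grid of mesh 1 / (n + 1). Each
    rounded function factors through a pair of integers and has products of half-open intervals as
    fibres, which are measurable for the product structure. *)
Lemma pcont_measurable F : pcont F -> measurable_fun setT F.
Proof.
move=> cF.
pose fl n (x : R) := Num.floor (n.+1%:R * x).
pose G n (p : RR * RR) := F ((fl n p.1)%:~R / n.+1%:R, (fl n p.2)%:~R / n.+1%:R).
have n0 n : 0 < n.+1%:R :> R by rewrite ltr0n.
have mfl n (i : int) : measurable ([set x : RR | fl n x = i]).
  rewrite (_ : [set x | _] = `[i%:~R / n.+1%:R, (i + 1)%:~R / n.+1%:R[%classic); first exact: measurable_itv.
  apply/seteqP; split => x /=; rewrite in_itv/= ler_pdivrMr// ltr_pdivlMr// mulrC /fl.
    by move=> <-; exact: floor_itv.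
  by move=> /floor_def ->.
apply: (@measurable_fun_cvg _ _ _ _ G).
  move=> n; apply: (@measurable_fun_unpickle _ _ _ (fun p : RR * RR => (fl n p.1, fl n p.2))
    (fun ij : int * int => F (ij.1%:~R / n.+1%:R, ij.2%:~R / n.+1%:R))).
  move=> [i j].
  rewrite (_ : [set x | _] = [set x | fl n x = i] `*` [set x | fl n x = j]).
    by apply: measurableX; exact: mfl.
  by apply/seteqP; split => -[u v] /= [-> ->].
move=> p _; apply/cvgrPdist_le => e e0; have [r r0 hr] := cF p e e0.
have [N hN] : exists N, forall n, (N <= n)%N -> n.+1%:R^-1 < r.
  have /cvgrPdist_lt /(_ _ r0)[N _ hN] := @cvg_harmonic R; exists N => n /hN.
  by rewrite sub0r normrN /harmonic/= ger0_norm// invr_ge0.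
have key n (x : R) : (N <= n)%N -> `|(fl n x)%:~R / n.+1%:R - x| < r.
  move=> /hN; apply: le_lt_trans.
  have /andP[h1 h2] := floor_itv (n.+1%:R * x).
  rewrite -[X in `|X|](@mulfK _ n.+1%:R) ?gt_eqF// normrM (@ger0_norm _ (_^-1)) ?invr_ge0//.
  rewrite ler_piMl ?invr_ge0// mulrBl divfK ?gt_eqF// ler_norml.
  by move: h1 h2; rewrite intrD -/(fl n x) /fl (mulrC x) => h1 h2; apply/andP; split; lra.
by exists N => // n /= Nn; rewrite distrC; apply: hr; exact: key.
Qed.

Definition cplane (p : RR * RR) : R[i] := p.1 +i* p.2.

Lemma ccont_pcont (h : R[i] -> R[i]) : (forall z, ccont h z) ->
  pcont (fun p => complex.Re (h (cplane p))) /\ pcont (fun p => complex.Im (h (cplane p))).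
Proof.
move=> ch.
have key p e : 0 < e -> exists2 r, 0 < r & forall q, `|q.1 - p.1| < r -> `|q.2 - p.2| < r ->
    normc (h (cplane q) - h (cplane p)) <= e.
  move=> e0; have [r r0 hr] := ch (cplane p) e e0.
  exists (r / 2); first by rewrite divr_gt0.
  move=> q h1 h2; have := hr (cplane q - cplane p); rewrite [cplane p + _]addrC subrK; apply.
  rewrite (le_lt_trans (normc_le_ReIm _))// /cplane cReD cReN cImD cImN /= [ltRHS]splitr.
  exact: ltrD.
split => p e e0; have [r r0 hr] := key p e e0; exists r => // q h1 h2; apply: le_trans (hr q h1 h2).
- by rewrite -cReN -cReD ler_Re_normc.
- by rewrite -cImN -cImD ler_Im_normc.
Qed.

Lemma cmeasurable_plane (h : R[i] -> R[i]) : (forall z, ccont h z) ->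
  cmeasurable (fun p : RR * RR => h (cplane p)).
Proof. by move=> /ccont_pcont[h1 h2]; split; exact: pcont_measurable. Qed.

End PlaneMeasurability.

(** * Measure-preserving maps, shears and rotations of the plane *)

Section MeasurePreserving.
Context d (T : measurableType d) (R : realType).
Variable mu : {measure set T -> \bar R}.
Implicit Types (S : T -> T).

Definition mpres S := measurable_fun setT S /\
  forall A, measurable A -> mu (S @^-1` A) = mu A.

Lemma mpres_comp S1 S2 : mpres S1 -> mpres S2 -> mpres (S1 \o S2).
Proof.
move=> [m1 h1] [m2 h2]; split; first exact: measurableT_comp.
move=> A mA; rewrite comp_preimage h2 ?h1//.
by rewrite -[X in measurable X]setTI; exact: m1.
Qed.

Lemma mpres_ge0_integral S (f : T -> \bar R) : mpres S -> measurable_fun setT f ->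
  (forall x, 0 <= f x)%E -> (\int[mu]_p f (S p) = \int[mu]_p f p)%E.
Proof.
move=> [mS hS] mf f0.
have E : (\int[pushforward mu S]_p f p = \int[mu]_p f (S p))%E.
  by rewrite ge0_integral_pushforward.
rewrite -E; apply: (@eq_measure_integral _ _ _ _ _ (measure_function.pushforward mu S)) => //= A mA _.
exact: hS.
Qed.

Lemma mpres_integrable S (f : T -> R) : mpres S -> rintegrable mu f ->
  rintegrable mu (f \o S) /\ \int[mu]_p f (S p) = \int[mu]_p f p.
Proof.
move=> pS hf; have [mS hS] := pS; have mf := rintegrable_measurable hf.
have mf' : measurable_fun setT (fun p => (f p)%:E) by exact/measurable_EFinP.
have h1 : rintegrable mu (f \o S).
  apply: rintegrableP; first exact: measurableT_comp.
  rewrite (@mpres_ge0_integral S (fun p => `|f p|%:E)%E)//.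
    exact: rintegrable_lty (rintegrable_norm hf).
  by apply/measurable_EFinP; exact: measurableT_comp.
split => //; rewrite /Rintegral; congr fine.
have hp := mpres_ge0_integral pS (measurable_funepos mf') (fun x => funepos_ge0 _ x).
have hn := mpres_ge0_integral pS (measurable_funeneg mf') (fun x => funeneg_ge0 _ x).
rewrite integralE [in RHS]integralE -hp -hn.
by congr (_ - _)%E; apply: eq_integral => x _; rewrite ?funeposE ?funenegE.
Qed.

End MeasurePreserving.

Section PlaneRotations.
Variable R : realType.
Notation RR := (measurableTypeR R).
Notation leb := (@lebesgue_measure R).
Implicit Types (S : RR * RR -> RR * RR).

(** It suffices to compare the measures on half-open intervals, which determine Lebesgue measure. *)
Lemma lebesgue_measureD (c : R) (A : set RR) : measurable A ->
  pushforward leb ((fun x => x + c) : RR -> RR) A = leb A.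
Proof.
have mD : measurable_fun setT ((fun x => x + c) : RR -> RR).
  by apply: measurable_funD; [exact: measurable_id|exact: measurable_cst].
move=> mA; apply/esym/lebesgue_measure_unique => //= _ [[a b]] _ <-.
have -> : [set` `]a, b] ] = `]a, b]%classic by [].
rewrite /pushforward (_ : _ @^-1` _ = `]a - c, b - c]%classic); last first.
  by apply/seteqP; split => x /=; rewrite !in_itv/= ltrBlDr lerBrDr.
rewrite !lebesgue_measure_itv/= !lte_fin ltrD2r.
by case: ifP => // _; rewrite -!EFinB opprB addrA subrK.
Qed.

Lemma ge0_integral_translation (c : R) (f : RR -> \bar R) : measurable_fun setT f ->
  (forall x, 0 <= f x)%E -> (\int[leb]_x f (x + c)%R = \int[leb]_x f x)%E.
Proof.
have mD : measurable_fun setT ((fun x => x + c) : RR -> RR).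
  by apply: measurable_funD; [exact: measurable_id|exact: measurable_cst].
move=> mf f0.
rewrite -[LHS](@ge0_integral_pushforward _ _ _ _ _ _ mD leb setT f)//.
by apply: eq_measure_integral => //= A mA _; exact: lebesgue_measureD.
Qed.

Lemma leb2_tonelli1 (f : RR * RR -> \bar R) : measurable_fun setT f -> (forall p, 0 <= f p)%E ->
  (\int[leb2 R]_p f p = \int[leb]_x \int[leb]_y f (x, y))%E.
Proof. exact: fubini_tonelli1. Qed.

Lemma leb2_tonelli2 (f : RR * RR -> \bar R) : measurable_fun setT f -> (forall p, 0 <= f p)%E ->
  (\int[leb2 R]_p f p = \int[leb]_y \int[leb]_x f (x, y))%E.
Proof. exact: fubini_tonelli2. Qed.

Lemma measurable_EFin_indic (A : set (RR * RR)) : measurable A ->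
  measurable_fun setT (fun p : RR * RR => (\1_A p : R)%:E).
Proof. by move=> mA; apply/measurable_EFinP; exact: measurable_indic. Qed.

Lemma EFin_indic_ge0 (A : set (RR * RR)) (p : RR * RR) : (0 <= (\1_A p : R)%:E)%E.
Proof. by rewrite lee_fin. Qed.

Lemma leb2_indic (A : set (RR * RR)) : measurable A ->
  leb2 R A = (\int[leb2 R]_p (\1_A p)%:E)%E.
Proof. by move=> mA; rewrite integral_indic// setIT. Qed.

(** On each horizontal line a shear is a translation, so Tonelli reduces the claim to translation
    invariance in one variable. [mpres_shear2] is the same along vertical lines. *)
Lemma mpres_shear1 (k : RR -> RR) : measurable_fun setT k ->
  mpres (leb2 R) (fun p => (p.1 + k p.2, p.2)).
Proof.
move=> mk.
have mS : measurable_fun setT (fun p : RR * RR => (p.1 + k p.2, p.2) : RR * RR).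
  apply/measurable_fun_pairP; split => /=; last exact: measurable_snd.
  apply: measurable_funD; first exact: measurable_fst.
  exact: measurableT_comp.
split => // A mA.
have mSA : measurable ((fun p : RR * RR => (p.1 + k p.2, p.2) : RR * RR) @^-1` A).
  by rewrite -[X in measurable X]setTI; exact: mS.
rewrite (leb2_indic mSA) (leb2_indic mA).
rewrite (leb2_tonelli2 (measurable_EFin_indic mSA) (EFin_indic_ge0 _)).
rewrite (leb2_tonelli2 (measurable_EFin_indic mA) (EFin_indic_ge0 _)).
apply: eq_integral => v _.
rewrite -(@ge0_integral_translation (k v) (fun u => (\1_A (u, v))%:E))//.
apply/measurable_EFinP; apply: (@measurableT_comp _ _ _ _ _ _ (\1_A : RR * RR -> R)).
  exact: measurable_indic.
exact: measurable_pair2.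
Qed.

Lemma mpres_shear2 (k : RR -> RR) : measurable_fun setT k ->
  mpres (leb2 R) (fun p => (p.1, p.2 + k p.1)).
Proof.
move=> mk.
have mS : measurable_fun setT (fun p : RR * RR => (p.1, p.2 + k p.1) : RR * RR).
  apply/measurable_fun_pairP; split => /=; first exact: measurable_fst.
  apply: measurable_funD; first exact: measurable_snd.
  exact: measurableT_comp.
split => // A mA.
have mSA : measurable ((fun p : RR * RR => (p.1, p.2 + k p.1) : RR * RR) @^-1` A).
  by rewrite -[X in measurable X]setTI; exact: mS.
rewrite (leb2_indic mSA) (leb2_indic mA).
rewrite (leb2_tonelli1 (measurable_EFin_indic mSA) (EFin_indic_ge0 _)).
rewrite (leb2_tonelli1 (measurable_EFin_indic mA) (EFin_indic_ge0 _)).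
apply: eq_integral => u _.
rewrite -(@ge0_integral_translation (k u) (fun v => (\1_A (u, v))%:E))//.
apply/measurable_EFinP; apply: (@measurableT_comp _ _ _ _ _ _ (\1_A : RR * RR -> R)).
  exact: measurable_indic.
exact: measurable_pair1.
Qed.

Definition plane_rot (c s : R) (p : RR * RR) : RR * RR := (c * p.1 - s * p.2, s * p.1 + c * p.2).

(* A rotation with s != 0 is a product of three shears, the outer ones of
   slope -(1 - c)/s = -tan(t/2); the half-turn is a quarter-turn squared. *)
Lemma mpres_rot (c s : R) : c ^+ 2 + s ^+ 2 = 1 -> mpres (leb2 R) (plane_rot c s).
Proof.
have ml (k : R) : measurable_fun setT ((fun x => k * x) : RR -> RR).
  by apply: measurable_funM; [exact: measurable_cst|exact: measurable_id].
have gen c' s' : c' ^+ 2 + s' ^+ 2 = 1 -> s' != 0 -> mpres (leb2 R) (plane_rot c' s').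
  move=> cs s0; pose t := - ((1 - c') / s').
  have -> : plane_rot c' s' = (fun p => (p.1 + t * p.2, p.2)) \o
      ((fun p => (p.1, p.2 + s' * p.1)) \o (fun p => (p.1 + t * p.2, p.2))).
    have E : s' * s' = 1 - c' * c' by move: cs; rewrite !expr2 => cs; lra.
    have st : s' * t = c' - 1 by rewrite /t; field.
    have tt : t * (1 + c') = - s'.
      apply: (mulfI s0); rewrite mulrA st mulrN E; ring.
    apply/funext => -[u v]; rewrite /plane_rot /=; congr (_, _).
      rewrite (_ : u + t * v + t * (v + s' * (u + t * v)) = u + (s' * t) * u + v * (2 * t + (s' * t) * t)); last by ring.
      rewrite st (_ : 2 * t + (c' - 1) * t = t * (1 + c')); last by ring.
      rewrite tt; ring.
    by rewrite mulrDr mulrA st; ring.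
  apply: mpres_comp; first exact: mpres_shear1.
  by apply: mpres_comp; [exact: mpres_shear2|exact: mpres_shear1].
have [->|s0 cs] := eqVneq s 0; last exact: gen.
rewrite expr0n addr0 => /eqP; rewrite sqrf_eq1 => /orP[] /eqP ->.
  have -> : plane_rot 1 0 = id by apply/funext => -[u v]; rewrite /plane_rot/= !mul1r !mul0r subr0 add0r.
  by split; [exact: measurable_id|].
have -> : plane_rot (-1) 0 = plane_rot 0 1 \o plane_rot 0 1.
  by apply/funext => -[u v]; rewrite /plane_rot/=; congr (_, _); ring.
have h : mpres (leb2 R) (plane_rot 0 1) by apply: gen; rewrite ?oner_neq0// expr0n expr1n add0r.
exact: mpres_comp.
Qed.

Lemma mpres_translation (a b : R) : mpres (leb2 R) (fun p => (p.1 + a, p.2 + b)).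
Proof.
rewrite (_ : (fun p => _) = (fun p => (p.1 + (fun=> a) p.2, p.2)) \o (fun p => (p.1, p.2 + (fun=> b) p.1)))//.
by apply: mpres_comp; [apply: mpres_shear1|apply: mpres_shear2]; exact: measurable_cst.
Qed.

End PlaneRotations.

Section RealFubini.
Context d1 d2 (T1 : measurableType d1) (T2 : measurableType d2) (R : realType).
Variables (m1 : {sigma_finite_measure set T1 -> \bar R}) (m2 : {sigma_finite_measure set T2 -> \bar R}).

(** The inner integrals are supplied as finite real functions, so that Fubini over the extended
    reals concludes on real integrals. [A] is the inner integral of the modulus and provides
    integrability on the product. *)
Lemma Rintegral_swap (F : T1 * T2 -> R) (A B : T1 -> R) (C : T2 -> R) :
  measurable_fun setT F ->
  (forall t, \int[m2]_p `|F (t, p)|%:E = (A t)%:E)%E -> (\int[m1]_t (A t)%:E < +oo)%E ->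
  (forall t, \int[m2]_p (F (t, p))%:E = (B t)%:E)%E ->
  (forall p, \int[m1]_t (F (t, p))%:E = (C p)%:E)%E ->
  (\int[m1]_t B t = \int[m2]_p C p)%R.
Proof.
move=> mF hA Aoo hB hC.
have iF : (m1 \x m2)%E.-integrable setT (fun tp => (F tp)%:E).
  apply/integrable12ltyP; first exact/measurable_EFinP.
  by under eq_integral do rewrite hA.
have := Fubini iF.
rewrite (eq_integral (fun t => (B t)%:E)); last by move=> t _; exact: hB.
rewrite (eq_integral (fun p => (C p)%:E)); last by move=> p _; exact: hC.
by rewrite /Rintegral => ->.
Qed.

End RealFubini.

Section PlaneSigmaFinite.
Variable R : realType.
Notation RR := (measurableTypeR R).
Notation leb := (@lebesgue_measure R).

(** The rotation average integrates over the product of the line with the plane, and Fubini asks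
    both factors to be sigma-finite; [leb2] itself is only typed as a measure. *)
Lemma leb2_sigma_finite : sigma_finite setT (leb2 R).
Proof.
have /sigma_finiteP[F [TF ndF Foo]] := sigma_finiteT leb.
exists (fun n => F n `*` F n).
  rewrite -setXTT TF predeqE => -[x y]; split.
    move=> [/= [n _ Fnx] [k _ Gky]]; exists (maxn n k) => //; split.
    - by move: x Fnx; exact/subsetPset/ndF/leq_maxl.
    - by move: y Gky; exact/subsetPset/ndF/leq_maxr.
  by move=> [n _ []/= ? ?]; split; exists n.
move=> k; have [? ?] := Foo k.
split; first exact: measurableX.
by rewrite /leb2 /= product_measure1E// lte_mul_pinfty// ge0_fin_numE.
Qed.

Let leb2_mixin := Measure_isSigmaFinite.Build _ _ _ (leb \x leb)%E leb2_sigma_finite.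
Definition leb2_sf : {sigma_finite_measure set (RR * RR)%type -> \bar R} :=
  HB.pack (leb \x leb)%E leb2_mixin.

End PlaneSigmaFinite.

(** * Gaussian integrals and averaging over rotations *)

Section GaussianIntegrals.
Variable R : realType.
Notation RR := (measurableTypeR R).
Notation leb := (@lebesgue_measure R).

Lemma rintegrable_prod (f g : RR -> R) : rintegrable leb f -> rintegrable leb g ->
  rintegrable (leb2 R) (fun p => f p.1 * g p.2) /\
  \int[leb2 R]_p (f p.1 * g p.2) = (\int[leb]_x f x) * (\int[leb]_x g x).
Proof.
move=> hf hg.
have mf := rintegrable_measurable hf; have mg := rintegrable_measurable hg.
have m1 : measurable_fun setT (fun p : RR * RR => f p.1).
  by apply: measurableT_comp => //; exact: measurable_fst.
have m2 : measurable_fun setT (fun p : RR * RR => g p.2).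
  by apply: measurableT_comp => //; exact: measurable_snd.
have mfg : measurable_fun setT (fun p : RR * RR => f p.1 * g p.2) by exact: measurable_funM.
have inner (k : R) (u : RR -> R) : rintegrable leb u ->
    (\int[leb]_y (k * u y)%:E)%E = (k * \int[leb]_y u y)%:E.
  by move=> hu; rewrite -RintegralZl// EFin_Rintegral//; exact: rintegrableZ.
have ifg : rintegrable (leb2 R) (fun p => f p.1 * g p.2).
  apply: rintegrableP => //.
  rewrite leb2_tonelli1//; last by apply/measurable_EFinP; exact: measurableT_comp.
  rewrite (eq_integral (fun x => (\int[leb]_y `|g y| * `|f x|)%:E)); last first.
    move=> x _; rewrite mulrC -inner; last exact: rintegrable_norm.
    by apply: eq_integral => y _; rewrite normrM.
  by rewrite inner ?ltry//; exact: rintegrable_norm.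
split => //; rewrite {1}/Rintegral /leb2 -integral12_prod_meas1//.
rewrite (eq_integral (fun x => (\int[leb]_y g y * f x)%:E)); last first.
  by move=> x _; rewrite mulrC -inner.
by rewrite inner//= mulrC.
Qed.

Definition gauss1 (a x : R) := expR (- x ^+ 2 + a * x).

Lemma measurable_gauss1 a : measurable_fun setT (gauss1 a : RR -> R).
Proof.
apply: measurableT_comp => //; apply: measurable_funD.
  by apply: measurableT_comp => //; apply: measurable_funX; exact: measurable_id.
by apply: measurable_funM; [exact: measurable_cst|exact: measurable_id].
Qed.

Lemma gauss1E a x : gauss1 a (x + a / 2) = expR (a ^+ 2 / 4) * expR (- x ^+ 2).
Proof. by rewrite /gauss1 -expRD; congr expR; field. Qed.

(** Completing the square: a translation by a / 2 removes the linear term. *)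
Lemma integral_gauss1 a : (\int[leb]_x (gauss1 a x)%:E)%E = (expR (a ^+ 2 / 4) * Num.sqrt pi)%:E.
Proof.
rewrite -(@ge0_integral_translation _ (a / 2) (fun x => (gauss1 a x)%:E)); last 2 first.
- by apply/measurable_EFinP; exact: measurable_gauss1.
- by move=> x; rewrite lee_fin expR_ge0.
under eq_integral do rewrite gauss1E EFinM.
rewrite ge0_integralZl ?lee_fin ?expR_ge0//; last first.
  by apply/measurable_EFinP; exact: measurable_gauss_fun.
by rewrite EFinM; congr (_ * _)%E; exact: integralT_gauss.
Qed.

Lemma rintegrable_gauss1 a : rintegrable leb (gauss1 a).
Proof.
apply: rintegrable_ge0P; [exact: measurable_gauss1|by move=> x; exact: expR_ge0|].
by rewrite integral_gauss1 ltry.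
Qed.

Lemma Rintegral_gauss1 a : \int[leb]_x gauss1 a x = expR (a ^+ 2 / 4) * Num.sqrt pi.
Proof. by rewrite /Rintegral integral_gauss1. Qed.

(** Majorant of a Gaussian times any exponential of rate at most a in modulus. It is integrable
    since it lies below [gauss1 a] plus [gauss1 (- a)]. *)
Definition gauss_abs (a x : R) := expR (- x ^+ 2 + a * `|x|).

Lemma rintegrable_gauss_abs a : rintegrable leb (gauss_abs a).
Proof.
apply: rintegrable_le (rintegrableD (rintegrable_gauss1 a) (rintegrable_gauss1 (- a))) _.
  apply: measurableT_comp => //; apply: measurable_funD.
    by apply: measurableT_comp => //; apply: measurable_funX; exact: measurable_id.
  by apply: measurable_funM; [exact: measurable_cst|exact: normr_measurable].
move=> x; rewrite ger0_norm ?expR_ge0// /gauss_abs /gauss1.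
have [x0|x0] := leP 0 x; first by rewrite (ger0_norm x0) lerDl expR_ge0.
by rewrite (ltr0_norm x0) mulrN mulNr lerDr expR_ge0.
Qed.

Definition gauss2 (p : RR * RR) := expR (- (p.1 ^+ 2 + p.2 ^+ 2)).

Lemma normc_cplane (p : RR * RR) : normc (cplane p) ^+ 2 = p.1 ^+ 2 + p.2 ^+ 2.
Proof. by rewrite sqr_normcE. Qed.

Lemma gauss2E p : gauss2 p = gauss1 0 p.1 * gauss1 0 p.2.
Proof. by rewrite /gauss2 /gauss1 -expRD !mul0r !addr0 opprD. Qed.

Lemma rintegrable_gauss2 : rintegrable (leb2 R) gauss2.
Proof.
have [h _] := rintegrable_prod (rintegrable_gauss1 0) (rintegrable_gauss1 0).
by move: h; congr rintegrable; apply/funext => p; rewrite gauss2E.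
Qed.

Lemma Rintegral_gauss2 : \int[leb2 R]_p gauss2 p = pi.
Proof.
have [_ h] := rintegrable_prod (rintegrable_gauss1 0) (rintegrable_gauss1 0).
under eq_Rintegral do rewrite gauss2E.
rewrite h !Rintegral_gauss1 expr0n mul0r expR0 !mul1r -expr2 sqr_sqrtr//.
exact: pi_ge0.
Qed.

Lemma measurable_gauss2 : measurable_fun setT gauss2.
Proof. exact: rintegrable_measurable rintegrable_gauss2. Qed.

Lemma gauss2_rot (c s : R) p : c ^+ 2 + s ^+ 2 = 1 -> gauss2 (plane_rot c s p) = gauss2 p.
Proof.
move=> cs; rewrite /gauss2 /plane_rot /=; congr (expR (- _)).
rewrite (_ : _ + _ = (c ^+ 2 + s ^+ 2) * (p.1 ^+ 2 + p.2 ^+ 2)); last by ring.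
by rewrite cs mul1r.
Qed.

Lemma cplane_rot (c s : R) p : cplane (plane_rot c s p) = cplane p * (c +i* s).
Proof.
by apply/eqP; rewrite eq_complex /=; apply/andP; split; apply/eqP; ring.
Qed.

(** Each rotation leaves the integral of f unchanged, so integrating over the angle multiplies it by
    2 pi. Fubini then performs the angular integral first; this plays the role of polar
    coordinates. *)
Lemma Rintegral_rot_average (f phi : RR * RR -> R) : rintegrable (leb2 R) f ->
  (forall p, (\int[leb]_(t in `[0%R, (pi *+ 2)%R]) (f (plane_rot (cos t) (sin t) p))%:E)%E = (phi p)%:E) ->
  (pi *+ 2) * \int[leb2 R]_p f p = \int[leb2 R]_p phi p.
Proof.
move=> hf hphi.
have pi2 : 0 <= pi *+ 2 :> R by rewrite mulrn_wge0// pi_ge0.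
have mf := rintegrable_measurable hf.
pose I : set RR := `[0%R, (pi *+ 2)%R]%classic.
have mI : measurable I by exact: measurable_itv.
have lebI : (leb I = (pi *+ 2)%:E)%E.
  have := lebesgue_measure_itv `[0%R, (pi *+ 2 : R)%R]; rewrite /= lte_fin -/I => ->.
  by case: ltP => //= h; [rewrite sube0|congr EFin; apply/le_anti; rewrite h pi2].
pose q (t : RR) (p : RR * RR) := plane_rot (cos t) (sin t) p.
have pq t : mpres (leb2 R) (q t) by apply: mpres_rot; exact: cos2Dsin2.
(* The indicator of the angular interval turns the average into an integral over the whole line, the
   domain expected by [Rintegral_swap]. *)
pose F (tp : RR * (RR * RR)) := \1_I tp.1 * f (q tp.1 tp.2).
have mI1 : measurable_fun setT (\1_I : RR -> R) by exact: measurable_indic.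
have mt : measurable_fun setT (fun tp : RR * (RR * RR) => tp.1) by exact: measurable_fst.
have mp : measurable_fun setT (fun tp : RR * (RR * RR) => tp.2) by exact: measurable_snd.
have mp1 : measurable_fun setT (fun tp : RR * (RR * RR) => tp.2.1).
  by apply: (measurableT_comp _ mp); exact: measurable_fst.
have mp2 : measurable_fun setT (fun tp : RR * (RR * RR) => tp.2.2).
  by apply: (measurableT_comp _ mp); exact: measurable_snd.
have mc : measurable_fun setT (fun tp : RR * (RR * RR) => cos tp.1).
  by apply: (measurableT_comp _ mt); apply: continuous_measurable_fun; exact: continuous_cos.
have ms : measurable_fun setT (fun tp : RR * (RR * RR) => sin tp.1).
  by apply: (measurableT_comp _ mt); apply: continuous_measurable_fun; exact: continuous_sin.
have mq : measurable_fun setT (fun tp : RR * (RR * RR) => q tp.1 tp.2).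
  apply/measurable_fun_pairP; split; rewrite /q /plane_rot /comp /=.
    by apply: measurable_funB; exact: measurable_funM.
  by apply: measurable_funD; exact: measurable_funM.
have mF : measurable_fun setT F.
  apply: measurable_funM; first exact: measurableT_comp.
  exact: measurableT_comp mf mq.
pose B := \int[leb2 R]_p `|f p|.
have iI : rintegrable leb (\1_I : RR -> R).
  by apply: integrable_indic_itv.
have inner (t : RR) (u : RR * RR -> R) : rintegrable (leb2 R) u ->
    (\int[leb2 R]_p (\1_I t * u (q t p))%:E)%E = (\1_I t * \int[leb2 R]_p u p)%:E.
  move=> hu; have [h1 h2] := mpres_integrable (pq t) hu.
  by rewrite -h2 -RintegralZl// EFin_Rintegral//; exact: rintegrableZ.
have outer (k : R) : (\int[leb]_t (\1_I t * k)%:E)%E = (pi *+ 2 * k)%:E.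
  under eq_integral do rewrite mulrC.
  have hk := rintegrableZ k iI.
  rewrite -(EFin_Rintegral hk) RintegralZl// mulrC; congr (_ * _)%:E.
  rewrite /Rintegral integral_indic// setIT; exact: (congr1 fine lebI).
have -> : pi *+ 2 * \int[leb2 R]_p f p = \int[leb]_t (\1_I t * \int[leb2 R]_p f p).
  by rewrite /Rintegral outer.
refine (@Rintegral_swap _ _ RR (RR * RR)%type R leb (leb2_sf R) F (fun t => \1_I t * B) (fun t => \1_I t * \int[leb2 R]_p f p) phi _ _ _ _ _).
- exact: mF.
- move=> t; rewrite -[RHS]inner; last exact: rintegrable_norm.
  apply: eq_integral => p _; rewrite /F /= normrM; congr (_ * _)%:E.
  by rewrite ger0_norm.
- by rewrite outer ltry.
- by move=> t; rewrite -[RHS]inner.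
- move=> p; rewrite -[RHS]hphi [RHS]integral_mkcond; apply: eq_integral => t _.
  by rewrite /F /= patchE indicE; case: ifPn => _; rewrite ?mul1r ?mul0r.
Qed.

Lemma Rintegral_gauss2_Z k : \int[leb2 R]_p (k * gauss2 p) = k * pi.
Proof. by rewrite RintegralZl ?Rintegral_gauss2//; exact: rintegrable_gauss2. Qed.

(** Along a rotation orbit the Gaussian is constant and h has mean h 0, so the rotation average of
    the integrand is h 0 times the Gaussian, of total mass pi. *)
Lemma cintegral_gauss_mean (h : R[i] -> R[i]) : (forall z, exists dh, cdiff h z dh) ->
  cintegrable (leb2 R) (fun p => h (cplane p) * (gauss2 p)%:C) ->
  cintegral (leb2 R) (fun p => h (cplane p) * (gauss2 p)%:C) = pi%:C * h 0.
Proof.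
move=> dh [i1 i2].
have ch z : ccont h z by have [u /cdiff_cont] := dh z.
have pi0 : (pi *+ 2 : R) != 0 by rewrite mulrn_eq0/= gt_eqF// pi_gt0.
have cp (p : RR * RR) : cpath (fun t : R => h (cplane p * (cos t +i* sin t))).
  apply: cpath_comp => //; have := @continuous_cos R; have := @continuous_sin R => hs hc.
  split => t; rewrite /=.
  - by apply: cvgB; apply: cvgM; try exact: cvg_cst; [exact: hc|exact: hs].
  - by apply: cvgD; apply: cvgM; try exact: cvg_cst; [exact: hs|exact: hc].
have mean (p : RR * RR) := sint_circle_mean (cplane p) dh.
(* The argument is run once for a real-homogeneous map [u], then used with the real and the
   imaginary part. *)
have part (u : R[i] -> R) (um : forall z (k : R), u (k%:C * z) = k * u z) :
   (forall p : RR * RR, continuous (fun t : R => u (h (cplane p * (cos t +i* sin t))))) ->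
   (forall p : RR * RR, \int[leb]_(t in `[0%R, pi *+ 2]) u (h (cplane p * (cos t +i* sin t))) = (pi *+ 2) * u (h 0)) ->
   rintegrable (leb2 R) (fun p => u (h (cplane p) * (gauss2 p)%:C)) ->
   \int[leb2 R]_p u (h (cplane p) * (gauss2 p)%:C) = pi * u (h 0).
  move=> cu hu iu.
  apply: (mulfI pi0); rewrite (@Rintegral_rot_average _ (fun p => pi *+ 2 * u (h 0) * gauss2 p))//.
    by rewrite Rintegral_gauss2_Z; ring.
  move=> p.
  have E t : u (h (cplane (plane_rot (cos t) (sin t) p)) * (gauss2 (plane_rot (cos t) (sin t) p))%:C) =
     gauss2 p * u (h (cplane p * (cos t +i* sin t))).
    by rewrite mulrC um cplane_rot gauss2_rot// cos2Dsin2.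
  under eq_integral do rewrite E.
  have ci := continuous_integrable_itv 0 (pi *+ 2) (cu p).
  rewrite (mulrC _ (gauss2 p)) -(hu p) EFinM /Rintegral fineK; last exact: integrable_fin_num.
  by rewrite -integralZl.
rewrite /cintegral (@part (@complex.Re R))//; last 3 first.
- by move=> z k; rewrite cReM /= mul0r subr0.
- by move=> p; exact: (cp p).1.
- by move=> p; have /(congr1 (@complex.Re R)) := mean p; rewrite cReM /= mul0r subr0.
rewrite (@part (@complex.Im R))//; last 3 first.
- by move=> z k; rewrite cImM /= mul0r addr0.
- by move=> p; exact: (cp p).2.
- by move=> p; have /(congr1 (@complex.Im R)) := mean p; rewrite cImM /= mul0r addr0.
by apply/eqP; rewrite eq_complex cReM cImM /= !mul0r subr0 addr0 !eqxx.
Qed.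

End GaussianIntegrals.

(** * Power series and the Fock space *)

Section PowerSeries.
Variable R : realType.
Implicit Types (a : nat -> R[i]) (z w : R[i]).

(** Convergence at x = 1 bounds the coefficients by some [K]. By strong induction the lower terms
    vanish, and for small x the term of degree m dominates the tail beyond it. *)
Lemma ctends_powers_unique a :
  (forall x : R, 0 < x -> ctends (series (fun m => a m * x%:C ^+ m)) 0) -> forall m, a m = 0.
Proof.
move=> h.
have [K K0 aK] : exists2 K, 0 <= K & forall m, normc (a m) <= K.
  have h1 : ctends (fun n => a n) 0.
    have h0 := h 1 ltr01.
    have hs := (ctends_shift (series (fun m => a m * (1 : R)%:C ^+ m)) 0).2 h0.
    have := ctendsB hs h0; rewrite subrr; congr ctends; apply/funext => n.
    by rewrite /series/= big_nat_recr//= addrAC subrr add0r rmorph1 expr1n mulr1.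
  have h2 := ctends_normc h1.
  have := cvg_seq_bounded (cvgP _ h2) => -[M [_ hM]].
  exists `|M + 1| => // m; have := hM (M + 1); rewrite ltrDl ltr01 => /(_ isT m Logic.I) /=.
  by rewrite ger0_norm ?normc_ge0// => /le_trans; apply; exact: ler_norm.
move=> m; elim/ltn_ind : m => m IH.
apply/normc_eq0P/le_anti; rewrite normc_ge0 andbT; apply/ler_addgt0Pr => e e0; rewrite add0r.
(* With x <= 1/2 a geometric series bounds the tail beyond m by K x^m 2x. Dividing by x^m leaves |a
   m| <= 2 K x, which the second bound on x makes at most e. *)
pose x := Num.min 2^-1 (e / (2 * K + 1)).
have K1 : 0 < 2 * K + 1 by lra.
have x0 : 0 < x by rewrite lt_min invr_gt0 ltr0n divr_gt0.
have x2 : x <= 2^-1 by rewrite ge_min lexx.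
have xe : x * (2 * K) <= e.
  have : x <= e / (2 * K + 1) by rewrite ge_min lexx orbT.
  by rewrite ler_pdivlMr//; nra.
clearbody x.
have hm : ctends (fun n => series (fun m => a m * x%:C ^+ m) (n + m.+1)%N) 0.
  have := h x x0; rewrite /ctends => hx.
  by rewrite (cvg_shiftn m.+1 (fun n => normc (series (fun m => a m * x%:C ^+ m) n - 0))).
have bd n : normc (a m * x%:C ^+ m) - K * x ^+ m * (2 * x) <=
    normc (series (fun m => a m * x%:C ^+ m) (n + m.+1)%N).
  rewrite /series/= (big_cat_nat (leq0n m) (leq_trans (leqnSn m) (leq_addl n m.+1)))/=.
  rewrite [X in normc (X + _)]big_nat_cond big1 ?add0r; last first.
    by move=> j /andP[/andP[_ jm] _]; rewrite IH// mul0r.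
  rewrite big_ltn ?leq_addl//.
  set t := \sum_(_ <= i < _) _.
  have tle : normc t <= K * x ^+ m * (2 * x).
    rewrite /t -{1}[m.+1]add0n big_addn addnK.
    rewrite (le_trans (le_normc_sum _ _ _))//.
    apply: (@le_trans _ _ (\sum_(0 <= i < n) K * x ^+ m * (x * 2^-1 ^+ i))).
      apply: ler_sum => i _; rewrite normcM normcX normc_real (ger0_norm (ltW x0)).
      rewrite -mulrA; apply: ler_pM; rewrite ?normc_ge0// ?exprn_ge0 ?(ltW x0)//.
      rewrite addnC exprD exprSr mulrAC -mulrA; apply: ler_wpM2l; first by rewrite exprn_ge0// ltW.
      rewrite mulrC; apply: ler_wpM2l; first exact: ltW.
      by rewrite lerXn2r// ?nnegrE ?(ltW x0)// invr_ge0.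
    rewrite -mulr_sumr; apply: ler_wpM2l; first by rewrite mulr_ge0// exprn_ge0// ltW.
    rewrite -mulr_sumr mulrC; apply: ler_wpM2r; first exact: ltW.
    rewrite sum_half_powers.
    by rewrite lerBlDr lerDl mulr_ge0// exprn_ge0// invr_ge0.
  have := le_normcB (a m * x%:C ^+ m) (- t); rewrite opprK normcN; lra.
have hl := ctends_normc hm; rewrite normc0 in hl.
have : normc (a m * x%:C ^+ m) - K * x ^+ m * (2 * x) <= 0.
  rewrite -(cvg_lim _ hl)//; apply: limr_ge; first by apply/cvg_ex; eexists; exact: hl.
  by apply: nearW.
rewrite normcM normcX normc_real (ger0_norm (ltW x0)) subr_le0.
rewrite (mulrC K) -mulrA mulrC ler_pM2l ?exprn_gt0// => /le_trans; apply.
by rewrite mulrCA (mulrC K); apply: le_trans xe; rewrite mulrCA.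
Qed.

Lemma ctends_powers_inj a b (f : R -> R[i]) :
  (forall x : R, 0 < x -> ctends (series (fun m => a m * x%:C ^+ m)) (f x)) ->
  (forall x : R, 0 < x -> ctends (series (fun m => b m * x%:C ^+ m)) (f x)) -> forall m, a m = b m.
Proof.
move=> ha hb m; apply/eqP; rewrite -subr_eq0; apply/eqP; move: m.
apply: ctends_powers_unique => x x0.
have := ctendsB (ha x x0) (hb x x0); rewrite subrr; congr ctends; apply/funext => n.
by rewrite /series/= -sumrB; apply: eq_bigr => k _; rewrite mulrBl.
Qed.

(** The weight m! is the squared Fock norm of z^m. *)
Definition wsq a m : R := m`!%:R * normc (a m) ^+ 2.

Lemma wsq_ge0 a m : 0 <= wsq a m.
Proof. by rewrite mulr_ge0// sqr_ge0. Qed.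

(** By the inequality between products and squares, |a m| r^m is at most m! |a m|^2 + r^(2m) / m!,
    and both series converge. *)
Lemma csummable_wsq a r : 0 <= r -> cvgn (series (wsq a)) -> cvgn (series (fun m => normc (a m) * r ^+ m)).
Proof.
move=> r0 ha.
apply: (@series_le_cvg _ _ (fun m => wsq a m + exp_coeff (r ^+ 2) m)).
- by move=> m; rewrite mulr_ge0 ?normc_ge0// exprn_ge0.
- move=> m; rewrite addr_ge0 ?wsq_ge0//.
  by apply: divr_ge0 => //; rewrite exprn_ge0// exprn_ge0.
- move=> m; rewrite /wsq /exp_coeff/=.
  have p0 : 0 < m`!%:R :> R by rewrite ltr0n fact_gt0.
  rewrite -exprM mulnC exprM.
  set p : R := m`!%:R in p0 *; set u := normc (a m); set v := r ^+ m.
  rewrite -(ler_pM2l p0) mulrDr [p * (_ / p)]mulrCA divff ?gt_eqF// mulr1.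
  by have := sqr_ge0 (p * u - v); have := sqr_ge0 (p * u); have := sqr_ge0 v; nra.
- rewrite (_ : series _ = series (wsq a) \+ series (exp_coeff (r ^+ 2))).
    by apply: is_cvgD => //; exact: is_cvg_series_exp_coeff.
  by apply/funext => n; rewrite /series/= big_split.
Qed.

Lemma normc_powD_le z w (rho : R) m : 1 <= rho -> normc z + normc w <= rho ->
  normc ((z + w) ^+ m - z ^+ m - m%:R * z ^+ m.-1 * w) <= normc w ^+ 2 * (4 * rho) ^+ m.
Proof.
move=> r1 zw; have zr : normc z <= rho by rewrite (le_trans _ zw)// lerDl normc_ge0.
have r0 : 0 <= rho by lra.
(* The induction carries the factor m^2: multiplying the remainder by z + w adds one term m z^(m-1)
   w^2. At the end m^2 <= 4^m is absorbed into the power. *)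
suff h : normc ((z + w) ^+ m - z ^+ m - m%:R * z ^+ m.-1 * w) <= normc w ^+ 2 * (m%:R ^+ 2 * rho ^+ m).
  apply: (le_trans h); rewrite ler_wpM2l ?sqr_ge0// exprMn ler_wpM2r ?exprn_ge0//.
  have -> : 4 = 2 ^+ 2 :> R by rewrite expr2; lra.
  rewrite -exprM mulnC exprM lerXn2r ?nnegrE ?exprn_ge0// -natrX ler_nat.
  by rewrite ltnW// ltn_expl.
elim: m => [|m IH].
  by rewrite !expr0 mul0r mul0r subr0 subrr normc0 mulr_ge0 ?sqr_ge0// mulr_ge0 ?sqr_ge0// exprn_ge0.
have E : (z + w) ^+ m.+1 - z ^+ m.+1 - m.+1%:R * z ^+ m * w =
    (z + w) * ((z + w) ^+ m - z ^+ m - m%:R * z ^+ m.-1 * w) + m%:R * z ^+ m.-1 * w ^+ 2.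
  rewrite exprS -natr1 [z ^+ m.+1]exprS.
  case: m {IH} => [|m]; first by rewrite /= !expr0; ring.
  by rewrite /= !exprS; ring.
rewrite /= E (le_trans (le_normcD _ _))// !normcM !normcX normc_natr.
have zwr : normc (z + w) <= rho by rewrite (le_trans (le_normcD _ _)).
have zm : normc z ^+ m.-1 <= rho ^+ m.+1.
  apply: (@le_trans _ _ (rho ^+ m.-1)); first by rewrite lerXn2r// nnegrE normc_ge0.
  by rewrite ler_weXn2l// (leq_trans (leq_pred m)).
apply: (@le_trans _ _ (rho * (normc w ^+ 2 * (m%:R ^+ 2 * rho ^+ m)) + m%:R * rho ^+ m.+1 * normc w ^+ 2)).
  apply: lerD; first by apply: ler_pM => //; exact: normc_ge0.
  by rewrite ler_wpM2r ?sqr_ge0// ler_wpM2l.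
rewrite (exprS rho m) -natr1.
have := sqr_ge0 (normc w); have := exprn_ge0 m r0; have := ler0n R m.
move: (normc w ^+ 2) (rho ^+ m) (m%:R : R) => A B M M0 B0 A0.
have h1 : 0 <= A * (rho * B) by rewrite !mulr_ge0.
have h2 : 0 <= A * (rho * B) * M by rewrite mulr_ge0.
nra.
Qed.

(** The derivative is the termwise one, [csum b]. The error is |w|^2 times the sum of |a m| (4
    rho)^m, finite because the radius of convergence is infinite; rho = |z| + 1 covers every |w| <
    1. *)
Lemma power_series_cdiff a h : (forall r, 0 <= r -> cvgn (series (fun m => normc (a m) * r ^+ m))) ->
  (forall z, ctends (series (fun m => a m * z ^+ m)) (h z)) -> forall z, exists d, cdiff h z d.
Proof.
move=> ca hh z.
pose rho := normc z + 1.
have z0 := normc_ge0 z.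
have rho1 : 1 <= rho by rewrite /rho; lra.
have r40 : 0 <= 4 * rho by lra.
pose b m := a m * (m%:R * z ^+ m.-1).
have cb : csummable b.
  apply: (csummable_le _ (ca _ r40)) => m.
  rewrite normcM ler_wpM2l ?normc_ge0// normcM normc_natr normcX.
  apply: (@le_trans _ _ (4 ^+ m * rho ^+ m)); last by rewrite exprMn.
  apply: ler_pM => //; first by rewrite exprn_ge0// normc_ge0.
    by rewrite -natrX ler_nat ltnW// ltn_expl.
  apply: (@le_trans _ _ (rho ^+ m.-1)); last by rewrite ler_weXn2l// leq_pred.
  by rewrite lerXn2r ?nnegrE ?normc_ge0//; rewrite /rho; lra.
set L := limn (series (fun m => normc (a m) * (4 * rho) ^+ m)).
have nd : nondecreasing_seq (series (fun m => normc (a m) * (4 * rho) ^+ m)).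
  by apply: nondecreasing_series => n _ _; rewrite mulr_ge0 ?normc_ge0// exprn_ge0.
have L0 : 0 <= L.
  apply: (@le_trans _ _ (series (fun m => normc (a m) * (4 * rho) ^+ m) 0%N)).
    by rewrite /series/= big_nil.
  exact: (nondecreasing_cvgn_le nd (ca _ r40)).
exists (csum b) => e e0.
exists (Num.min 1 (e / (L + 1))); first by rewrite lt_min ltr01 divr_gt0//; lra.
move=> w; rewrite lt_min => /andP[w1 we].
have hc := ctendsB (ctendsB (hh (z + w)) (hh z)) (ctendsMl w (csum_ctends cb)).
rewrite (mulrC _ w); have hn := ctends_normc hc.
apply: (@le_trans _ _ (normc w ^+ 2 * L)).
  rewrite -(cvg_lim _ hn)//; apply: limr_le; first by apply/cvg_ex; eexists; exact: hn.
  apply: nearW => n; rewrite /series/= mulr_sumr -!sumrB.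
  rewrite (le_trans (le_normc_sum _ _ _))//.
  apply: (@le_trans _ _ (normc w ^+ 2 * series (fun m => normc (a m) * (4 * rho) ^+ m) n)).
    rewrite /series/= mulr_sumr; apply: ler_sum => m _.
    rewrite (_ : _ - _ = a m * ((z + w) ^+ m - z ^+ m - m%:R * z ^+ m.-1 * w)); last by rewrite /b; ring.
    rewrite normcM mulrCA ler_wpM2l ?normc_ge0// normc_powD_le//.
    by rewrite /rho lerD2l ltW.
  by rewrite ler_wpM2l ?sqr_ge0//; exact: (nondecreasing_cvgn_le nd (ca _ r40)).
rewrite expr2 -mulrA mulrC; apply: ler_wpM2r; first exact: normc_ge0.
move: we; rewrite ltr_pdivlMr; last by lra.
have := normc_ge0 w; nra.
Qed.

End PowerSeries.

Lemma mpres_cintegrable d (T : measurableType d) (R : realType) (mu : {measure set T -> \bar R})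
  (S : T -> T) (f : T -> R[i]) : mpres mu S -> cintegrable mu f ->
  cintegrable mu (f \o S) /\ cintegral mu (f \o S) = cintegral mu f.
Proof.
move=> pS [i1 i2].
have [j1 E1] := mpres_integrable pS i1; have [j2 E2] := mpres_integrable pS i2.
by split => //; rewrite /cintegral -E1 -E2.
Qed.

(** * Reproducing formula and Taylor coefficients in the Fock space *)

Section FockSpace.
Variable R : realType.
Notation RR := (measurableTypeR R).
Notation leb2 := (leb2 R).
Implicit Types (f g h : R[i] -> R[i]) (z w : R[i]) (p : RR * RR) (a : nat -> R[i]).

Definition holo h := forall z, exists d, cdiff h z d.

Lemma holo_ccont h : holo h -> forall z, ccont h z.
Proof. by move=> hh z; have [d /cdiff_cont] := hh z. Qed.

Definition wnorm h p : R := normc (h (cplane p)) ^+ 2 * gauss2 p.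

Lemma fock_normsqE h : fock_normsq h = (pi^-1%:E * \int[leb2]_p (wnorm h p)%:E)%E.
Proof.
rewrite /fock_normsq; congr (_ * _)%E; apply: eq_integral => p _.
by rewrite /wnorm -[p.1 +i* p.2]/(cplane p) normc_cplane.
Qed.

Lemma measurable_wnorm h : (forall z, ccont h z) -> measurable_fun setT (wnorm h).
Proof.
move=> ch; apply: measurable_funM; last exact: measurable_gauss2.
by apply: measurable_normc2; exact: cmeasurable_plane.
Qed.

Lemma wnorm_ge0 h p : 0 <= wnorm h p.
Proof. by rewrite mulr_ge0 ?sqr_ge0// expR_ge0. Qed.

Lemma fock_rintegrable h : (forall z, ccont h z) -> (fock_normsq h < +oo)%E ->
  rintegrable leb2 (wnorm h).
Proof.
move=> ch; rewrite fock_normsqE => hoo.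
apply: rintegrable_ge0P; [exact: measurable_wnorm|exact: wnorm_ge0|].
have p0 : (0 < (pi : R)^-1%:E)%E by rewrite lte_fin invr_gt0 pi_gt0.
rewrite ltNge leye_eq; apply/negP => /eqP E; move: hoo; rewrite E.
by rewrite gt0_muley.
Qed.

Lemma fock_normsq_fin h : rintegrable leb2 (wnorm h) ->
  fock_normsq h = (pi^-1 * \int[leb2]_p wnorm h p)%:E.
Proof. by move=> hh; rewrite fock_normsqE EFinM EFin_Rintegral. Qed.

(** The sum of absolute values replaces the modulus of the point because the exponential then splits
    into one factor per variable, so that [gdom] is integrable as a product. *)
Definition expabs (r : R) p := expR (r * (`|p.1| + `|p.2|)).
Definition gdom (r : R) p : R := gauss_abs (2 * r) p.1 * gauss_abs (2 * r) p.2.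

Lemma gdomE r p : gdom r p = expabs r p ^+ 2 * gauss2 p.
Proof.
rewrite /gdom /gauss_abs /expabs /gauss2 [expR _ ^+ 2]expr2 -!expRD; congr expR; ring.
Qed.

Lemma rintegrable_gdom r : rintegrable leb2 (gdom r).
Proof. exact: (rintegrable_prod (rintegrable_gauss_abs _) (rintegrable_gauss_abs _)).1. Qed.

Lemma normc_cplane_le p : normc (cplane p) <= `|p.1| + `|p.2|.
Proof. exact: normc_le_ReIm. Qed.

Lemma expR_normc_le (r : R) p : 0 <= r -> expR (r * normc (cplane p)) <= expabs r p.
Proof. by move=> r0; rewrite ler_expR ler_wpM2l// normc_cplane_le. Qed.

Lemma le_dom h r p : normc (h (cplane p)) * expabs r p * gauss2 p <= wnorm h p + gdom r p.
Proof.
rewrite gdomE /wnorm -mulrDl; apply: ler_wpM2r; first exact: expR_ge0.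
have := sqr_ge0 (normc (h (cplane p)) - expabs r p); have := sqr_ge0 (normc (h (cplane p)));
have := sqr_ge0 (expabs r p); nra.
Qed.

Lemma cmeasurable_cplane : cmeasurable (@cplane R).
Proof. by split; [exact: measurable_fst|exact: measurable_snd]. Qed.

Lemma cmeasurable_gauss2 : cmeasurable (fun p => (gauss2 p)%:C : R[i]).
Proof. by apply: cmeasurable_real; exact: measurable_gauss2. Qed.

Lemma gauss2_ge0 p : 0 <= gauss2 p. Proof. exact: expR_ge0. Qed.

Lemma pi_factV m : ((pi * m`!%:R)^-1)%:C = (pi^-1)%:C * (m`!%:R)^-1 :> R[i].
Proof. by rewrite invfM rmorphM; congr (_ * _); rewrite fmorphV rmorph_nat. Qed.

Section Coefficients.
Variable h : R[i] -> R[i].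
Hypothesis hh : holo h.
Hypothesis ih : rintegrable leb2 (wnorm h).

Let dom r p := wnorm h p + gdom r p.
Let idom r : rintegrable leb2 (dom r).
Proof. by apply: rintegrableD => //; exact: rintegrable_gdom. Qed.

Let ch : forall z, ccont h z. Proof. exact: holo_ccont. Qed.
Let mh : cmeasurable (fun p : RR * RR => h (cplane p)). Proof. exact: cmeasurable_plane. Qed.

(** The Gaussian integrand of h against the conjugate of the reproducing kernel exp(conj z w), w
    being the point p. *)
Let rker z p := h (cplane p) * cexp (z * conjc (cplane p)) * (gauss2 p)%:C.

Let normc_ker_le z w : normc (cexp (z * conjc w)) <= expR (normc z * normc w).
Proof.
rewrite normc_cexp ler_expR (le_trans (ler_norm _))// (le_trans (ler_Re_normc _))//.
by rewrite normcM normc_conjc.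
Qed.

Lemma cintegrable_rker z : cintegrable leb2 (rker z).
Proof.
apply: cintegrable_le (idom (normc z)) _.
  apply: cmeasurableM; last exact: cmeasurable_gauss2.
  apply: cmeasurableM => //; apply: cmeasurable_cexp; apply: cmeasurableM.
    exact: cmeasurable_cst.
  by apply: cmeasurable_conjc; exact: cmeasurable_cplane.
move=> p; apply: le_trans (le_dom h (normc z) p).
rewrite /rker !normcM normc_real (ger0_norm (gauss2_ge0 _)).
rewrite ler_wpM2r ?gauss2_ge0// ler_wpM2l ?normc_ge0//.
by rewrite (le_trans (normc_ker_le _ _))// expR_normc_le// normc_ge0.
Qed.

(* The Gaussian mean value property applied to w |-> h(z+w) exp(- conj z w),
   followed by a translation. *)
Lemma reproducing z : cintegral leb2 (rker z) = pi%:C * h z.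
Proof.
pose k w := h (w + z) * cexp (- conjc z * w).
have hk : holo k.
  move=> w; have [d hd] := hh (w + z).
  have h1 : cdiff (fun w => w + z) w (1 + 0).
    by apply: cdiffD; [exact: cdiff_id|exact: cdiff_cst].
  have h2 := cdiff_comp h1 hd.
  have h3 : cdiff (fun w => - conjc z * w) w (0 * w + - conjc z * 1).
    by apply: cdiffM; [exact: cdiff_cst|exact: cdiff_id].
  have h4 := cdiff_comp h3 (cdiff_cexp _).
  by eexists; exact: (cdiffM h2 h4).
pose S p : RR * RR := (p.1 + complex.Re z, p.2 + complex.Im z).
have pS : mpres leb2 S by exact: mpres_translation.
(* With w the point before translation, the exponents combine as z conj(w + z) - |w + z|^2 = - conj
   z w - |w|^2. *)
have E p : rker z (S p) = k (cplane p) * (gauss2 p)%:C.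
  have SE : cplane (S p) = cplane p + z.
    by apply/eqP; rewrite eq_complex /= cReD cImD !eqxx.
  rewrite /rker /k SE -!mulrA; congr (_ * _).
  have gE q : (gauss2 q)%:C = cexp (- (cplane q * conjc (cplane q))) :> R[i].
    by rewrite mulc_conjc -rmorphN cexp_real normc_cplane.
  rewrite !gE SE -!cexpD; congr cexp; rewrite rmorphD/=; ring.
have [j <-] := mpres_cintegrable pS (cintegrable_rker z).
have SE : rker z \o S = fun p => k (cplane p) * (gauss2 p)%:C by apply/funext.
rewrite SE in j *; rewrite cintegral_gauss_mean//.
by rewrite /k add0r mulr0 cexp0 mulr1.
Qed.

Definition fterm m p := h (cplane p) * conjc (cplane p) ^+ m * (gauss2 p)%:C.
(** The m-th Taylor coefficient, read as the pairing of h with w^m divided by pi m!, the Gaussian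
    integral of |w^m|^2. *)
Definition fcoef m : R[i] := (pi * m`!%:R)^-1%:C * cintegral leb2 (fterm m).

(** The exponential series inside the reproducing formula is integrated term by term. Integrability
    of each [fterm h m] comes from the same domination at z = 1. *)
Lemma fock_expansion z : (forall m, cintegrable leb2 (fterm m)) /\
  ctends (series (fun m => fcoef m * z ^+ m)) (h z).
Proof.
pose T z m p := h (cplane p) * cexp_term (z * conjc (cplane p)) m * (gauss2 p)%:C.
have mT z' m : cmeasurable (T z' m).
  apply: cmeasurableM; last exact: cmeasurable_gauss2.
  apply: cmeasurableM => //; rewrite /cexp_term.
  apply: cmeasurableM; last exact: cmeasurable_cst.
  apply: cmeasurableX; apply: cmeasurableM; first exact: cmeasurable_cst.
  by apply: cmeasurable_conjc; exact: cmeasurable_cplane.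
have key z' := @cintegral_series _ _ _ leb2 (T z') (rker z') (dom (normc z')) (mT z').
have sT z' p : ctends (series (T z' ^~ p)) (rker z' p).
  have := ctendsMl (h (cplane p) * (gauss2 p)%:C) (ctends_cexp (z' * conjc (cplane p))).
  rewrite mulrAC; congr ctends; apply/funext => n.
  by rewrite /series/= mulr_sumr; apply: eq_bigr => k _; rewrite /T mulrAC.
have bT z' n p : \sum_(0 <= k < n) normc (T z' k p) <= dom (normc z') p.
  apply: le_trans (le_dom h (normc z') p).
  apply: (@le_trans _ _ (normc (h (cplane p)) * gauss2 p * series (exp_coeff (normc (z' * conjc (cplane p)))) n)).
    rewrite /series/= mulr_sumr; apply: ler_sum => k _.
    by rewrite /T normcM normcM normc_real (ger0_norm (gauss2_ge0 _)) normc_cexp_term mulrAC.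
  rewrite mulrAC ler_wpM2r ?gauss2_ge0// ler_wpM2l ?normc_ge0//.
  apply: le_trans (expR_normc_le _ (normc_ge0 z')).
  rewrite normcM normc_conjc.
  apply: (nondecreasing_cvgn_le _ (is_cvg_series_exp_coeff _)).
  apply: nondecreasing_series => k _ _.
  by rewrite /exp_coeff/= mulr_ge0 ?invr_ge0// exprn_ge0// mulr_ge0 ?normc_ge0.
have fT m : fterm m = (fun p => m`!%:R * T 1 m p).
  apply/funext => p; rewrite /fterm /T /cexp_term mul1r.
  have f0 : m`!%:R != 0 :> R[i] by rewrite pnatr_eq0 -lt0n fact_gt0.
  by field.
have iT z' : forall m, cintegrable leb2 (T z' m) by have [] := key z' (sT z') (idom _) (bT z').
have if_ m : cintegrable leb2 (fterm m) by rewrite fT; exact: cintegrableZ.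
split => //.
have [_ _ hs] := key z (sT z) (idom _) (bT z).
have := ctendsMl (pi^-1%:C) hs; rewrite reproducing mulrA -rmorphM mulVf ?gt_eqF ?pi_gt0// mul1r.
congr ctends; apply/funext => n; rewrite /series/= mulr_sumr; apply: eq_bigr => m _.
have -> : T z m = (fun p => (z ^+ m / m`!%:R) * fterm m p).
  by apply/funext => p; rewrite /T /fterm /cexp_term exprMn; ring.
rewrite cintegralZ// /fcoef pi_factV; ring.
Qed.

End Coefficients.

Definition fpoly a N w : R[i] := \sum_(0 <= m < N) a m * w ^+ m.

Lemma holo_cst (c : R[i]) : holo (fun=> c).
Proof. by move=> z; exists 0; exact: cdiff_cst. Qed.

Lemma holoM f g : holo f -> holo g -> holo (fun w => f w * g w).
Proof.
by move=> hf hg z; have [d hd] := hf z; have [d' hd'] := hg z; eexists; exact: cdiffM hd hd'.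
Qed.

Lemma holoD f g : holo f -> holo g -> holo (fun w => f w + g w).
Proof.
by move=> hf hg z; have [d hd] := hf z; have [d' hd'] := hg z; eexists; exact: cdiffD hd hd'.
Qed.

Lemma holo_id : holo id.
Proof. by move=> z; exists 1; exact: cdiff_id. Qed.

Lemma holo_mono n : holo (fun w => w ^+ n).
Proof.
elim: n => [|n IH].
  rewrite (_ : (fun w => _) = fun=> 1); first exact: holo_cst.
  by apply/funext => w; rewrite expr0.
rewrite (_ : (fun w => _) = fun w => w * w ^+ n); first exact: holoM holo_id IH.
by apply/funext => w; rewrite exprS.
Qed.

Lemma holo_fpoly a N : holo (fpoly a N).
Proof.
elim: N => [|N IH].
  rewrite (_ : fpoly a 0 = fun=> 0); first exact: holo_cst.
  by apply/funext => w; rewrite /fpoly big_nil.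
rewrite (_ : fpoly a N.+1 = fun w => fpoly a N w + a N * w ^+ N).
  by apply: holoD => //; apply: holoM (holo_mono N); exact: holo_cst.
by apply/funext => w; rewrite /fpoly big_nat_recr.
Qed.

Lemma pow_le_expR (x : R) n : 0 <= x -> x ^+ n <= n`!%:R * expR x.
Proof.
move=> x0; case: n => [|n]; first by rewrite expr0 fact0 mul1r -expR0 ler_expR.
have p0 : 0 < n.+1`!%:R :> R by rewrite ltr0n fact_gt0.
rewrite mulrC -ler_pdivrMr//; apply: le_trans (expR_ge1Dxn n x0); lra.
Qed.

Lemma rintegrable_wnorm_mono n : rintegrable leb2 (wnorm (fun w => w ^+ n)).
Proof.
apply: rintegrable_le (rintegrableZ (n`!%:R ^+ 2) (rintegrable_gdom 1)) _.
  by apply: measurable_wnorm; exact/holo_ccont/holo_mono.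
move=> p; rewrite ger0_norm ?wnorm_ge0// gdomE /wnorm mulrA ler_wpM2r ?gauss2_ge0//.
rewrite -exprMn lerXn2r ?nnegrE ?normc_ge0 ?mulr_ge0 ?expR_ge0//.
rewrite normcX (le_trans (pow_le_expR n (normc_ge0 _)))// ler_wpM2l//.
by have := @expR_normc_le 1 p ler01; rewrite mul1r.
Qed.

Lemma ctends_kronecker n z : ctends (series (fun m => (m == n)%:R * z ^+ m)) (z ^+ n).
Proof.
rewrite /ctends -(cvg_shiftn n.+1).
rewrite (_ : (fun k => _) = fun=> 0); first exact: cvg_cst.
apply/funext => N; rewrite /series/=.
rewrite (bigD1_seq n) ?mem_index_iota ?iota_uniq ?leq_addl//= eqxx mul1r.
by rewrite big1 ?addr0 ?subrr ?normc0// => i /negbTE ->; rewrite mul0r.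
Qed.

Lemma cintegral_fterm h m : cintegral leb2 (fterm h m) = (pi * m`!%:R)%:C * fcoef h m.
Proof.
by rewrite /fcoef mulrA -rmorphM divff ?mul1r// mulf_neq0 ?gt_eqF ?pi_gt0// ltr0n fact_gt0.
Qed.

(** This is the orthogonality of the monomials together with their norms, obtained by uniqueness of
    power series: the expansion of w^n given by [fock_expansion] must be the obvious one. *)
Lemma fcoef_mono n m : fcoef (fun w => w ^+ n) m = (m == n)%:R.
Proof.
apply: (@ctends_powers_inj R (fcoef (fun w => w ^+ n)) (fun m => (m == n)%:R)
  (fun x => x%:C ^+ n)) => x _; last exact: ctends_kronecker.
exact: (fock_expansion (holo_mono n) (rintegrable_wnorm_mono n) x%:C).2.
Qed.

Lemma cintegrable_fterm_mono n m : cintegrable leb2 (fterm (fun w => w ^+ n) m).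
Proof. exact: (fock_expansion (holo_mono n) (rintegrable_wnorm_mono n) 0).1. Qed.

Lemma fterm_fpoly a N m : fterm (fpoly a N) m =
  fun p => \sum_(0 <= n < N) a n * fterm (fun w => w ^+ n) m p.
Proof.
apply/funext => p; rewrite /fterm /fpoly !mulr_suml; apply: eq_bigr => n _.
by rewrite !mulrA.
Qed.

Lemma cintegrable_fterm_fpoly a N m : cintegrable leb2 (fterm (fpoly a N) m).
Proof.
rewrite fterm_fpoly; apply: cintegrable_sum => n; apply: cintegrableZ.
exact: cintegrable_fterm_mono.
Qed.

Lemma cintegral_fterm_fpoly a N m : (m < N)%N ->
  cintegral leb2 (fterm (fpoly a N) m) = (pi * m`!%:R)%:C * a m.
Proof.
move=> mN; rewrite fterm_fpoly cintegral_sum; last first.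
  by move=> n; apply: cintegrableZ; exact: cintegrable_fterm_mono.
under eq_bigr => n _ do rewrite (cintegralZ _ (cintegrable_fterm_mono n m)) cintegral_fterm fcoef_mono.
rewrite (bigD1_seq m) ?mem_index_iota ?iota_uniq//= eqxx mulr1 mulrC.
by rewrite big1 ?addr0// => i; rewrite eq_sym => /negbTE ->; rewrite mulr0 mulr0.
Qed.

Lemma cross_fpoly h a N p : h (cplane p) * conjc (fpoly a N (cplane p)) * (gauss2 p)%:C =
  \sum_(0 <= m < N) conjc (a m) * fterm h m p.
Proof.
rewrite /fpoly rmorph_sum/= mulr_sumr mulr_suml; apply: eq_bigr => m _.
by rewrite rmorphM rmorphXn/= /fterm; ring.
Qed.

Lemma cintegral_cross_fpoly h a N : (forall m, cintegrable leb2 (fterm h m)) ->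
  cintegrable leb2 (fun p => h (cplane p) * conjc (fpoly a N (cplane p)) * (gauss2 p)%:C) /\
  cintegral leb2 (fun p => h (cplane p) * conjc (fpoly a N (cplane p)) * (gauss2 p)%:C) =
  \sum_(0 <= m < N) conjc (a m) * cintegral leb2 (fterm h m).
Proof.
move=> ih; rewrite (_ : (fun p => _) = fun p => \sum_(0 <= m < N) conjc (a m) * fterm h m p); last first.
  by apply/funext => p; exact: cross_fpoly.
have iz m : cintegrable leb2 (fun p => conjc (a m) * fterm h m p) by exact: cintegrableZ.
split; first exact: cintegrable_sum.
by rewrite cintegral_sum//; apply: eq_bigr => m _; rewrite cintegralZ.
Qed.

Lemma wnormC h p : (wnorm h p)%:C = h (cplane p) * conjc (h (cplane p)) * (gauss2 p)%:C.
Proof. by rewrite /wnorm rmorphM mulc_conjc. Qed.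

Lemma rintegrable_of_C (f : RR * RR -> R) : cintegrable leb2 (fun p => (f p)%:C) -> rintegrable leb2 f.
Proof. by case. Qed.

Lemma sum_wsq a N : \sum_(0 <= m < N) conjc (a m) * ((pi * m`!%:R)%:C * a m) =
  (pi * \sum_(0 <= m < N) wsq a m)%:C.
Proof.
rewrite mulr_sumr rmorph_sum; apply: eq_bigr => m _.
transitivity ((pi * m`!%:R)%:C * (a m * conjc (a m))); first by ring.
have E : pi * wsq a m = (pi * m`!%:R) * normc (a m) ^+ 2 by rewrite /wsq mulrA.
by rewrite mulc_conjc -rmorphM E.
Qed.

Lemma wnorm_fpoly a N : rintegrable leb2 (wnorm (fpoly a N)) /\
  \int[leb2]_p wnorm (fpoly a N) p = pi * \sum_(0 <= m < N) wsq a m.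
Proof.
have [i E] := cintegral_cross_fpoly a N (cintegrable_fterm_fpoly a N).
have W : (fun p => (wnorm (fpoly a N) p)%:C) =
    (fun p => fpoly a N (cplane p) * conjc (fpoly a N (cplane p)) * (gauss2 p)%:C).
  by apply/funext => p; exact: wnormC.
split; first by apply: rintegrable_of_C; rewrite W.
apply: (@complexI R); rewrite -cintegral_real W E -sum_wsq.
by apply: eq_big_nat => m /andP[_ mN]; rewrite cintegral_fterm_fpoly.
Qed.

(** Expand the nonnegative integral of |h - p|^2 against the Gaussian, p being the Taylor polynomial
    of h; the cross term and the norm of p both equal pi times the weighted sum. *)
Lemma fock_bessel h N : holo h -> rintegrable leb2 (wnorm h) ->
  pi * \sum_(0 <= m < N) wsq (fcoef h) m <= \int[leb2]_p wnorm h p.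
Proof.
move=> hh ih; set a := fcoef h; set s := \sum_(0 <= m < N) _.
have ift := (fock_expansion hh ih 0).1.
have [ix Ex] := cintegral_cross_fpoly a N ift.
have [ip Ep] := wnorm_fpoly a N.
have Exs : cintegral leb2 (fun p => h (cplane p) * conjc (fpoly a N (cplane p)) * (gauss2 p)%:C) = (pi * s)%:C.
  by rewrite Ex -sum_wsq; apply: eq_bigr => m _; rewrite cintegral_fterm.
pose X p := complex.Re (h (cplane p) * conjc (fpoly a N (cplane p)) * (gauss2 p)%:C).
have iX : rintegrable leb2 X by case: ix.
have EX : \int[leb2]_p X p = pi * s by have /(congr1 (@complex.Re R)) := Exs.
have key p : wnorm h p - 2 * X p + wnorm (fpoly a N) p = wnorm (fun w => h w - fpoly a N w) p.
  rewrite /X /wnorm !sqr_normcE; move: (h _) (fpoly _ _ _) => -[a1 a2] [b1 b2] /=; ring.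
have : 0 <= \int[leb2]_p (wnorm h p - 2 * X p + wnorm (fpoly a N) p).
  by apply: Rintegral_ge0 => p _; rewrite key wnorm_ge0.
have i2X := rintegrableZ 2 iX.
have iB := rintegrableB ih i2X.
rewrite RintegralD// RintegralB// RintegralZl// EX Ep -/s; lra.
Qed.

Lemma fock_coef_cvg h : holo h -> rintegrable leb2 (wnorm h) ->
  cvgn (series (wsq (fcoef h))) /\ pi * limn (series (wsq (fcoef h))) <= \int[leb2]_p wnorm h p.
Proof.
move=> hh ih.
have nd : nondecreasing_seq (series (wsq (fcoef h))).
  by apply: nondecreasing_series => n _ _; exact: wsq_ge0.
have p0 : 0 < pi :> R := pi_gt0 R.
have bd n : series (wsq (fcoef h)) n <= pi^-1 * \int[leb2]_p wnorm h p.
  by rewrite mulrC ler_pdivlMr// mulrC; exact: fock_bessel.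
have cv : cvgn (series (wsq (fcoef h))).
  by apply: nondecreasing_is_cvgn => //; eexists => _ [n _ <-]; exact: bd.
split => //; rewrite mulrC -ler_pdivlMr// mulrC.
by apply: limr_le => //; apply: nearW.
Qed.

Lemma fock_fatou h a : (forall z, ctends (series (fun m => a m * z ^+ m)) (h z)) ->
  cvgn (series (wsq a)) -> (\int[leb2]_p (wnorm h p)%:E <= (pi * limn (series (wsq a)))%:E)%E.
Proof.
move=> hz ca.
apply: (@le_integral_lim _ _ _ leb2 (fun N => wnorm (fpoly a N)) _ _ 0%N).
- by move=> N; apply: measurable_wnorm; exact/holo_ccont/holo_fpoly.
- by move=> N p; exact: wnorm_ge0.
- move=> p; apply: cvgM; last exact: cvg_cst.
  have h1 := ctends_normc (hz (cplane p)).
  rewrite expr2; under eq_fun do rewrite expr2.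
  by apply: cvgM; exact: h1.
- move=> N _; have [i E] := wnorm_fpoly a N; rewrite -EFin_Rintegral// E lee_fin.
  rewrite ler_pM2l ?pi_gt0//; apply: (nondecreasing_cvgn_le _ ca).
  by apply: nondecreasing_series => n _ _; exact: wsq_ge0.
Qed.

(** For the norm, Bessel gives one inequality, and Fatou along the Taylor polynomials gives the
    other. *)
Lemma fock_taylor h : fock h -> [/\ cvgn (series (wsq (fcoef h))),
  forall z, ctends (series (fun m => fcoef h m * z ^+ m)) (h z) &
  fock_normsq h = (limn (series (wsq (fcoef h))))%:E].
Proof.
move=> [/entireP hh hoo].
have ih := fock_rintegrable (holo_ccont hh) hoo.
have [cv lb] := fock_coef_cvg hh ih.
have hz z := (fock_expansion hh ih z).2.
split => //; rewrite fock_normsq_fin//; congr EFin.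
have ub := fock_fatou hz cv; rewrite -EFin_Rintegral// lee_fin in ub.
have p0 : pi != 0 :> R by rewrite gt_eqF// pi_gt0.
apply: (mulfI p0); rewrite mulrA divff// mul1r.
by apply/le_anti; rewrite ub lb.
Qed.

(** Converse of [fock_taylor]: the weights force an infinite radius of convergence, so h is entire,
    Fatou makes its norm finite, and uniqueness of power series identifies the coefficients. *)
Lemma taylor_fock a h : cvgn (series (wsq a)) ->
  (forall z, ctends (series (fun m => a m * z ^+ m)) (h z)) ->
  [/\ fock h, fcoef h = a & fock_normsq h = (limn (series (wsq a)))%:E].
Proof.
move=> ca hz.
have hh : holo h.
  by apply: power_series_cdiff hz => r r0; exact: csummable_wsq.
have ub := fock_fatou hz ca.
have ih : rintegrable leb2 (wnorm h).
  apply: rintegrable_ge0P; [exact: (measurable_wnorm (holo_ccont hh))|exact: wnorm_ge0|].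
  by rewrite (le_lt_trans ub)// ltry.
have hf : fock h.
  by split; [exact/entireP|rewrite fock_normsq_fin// ltry].
have [_ hz' E] := fock_taylor hf.
have ae : fcoef h = a.
  by apply/funext; apply: (@ctends_powers_inj R (fcoef h) a (fun x => h x%:C)) => x _; [exact: hz'|exact: hz].
by split; rewrite // E ae.
Qed.

End FockSpace.

(** * Hermite functions *)

Section HermiteSeries.
Variable R : realType.
Implicit Types (x r t : R) (z : R[i]).

(** Taylor coefficients of exp(-z^2 / 2). *)
Definition gcoef k : R := if odd k then 0 else (- 2^-1) ^+ k./2 / k./2`!%:R.

(* Taylor coefficients in z of exp(sqrt 2 z x - z^2/2). *)
Definition hpoly m x : R := convol (fun j => (Num.sqrt 2 * x) ^+ j / j`!%:R) gcoef m.

Lemma series_double (V : nmodType) (u : nat -> V) n :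
  \sum_(0 <= k < n.*2) u k = \sum_(0 <= j < n) (u j.*2 + u j.*2.+1).
Proof.
elim: n => [|n IH]; first by rewrite !big_nil.
by rewrite doubleS !big_nat_recr//= IH addrA.
Qed.

Lemma gcoef_even j : gcoef j.*2 = (- 2^-1) ^+ j / j`!%:R.
Proof. by rewrite /gcoef odd_double doubleK. Qed.

Lemma gcoef_odd j : gcoef j.*2.+1 = 0.
Proof. by rewrite /gcoef /= odd_double. Qed.

Lemma gcoef_norm_series r n : 0 <= r ->
  \sum_(0 <= k < n) `|gcoef k| * r ^+ k <= expR (r ^+ 2 / 2).
Proof.
move=> r0; apply: (@le_trans _ _ (\sum_(0 <= k < n.*2) `|gcoef k| * r ^+ k)).
  have n2 : (n <= n.*2)%N by rewrite -addnn leq_addr.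
  rewrite (big_cat_nat (leq0n n) n2)/=.
  by rewrite lerDl sumr_ge0// => k _; rewrite mulr_ge0// exprn_ge0.
rewrite series_double.
rewrite (eq_bigr (fun j => exp_coeff (r ^+ 2 / 2) j)); last first.
  move=> j _; rewrite gcoef_even gcoef_odd normr0 mul0r addr0 normrM normrX normrN.
  rewrite ger0_norm ?invr_ge0// ger0_norm ?invr_ge0// /exp_coeff/= -mul2n exprM exprMn exprVn.
  by rewrite expr2 !exprMn exprVn [LHS]mulrC mulrA.
apply: (nondecreasing_cvgn_le _ (is_cvg_series_exp_coeff _)).
apply: nondecreasing_series => k _ _.
by rewrite /exp_coeff/= mulr_ge0 ?invr_ge0// exprn_ge0// divr_ge0// sqr_ge0.
Qed.

Lemma csummable_gcoef z : csummable (fun k => (gcoef k)%:C * z ^+ k).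
Proof.
rewrite /csummable (_ : (fun k => normc _) = fun k => `|gcoef k| * normc z ^+ k); last first.
  by apply/funext => k; rewrite normcM normc_real normcX.
apply: nondecreasing_is_cvgn.
  by apply: nondecreasing_series => k _ _; rewrite mulr_ge0// exprn_ge0// normc_ge0.
by exists (expR (normc z ^+ 2 / 2)) => _ [n _ <-]; apply: gcoef_norm_series; exact: normc_ge0.
Qed.

Arguments csummable_gcoef z : clear implicits.

(** The partial sums of even length are exactly those of the exponential series at -z^2 / 2;
    absolute convergence already provides a limit for the full sequence. *)
Lemma ctends_gcoef z : ctends (series (fun k => (gcoef k)%:C * z ^+ k)) (cexp (- (z ^+ 2 / 2))).
Proof.
have h := csum_ctends (csummable_gcoef z).
suff -> : cexp (- (z ^+ 2 / 2)) = csum (fun k => (gcoef k)%:C * z ^+ k) by [].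
apply: (ctends_unique (ctends_cexp _)).
have h2 : ctends (fun n => series (fun k => (gcoef k)%:C * z ^+ k) n.*2) (csum (fun k => (gcoef k)%:C * z ^+ k)).
  apply/cvgrPdist_lt => e e0; have /cvgrPdist_lt /(_ _ e0)[N _ hN] := h.
  by exists N => // n /= Nn; apply: hN => /=; rewrite (leq_trans Nn)// -addnn leq_addr.
move: h2; congr ctends; apply/funext => n; rewrite /series/= series_double.
apply: eq_bigr => j _; rewrite gcoef_even gcoef_odd mul0r addr0 /cexp_term.
rewrite rmorphM rmorphXn rmorphN !fmorphV !rmorph_nat -mul2n exprM mulrAC -exprMn; congr (_ ^+ _ / _).
by rewrite mulNr mulrC.
Qed.

(** The generating function of [hpoly] with each factor's coefficients replaced by their absolute
    values, whence the positive sign in front of r^2 / 2. *)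
Definition hdom r x : R := expR (Num.sqrt 2 * r * `|x|) * expR (r ^+ 2 / 2).

Lemma hpoly_series_le r x n : 0 <= r -> \sum_(0 <= m < n) `|hpoly m x| * r ^+ m <= hdom r x.
Proof.
move=> r0.
pose a j : R := exp_coeff (Num.sqrt 2 * r * `|x|) j.
pose b k : R := `|gcoef k| * r ^+ k.
have y0 : 0 <= Num.sqrt 2 * r * `|x| by rewrite !mulr_ge0// sqrtr_ge0.
have a0 j : 0 <= a j by rewrite /a /exp_coeff/= mulr_ge0 ?invr_ge0// exprn_ge0.
have b0 k : 0 <= b k by rewrite mulr_ge0// exprn_ge0.
have ndb : nondecreasing_seq (series b) by apply: nondecreasing_series.
have cb : cvgn (series b).
  by apply: nondecreasing_is_cvgn => //; exists (expR (r ^+ 2 / 2)) => _ [k _ <-]; exact: gcoef_norm_series.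
have hc := series_conv_cvg_ge0 a0 b0 (is_cvg_series_exp_coeff _) cb.
have ndc : nondecreasing_seq (series (convol a b)).
  by apply: nondecreasing_series => k _ _; apply: sumr_ge0 => j _; rewrite mulr_ge0.
apply: (@le_trans _ _ (series (convol a b) n)).
  apply: ler_sum => m _; rewrite /hpoly /convol.
  apply: (@le_trans _ _ (\sum_(j < m.+1) `|(Num.sqrt 2 * x) ^+ j / j`!%:R * gcoef (m - j)| * r ^+ m)).
    by rewrite -mulr_suml ler_wpM2r ?exprn_ge0// ler_norm_sum.
  apply: ler_sum => j _; have jm : (j <= m)%N by rewrite -ltnS.
  rewrite (_ : r ^+ m = r ^+ j * r ^+ (m - j)); last by rewrite -exprD subnKC.
  rewrite /a /b /exp_coeff/= !normrM normrX normrM.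
  rewrite (ger0_norm (sqrtr_ge0 _)) (@ger0_norm _ (_^-1)) ?invr_ge0//.
  by rewrite !exprMn le_eqVlt; apply/orP; left; apply/eqP; ring.
apply: (@le_trans _ _ (limn (series (convol a b)))).
  by apply: nondecreasing_cvgn_le => //; apply/cvg_ex; eexists; exact: hc.
rewrite (cvg_lim _ hc)//; apply: ler_pM => //.
- apply: limr_ge; first exact: is_cvg_series_exp_coeff.
  by apply: nearW => k; apply: sumr_ge0 => j _.
- apply: limr_ge => //; apply: nearW => k; exact: sumr_ge0.
- by apply: limr_le => //; apply: nearW => k; exact: gcoef_norm_series.
Qed.

Lemma ctends_hpoly z x : ctends (series (fun m => (hpoly m x)%:C * z ^+ m))
  (cexp ((Num.sqrt 2)%:C * z * x%:C - z ^+ 2 / 2)).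
Proof.
rewrite cexpD.
have := ctends_conv (@csummable_cexp R ((Num.sqrt 2)%:C * z * x%:C)) (csummable_gcoef z)
  (@ctends_cexp R _) (@ctends_gcoef z).
congr ctends; congr series; apply/funext => m.
rewrite /hpoly /convol rmorph_sum mulr_suml; apply: eq_bigr => j _.
have jm : (j <= m)%N by rewrite -ltnS.
rewrite (_ : z ^+ m = z ^+ j * z ^+ (m - j)); last by rewrite -exprD subnKC.
rewrite /cexp_term !exprMn !rmorphM /= fmorphV rmorph_nat !rmorphXn /=; ring.
Qed.

End HermiteSeries.

Section HermiteFunctions.
Variable R : realType.
Notation RR := (measurableTypeR R).
Notation leb := (@lebesgue_measure R).
Implicit Types (x r t w : R) (z : R[i]).

Definition gcst : R := pi `^ (- 4^-1).

(* The normalized Hermite function psi_m is sqrt (m!) * hfun m. *)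
Definition hfun m x : R := gcst * expR (- x ^+ 2 / 2) * hpoly m x.

Definition hbound r x : R := gcst * expR (- x ^+ 2 / 2) * hdom r x.

Lemma gcst_gt0 : 0 < gcst.
Proof. by rewrite /gcst powR_gt0// pi_gt0. Qed.

Lemma gcst_sq : gcst ^+ 2 * Num.sqrt pi = 1.
Proof.
rewrite /gcst -powR_mulrn ?powR_ge0// -powRrM.
rewrite -powR12_sqrt ?pi_ge0// -powRD; last by apply/implyP => _; rewrite gt_eqF// pi_gt0.
by rewrite (_ : _ + _ = 0) ?powRr0//; field.
Qed.

Lemma hbound_ge0 r x : 0 <= hbound r x.
Proof. by rewrite !mulr_ge0 ?expR_ge0// ltW// gcst_gt0. Qed.

Lemma hfun_series_le r x n : 0 <= r -> \sum_(0 <= m < n) `|hfun m x| * r ^+ m <= hbound r x.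
Proof.
move=> r0; rewrite /hbound.
rewrite (_ : \sum_(_ <= _ < _) _ = gcst * expR (- x ^+ 2 / 2) * \sum_(0 <= m < n) `|hpoly m x| * r ^+ m).
  by rewrite ler_wpM2l ?hpoly_series_le// mulr_ge0 ?expR_ge0// ltW// gcst_gt0.
rewrite mulr_sumr; apply: eq_bigr => m _; rewrite normrM ger0_norm ?mulrA//.
by rewrite mulr_ge0 ?expR_ge0// ltW// gcst_gt0.
Qed.

(** The choice r = 1 makes the bound uniform in m. *)
Lemma hfun_le m x : `|hfun m x| <= hbound 1 x.
Proof.
apply: le_trans (hfun_series_le x m.+1 ler01); rewrite big_nat_recr//= expr1n mulr1 lerDr.
by apply: sumr_ge0 => k _; rewrite mulr_ge0// exprn_ge0.
Qed.

Lemma SB_kernelE z x : SB_kernel z x =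
  (gcst * expR (- x ^+ 2 / 2))%:C * cexp ((Num.sqrt 2)%:C * z * x%:C - z ^+ 2 / 2).
Proof.
rewrite /SB_kernel rmorphM/= -[RHS]mulrA; congr (_ * _).
rewrite -cexp_real -cexpD; congr cexp.
rewrite rmorphM rmorphN rmorphXn fmorphV rmorph_nat; by field.
Qed.

Lemma ctends_SB_kernel z x : ctends (series (fun m => (hfun m x)%:C * z ^+ m)) (SB_kernel z x).
Proof.
rewrite SB_kernelE; have := ctendsMl (gcst * expR (- x ^+ 2 / 2))%:C (ctends_hpoly z x).
congr ctends; apply/funext => n; rewrite /series/= mulr_sumr; apply: eq_bigr => m _.
by rewrite mulrA -rmorphM.
Qed.

Lemma SB_kernel_real w x : SB_kernel w%:C x =
  (gcst * expR (- x ^+ 2 / 2) * expR (Num.sqrt 2 * w * x - w ^+ 2 / 2))%:C.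
Proof.
rewrite SB_kernelE (_ : _ - _ = (Num.sqrt 2 * w * x - w ^+ 2 / 2)%:C).
  by rewrite cexp_real -rmorphM.
by rewrite rmorphB [X in _ = _ - X]rmorphM rmorphXn fmorphV rmorph_nat !rmorphM.
Qed.

Lemma normc_SB_kernel_le z x : normc (SB_kernel z x) <= hbound (normc z) x.
Proof.
have h := ctends_normc (ctends_SB_kernel z x).
rewrite -(cvg_lim _ h)//; apply: limr_le; first by apply/cvg_ex; eexists; exact: h.
apply: nearW => n; apply: le_trans (hfun_series_le x n (normc_ge0 z)).
rewrite (le_trans (le_normc_sum _ _ _))//; apply: ler_sum => m _.
by rewrite normcM normc_real normcX.
Qed.

Lemma measurable_hfun m : measurable_fun setT (hfun m : RR -> R).
Proof.
apply: measurable_funM; last first.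
  rewrite /hpoly /convol; apply: measurable_sum => j.
  apply: measurable_funM => //; apply: measurable_funM => //.
  by apply: measurable_funX; apply: measurable_funM => //; exact: measurable_id.
apply: measurable_funM => //; apply: measurableT_comp => //; apply: measurable_funM => //.
by apply: measurableT_comp => //; apply: measurable_funX; exact: measurable_id.
Qed.

Lemma measurable_hbound r : measurable_fun setT (hbound r : RR -> R).
Proof.
apply: measurable_funM; apply: measurable_funM => //; apply: measurableT_comp => //.
  apply: measurable_funM => //.
  by apply: measurableT_comp => //; apply: measurable_funX; exact: measurable_id.
by apply: measurable_funM => //; exact: measurableT_comp.
Qed.

Lemma hbound_sq r x : hbound r x ^+ 2 =
  gcst ^+ 2 * expR (r ^+ 2) * gauss_abs (2 * Num.sqrt 2 * r) x.
Proof.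
rewrite /hbound /hdom /gauss_abs expRD !exprMn -!expRM_natl.
rewrite (_ : 2 * (- x ^+ 2 / 2) = - x ^+ 2); last by field.
rewrite (_ : 2 * (r ^+ 2 / 2) = r ^+ 2); last by field.
by rewrite (_ : 2 * (_ * `|x|) = 2 * Num.sqrt 2 * r * `|x|); [ring|rewrite !mulrA].
Qed.

Lemma rL2_hbound r : rL2 leb (hbound r).
Proof.
split; first exact: measurable_hbound.
rewrite (_ : (fun x => _) = fun x => gcst ^+ 2 * expR (r ^+ 2) * gauss_abs (2 * Num.sqrt 2 * r) x).
  exact/rintegrableZ/rintegrable_gauss_abs.
by apply/funext => x; exact: hbound_sq.
Qed.

Lemma rL2_hfun m : rL2 leb (hfun m).
Proof.
split; first exact: measurable_hfun.
apply: rintegrable_le (rL2_hbound 1).2 _; first by apply: measurable_funX; exact: measurable_hfun.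
move=> x; rewrite ger0_norm ?sqr_ge0// -(ger0_norm (sqr_ge0 (hfun m x))) normrX.
by rewrite lerXn2r// ?nnegrE ?hbound_ge0// hfun_le.
Qed.

Lemma cmeasurable_SB_kernel z : @cmeasurable _ RR _ (SB_kernel z).
Proof.
apply: (@cmeasurable_lim _ RR _ (fun n x => series (fun m => (hfun m x)%:C * z ^+ m) n)).
  move=> n; apply: cmeasurable_sum => m; apply: cmeasurableM; last exact: cmeasurable_cst.
  by apply: cmeasurable_real; exact: measurable_hfun.
by move=> x; exact: ctends_SB_kernel.
Qed.

Definition rkernel w x : R :=
  gcst * expR (- x ^+ 2 / 2) * expR (Num.sqrt 2 * w * x - w ^+ 2 / 2).

Lemma rkernel_le w x : `|rkernel w x| <= hbound `|w| x.
Proof. by rewrite -!normc_real -SB_kernel_real normc_SB_kernel_le. Qed.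

Lemma measurable_rkernel w : measurable_fun setT (rkernel w : RR -> R).
Proof.
have [h _] := cmeasurable_SB_kernel w%:C; move: h.
by under eq_fun do rewrite SB_kernel_real.
Qed.

Lemma rL2_rkernel w : rL2 leb (rkernel w).
Proof.
split; first exact: measurable_rkernel.
apply: rintegrable_le (rL2_hbound `|w|).2 _; first by apply: measurable_funX; exact: measurable_rkernel.
move=> x; rewrite normrX.
by rewrite lerXn2r// ?nnegrE ?hbound_ge0// rkernel_le.
Qed.

(** The product of the two kernels is a Gaussian with linear term sqrt 2 (t + w) x. Its integral
    contributes exp((t + w)^2 / 2), of which the prefactor exp(-(t^2 + w^2) / 2) leaves exp(t w). *)
Lemma Rintegral_rkernel t w : \int[leb]_x (rkernel t x * rkernel w x) = expR (t * w).
Proof.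
rewrite (_ : \int[leb]_x _ = \int[leb]_x (gcst ^+ 2 * expR (- (t ^+ 2 + w ^+ 2) / 2) *
  gauss1 (Num.sqrt 2 * (t + w)) x)); last first.
  apply: eq_Rintegral => x _; rewrite /rkernel /gauss1 -[RHS]mulrA -expRD.
  rewrite (mulrACA (gcst * _)) (mulrACA gcst) -expr2 -!expRD -mulrA -expRD.
  by congr (_ * expR _); field.
rewrite RintegralZl ?rintegrable_gauss1//; last exact: rintegrable_gauss1.
rewrite Rintegral_gauss1 (mulrC (expR (_ / 4))) mulrACA gcst_sq mul1r -expRD; congr expR.
by rewrite exprMn sqr_sqrtr//; field.
Qed.

Lemma ctends_integral_hfun (f : R -> R) w : rL2 leb f ->
  ctends (series (fun m => (\int[leb]_x (hfun m x * f x))%:C * w%:C ^+ m))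
    (\int[leb]_x (rkernel w x * f x))%:C.
Proof.
move=> fL2.
pose f_ m x := (hfun m x * f x)%:C * w%:C ^+ m.
have [//|x|||_ h1 h2] := @cintegral_series _ RR R leb f_ (fun x => (rkernel w x * f x)%:C)
   (fun x => hbound `|w| x * `|f x|).
- move=> m; apply: cmeasurableM; last exact: cmeasurable_cst.
  by apply: cmeasurable_real; apply: measurable_funM; [exact: measurable_hfun|exact: fL2.1].
- rewrite rmorphM/= -SB_kernel_real mulrC.
  have := ctendsMl (f x)%:C (ctends_SB_kernel w%:C x); congr ctends; apply/funext => n.
  by rewrite /series/= mulr_sumr; apply: eq_bigr => m _; rewrite /f_ [(hfun m x * f x)%:C]rmorphM/= mulrCA mulrA.
- apply: rintegrableM; first exact: rL2_hbound.
  split; first by apply: measurableT_comp => //; exact: fL2.1.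
  by under eq_fun do rewrite -normrX ger0_norm ?sqr_ge0//; exact: fL2.2.
- move=> n x.
  rewrite (eq_bigr (fun m => `|hfun m x| * `|w| ^+ m * `|f x|)).
    by rewrite -mulr_suml ler_wpM2r// hfun_series_le.
  by move=> m _; rewrite /f_ normcM normcX !normc_real normrM mulrAC.
- move: h2; rewrite cintegral_real; congr ctends; congr series; apply/funext => m.
  rewrite /f_ -cintegral_real mulrC -cintegralZ; last first.
    by apply/cintegrable_real/rintegrableM => //; exact: rL2_hfun.
  by congr cintegral; apply/funext => x; rewrite mulrC.
Qed.

(* Both power series in t of \int A_t A_w = e^(tw), and then those in w, are compared. *)
Lemma Rintegral_hfun m n : \int[leb]_x (hfun m x * hfun n x) = (m == n)%:R / m`!%:R.
Proof.
have h1 w k : \int[leb]_x (hfun k x * rkernel w x) = w ^+ k / k`!%:R.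
  apply: (@complexI R); move: k.
  apply: (@ctends_powers_inj R _ _ (fun t => (expR (t * w))%:C)) => t t0.
    by rewrite -Rintegral_rkernel; apply: ctends_integral_hfun; exact: rL2_rkernel.
  rewrite -cexp_real; have := @ctends_cexp R (t * w)%:C; congr ctends; congr series.
  apply/funext => k; rewrite /cexp_term -rmorphXn exprMn.
  rewrite [in LHS]rmorphM [in RHS]rmorphM fmorphV rmorph_nat/= -[t%:C ^+ k]rmorphXn/=.
  by rewrite -mulrA mulrC.
apply: (@complexI R); move: n.
apply: (@ctends_powers_inj R _ _ (fun w => (w ^+ m / m`!%:R)%:C)) => w w0.
  rewrite -h1 (_ : \int[leb]_x _ = \int[leb]_x (rkernel w x * hfun m x)); last first.
    by apply: eq_Rintegral => x _; rewrite mulrC.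
  have := ctends_integral_hfun w (rL2_hfun m); congr ctends; congr series; apply/funext => k.
  by congr (_%:C * _); apply: eq_Rintegral => x _; rewrite mulrC.
apply: cvg_near_cst; exists m.+1 => // n /= mn.
rewrite /series/= big_mkord (bigD1 (Ordinal mn))//= eqxx mul1r big1 ?addr0; last first.
  move=> k km; rewrite -val_eqE/= in km; by rewrite eq_sym (negbTE km) mul0r mul0r.
by rewrite -rmorphXn -rmorphM mulrC subrr normc0.
Qed.

End HermiteFunctions.

(** * Coefficients of the transform *)

Section DoubleSeries.
Variable R : realType.

Lemma exists_pairing : exists pr : nat -> nat * nat, bijective pr.
Proof.
have /card_set_bijP[f] : ([set: nat] #= [set: nat * nat])%card by rewrite card_eq_sym card_nat2.
by rewrite setTT_bijective; exists f.
Qed.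

(** An arbitrary enumeration of index pairs, since Bessel and Riesz-Fischer are stated for
    sequences. In a pair, the first index is the power of z and the second that of conj z. *)
Definition npair : nat -> nat * nat := projT1 (cid exists_pairing).

Lemma npair_bij : bijective npair.
Proof. exact: projT2 (cid exists_pairing). Qed.

Lemma nneseries_pair (a : nat * nat -> \bar R) : (forall q, 0 <= a q)%E ->
  (\sum_(n <oo) \sum_(m <oo) a (m, n) = \sum_(k <oo) a (npair k))%E.
Proof.
move=> a0; rewrite [RHS]nneseries_esumT// nneseries_esumT; last by move=> n; exact: nneseries_ge0.
rewrite (_ : esum _ _ = (\esum_(n in [set: nat]) \esum_(m in [set: nat]) a (m, n))%E); last first.
  by apply: eq_esum => n _; rewrite nneseries_esumT.
rewrite (@esum_esum _ _ _ setT (fun=> setT) (fun n m => a (m, n)))//.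
rewrite -(@reindex_esum _ _ _ setT setT npair); last by rewrite setTT_bijective; exact: npair_bij.
rewrite (@reindex_esum _ _ _ (setT `*`` (fun=> setT)) setT (fun k : nat * nat => (k.2, k.1)))//.
by split => // [[? ?] [? ?] _ _ [-> ->]//|[m n] _]; exists (n, m).
Qed.

Lemma nneseries_EFin (u : nat -> R) : cvgn (series u) ->
  (\sum_(n <oo) (u n)%:E = (limn (series u))%:E)%E.
Proof.
by move=> cu; rewrite -EFin_lim//; congr (lim (_ @ \oo)); apply/funext => n; rewrite /= sumEFin.
Qed.

Lemma nneseries_cvgn (u : nat -> R) : (forall n, 0 <= u n) ->
  (\sum_(n <oo) (u n)%:E < +oo)%E -> cvgn (series u).
Proof.
move=> u0 uoo; apply: nondecreasing_is_cvgn; first exact: nondecreasing_series.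
exists (fine (\sum_(n <oo) (u n)%:E)%E) => _ [n _ <-].
rewrite -lee_fin fineK; last by rewrite ge0_fin_numE// nneseries_ge0// => *; rewrite lee_fin.
rewrite /series/= -sumEFin; apply: nneseries_lim_ge => k _ _; by rewrite lee_fin.
Qed.

End DoubleSeries.

Section PlaneHermite.
Variable R : realType.
Notation RR := (measurableTypeR R).
Notation leb := (@lebesgue_measure R).
Notation leb2 := (leb2 R).
Implicit Types (z : R[i]) (phi : (RR * RR)%type -> R[i]).

Lemma rL2_prod (f g : RR -> R) : rL2 leb f -> rL2 leb g -> rL2 leb2 (fun p => f p.1 * g p.2).
Proof.
move=> [mf f2] [mg g2]; split.
  by apply: measurable_funM; exact: measurableT_comp.
rewrite (_ : (fun p => _) = fun p : RR * RR => f p.1 ^+ 2 * g p.2 ^+ 2).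
  by case: (rintegrable_prod f2 g2).
by apply/funext => p; rewrite exprMn.
Qed.

(** The product psi_m(x) psi_n(y); the square root restores the normalization left out of [hfun]. *)
Definition herm2 (q : nat * nat) (p : RR * RR) : R :=
  Num.sqrt (q.1`!%:R * q.2`!%:R) * (hfun q.1 p.1 * hfun q.2 p.2).

Lemma rL2_herm2 q : rL2 leb2 (herm2 q).
Proof. by apply: rL2Z; apply: rL2_prod; exact: rL2_hfun. Qed.

Lemma Rintegral_herm2 q q' : \int[leb2]_p (herm2 q p * herm2 q' p) = (q == q')%:R.
Proof.
pose s (q : nat * nat) : R := Num.sqrt (q.1`!%:R * q.2`!%:R).
have h1 := rintegrableM (rL2_hfun R q.1) (rL2_hfun R q'.1).
have h2 := rintegrableM (rL2_hfun R q.2) (rL2_hfun R q'.2).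
have [i12 e12] := rintegrable_prod h1 h2.
rewrite (_ : \int[leb2]_p _ = \int[leb2]_p (s q * s q' *
  ((hfun q.1 p.1 * hfun q'.1 p.1) * (hfun q.2 p.2 * hfun q'.2 p.2)))); last first.
  by apply: eq_Rintegral => p _; rewrite /herm2 -/(s q) -/(s q'); ring.
rewrite RintegralZl// e12 !Rintegral_hfun.
have [<-|qq] := eqVneq q q'.
  have q0 : 0 <= (q.1`!%:R * q.2`!%:R : R) by rewrite mulr_ge0.
  rewrite !eqxx -expr2 sqr_sqrtr// !mul1r -invfM mulfV//.
case: q q' qq {h1 h2 i12 e12} => [m n] [m' n']/=; rewrite xpair_eqE negb_and.
by case/orP => /negbTE ->; rewrite !(mul0r, mulr0).
Qed.

Lemma herm2_orthonormal : orthonormal_seq leb2 (herm2 \o npair).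
Proof.
split => [k|j k]; first exact: rL2_herm2.
by rewrite Rintegral_herm2 (bij_eq npair_bij).
Qed.

Lemma L2_ReIm phi : L2 leb2 phi <->
  rL2 leb2 (fun p => complex.Re (phi p)) /\ rL2 leb2 (fun p => complex.Im (phi p)).
Proof.
split => [[[m1 m2]]|[[m1 i1] [m2 i2]]].
  rewrite /L2_normsq => hoo.
  have hi : rintegrable leb2 (fun p => normc (phi p) ^+ 2).
    by apply: rintegrable_ge0P => // [|p]; [exact: measurable_normc2|exact: sqr_ge0].
  split; split => //; apply: rintegrable_le hi _; try exact: measurable_funX.
    by move=> p; rewrite ger0_norm ?sqr_ge0// sqr_normcE lerDl sqr_ge0.
  by move=> p; rewrite ger0_norm ?sqr_ge0// sqr_normcE lerDr sqr_ge0.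
split; first by split.
rewrite /L2_normsq; under eq_integral do rewrite sqr_normcE.
exact: (rintegrable_lty (rintegrableD i1 i2)).
Qed.

Lemma L2_normsqE phi : L2 leb2 phi -> L2_normsq leb2 phi =
  (\int[leb2]_p (complex.Re (phi p) ^+ 2) + \int[leb2]_p (complex.Im (phi p) ^+ 2))%:E.
Proof.
move=> /L2_ReIm[[m1 i1] [m2 i2]]; rewrite /L2_normsq.
rewrite -RintegralD// EFin_Rintegral; last exact: rintegrableD.
by apply: eq_integral => p _; rewrite sqr_normcE.
Qed.

Lemma rL2_normc phi : L2 leb2 phi -> rL2 leb2 (fun p => normc (phi p)).
Proof.
move=> hphi; have [mphi _] := hphi; move/L2_ReIm: hphi => [[m1 i1] [m2 i2]].
split; first exact: measurable_normc.
by under eq_fun do rewrite sqr_normcE; exact: rintegrableD.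
Qed.

End PlaneHermite.

Section DoubleWeights.
Variable R : realType.

(** The coefficient array is indexed as a n m, with n the power of conj z, whereas pairs list the
    power of z first; hence the swapped arguments. *)
Definition wsq2 (a : nat -> nat -> R[i]) (q : nat * nat) : R :=
  q.1`!%:R * q.2`!%:R * normc (a q.2 q.1) ^+ 2.

Lemma wsq2_ge0 a q : 0 <= wsq2 a q.
Proof. by rewrite mulr_ge0 ?sqr_ge0// mulr_ge0. Qed.

Lemma SF_coef_normsqE c a : (forall n, cvgn (series (wsq (a n)))) ->
  (forall n, fock_normsq (c n) = (limn (series (wsq (a n))))%:E) ->
  SF_coef_normsq c = (\sum_(k <oo) (wsq2 a (npair k))%:E)%E.
Proof.
move=> ca ha; rewrite -(nneseries_pair (a := fun q => (wsq2 a q)%:E)); last first.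
  by move=> q; rewrite lee_fin wsq2_ge0.
apply: eq_eseriesr => n _; rewrite ha -nneseries_EFin// -nneseriesZl; last first.
  by move=> m _; rewrite lee_fin wsq_ge0.
by apply: eq_eseriesr => m _; rewrite -EFinM /wsq2 /wsq/= mulrA (mulrC n`!%:R).
Qed.

(** Row n is part of a convergent double series of nonnegative terms, in which it carries the
    additional factor n! >= 1. *)
Lemma cvgn_wsq2_row a n : cvgn (series (wsq2 a \o npair)) -> cvgn (series (wsq (a n))).
Proof.
move=> ca; apply: nneseries_cvgn; first by move=> m; exact: wsq_ge0.
have := ltry (limn (series (wsq2 a \o npair))); rewrite -nneseries_EFin//.
rewrite -(nneseries_pair (a := fun q => (wsq2 a q)%:E)); last first.
  by move=> q; rewrite lee_fin wsq2_ge0.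
apply: le_lt_trans.
apply: (@le_trans _ _ (\sum_(0 <= k < n.+1) \sum_(m <oo) (wsq2 a (m, k))%:E)%E); last first.
  apply: nneseries_lim_ge => k _ _; apply: nneseries_ge0 => m _ _; by rewrite lee_fin wsq2_ge0.
rewrite big_nat_recr//=.
apply: (@le_trans _ _ (\sum_(m <oo) (wsq2 a (m, n))%:E)%E).
  apply: lee_nneseries => [m _ _|m _]; first by rewrite lee_fin wsq_ge0.
  rewrite lee_fin /wsq /wsq2/= mulrAC ler_peMr//; first by rewrite mulr_ge0// sqr_ge0.
  by rewrite ler1n fact_gt0.
rewrite leeDr//; apply: sume_ge0 => k _; apply: nneseries_ge0 => m _ _.
by rewrite lee_fin wsq2_ge0.
Qed.

End DoubleWeights.

Section Transform.
Variable R : realType.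
Notation RR := (measurableTypeR R).
Notation leb := (@lebesgue_measure R).
Notation leb2 := (leb2 R).
Implicit Types (z : R[i]).

Section Coefficients.
Variable phi : (RR * RR)%type -> R[i].
Hypothesis phiL2 : L2 leb2 phi.

(** The coefficient of conj z^n z^m in the transform of [phi]. *)
Definition hcoef n m : R[i] :=
  cintegral leb2 (fun p => (hfun m p.1 * hfun n p.2)%:C * phi p).

(** The coefficient function of conj z^n: only the kernel in the second variable has been
    expanded. *)
Definition hrow n z : R[i] :=
  cintegral leb2 (fun p => SB_kernel z p.1 * (hfun n p.2)%:C * phi p).

Lemma rintegrable_hbound2 r s :
  rintegrable leb2 (fun p => hbound r p.1 * hbound s p.2 * normc (phi p)).
Proof.
apply: rintegrableM; last exact: rL2_normc.
by apply: rL2_prod; exact: rL2_hbound.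
Qed.

Let mphi : cmeasurable phi. Proof. by case: phiL2. Qed.

Lemma cmeasurable_fst (f : RR -> R[i]) : cmeasurable f -> cmeasurable (fun p : RR * RR => f p.1).
Proof.
by move=> [m1 m2]; split; [apply: (measurableT_comp m1)|apply: (measurableT_comp m2)];
  exact: measurable_fst.
Qed.

Lemma cmeasurable_snd (f : RR -> R[i]) : cmeasurable f -> cmeasurable (fun p : RR * RR => f p.2).
Proof.
by move=> [m1 m2]; split; [apply: (measurableT_comp m1)|apply: (measurableT_comp m2)];
  exact: measurable_snd.
Qed.

Lemma cmeasurable_hfun n : cmeasurable (fun x : RR => (hfun n x)%:C).
Proof. by apply: cmeasurable_real; exact: measurable_hfun. Qed.

Lemma hcoef_cintegrable m n : cintegrable leb2 (fun p => (hfun m p.1 * hfun n p.2)%:C * phi p).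
Proof.
apply: cintegrable_le (rintegrable_hbound2 1 1) _.
  apply: cmeasurableM => //; apply: cmeasurable_real.
  have [] := @rL2_prod _ (hfun m) (hfun n) (rL2_hfun R m) (rL2_hfun R n); by [].
move=> p; rewrite normcM normc_real normrM ler_wpM2r ?normc_ge0//.
by rewrite ler_pM// hfun_le.
Qed.

Lemma ctends_hrow n z : ctends (series (fun m => hcoef n m * z ^+ m)) (hrow n z).
Proof.
pose f_ m (p : RR * RR) := (hfun m p.1)%:C * z ^+ m * ((hfun n p.2)%:C * phi p).
have mh : cmeasurable (fun p : RR * RR => (hfun n p.2)%:C).
  exact: (cmeasurable_snd (cmeasurable_hfun n)).
have [m|p||k p|_ h1 h2] := @cintegral_series _ (RR * RR)%type R leb2 f_
   (fun p => SB_kernel z p.1 * (hfun n p.2)%:C * phi p)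
   (fun p => hbound (normc z) p.1 * hbound 1 p.2 * normc (phi p)).
- apply: cmeasurableM; last exact: cmeasurableM.
  apply: cmeasurableM; last exact: cmeasurable_cst.
  exact: (cmeasurable_fst (cmeasurable_hfun m)).
- have := ctendsMl ((hfun n p.2)%:C * phi p) (ctends_SB_kernel z p.1).
  congr ctends; last by ring.
  apply/funext => k; by rewrite /series/= mulr_sumr; apply: eq_bigr => m _; rewrite /f_ mulrC.
- exact: rintegrable_hbound2.
- rewrite (eq_bigr (fun m => `|hfun m p.1| * normc z ^+ m * (`|hfun n p.2| * normc (phi p)))).
    rewrite -mulr_suml -mulrA ler_pM//.
    + by apply: sumr_ge0 => m _; rewrite mulr_ge0// exprn_ge0// normc_ge0.
    + by rewrite mulr_ge0// normc_ge0.
    + exact: hfun_series_le (normc_ge0 _).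
    + by rewrite ler_wpM2r ?normc_ge0// hfun_le.
  by move=> m _; rewrite /f_ !normcM normcX !normc_real.
- move: h2; congr ctends; congr series; apply/funext => m.
  rewrite /f_ /hcoef mulrC -cintegralZ; last exact: hcoef_cintegrable.
  congr cintegral; apply/funext => p; rewrite [(hfun m p.1 * hfun n p.2)%:C]rmorphM/=; ring.
Qed.

(** Only the kernel in conj z is expanded here, the one in z being treated by [ctends_hrow]; each
    stage is a single series under one integrable majorant. *)
Lemma SB_integrable z : cintegrable leb2 (SB_integrand phi z) /\
  ctends (series (fun n => conjc z ^+ n * hrow n z)) (SB_transform phi z).
Proof.
pose f_ n (p : RR * RR) := conjc z ^+ n * (SB_kernel z p.1 * (hfun n p.2)%:C * phi p).
have mK : cmeasurable (fun p : RR * RR => SB_kernel z p.1).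
  exact: (cmeasurable_fst (cmeasurable_SB_kernel z)).
have mf n : cmeasurable (fun p : RR * RR => SB_kernel z p.1 * (hfun n p.2)%:C * phi p).
  apply: cmeasurableM => //; apply: cmeasurableM => //.
  exact: (cmeasurable_snd (cmeasurable_hfun n)).
have [n|p||k p|h1 h2 h3] := @cintegral_series _ (RR * RR)%type R leb2 f_
   (SB_integrand phi z)
   (fun p => hbound (normc z) p.1 * hbound (normc z) p.2 * normc (phi p)).
- by apply: cmeasurableM => //; exact: cmeasurable_cst.
- have := ctendsMl (SB_kernel z p.1 * phi p) (ctends_SB_kernel (conjc z) p.2).
  congr ctends; last by rewrite /SB_integrand; ring.
  apply/funext => k; by rewrite /series/= mulr_sumr; apply: eq_bigr => m _; rewrite /f_; ring.
- exact: rintegrable_hbound2.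
- rewrite (eq_bigr (fun n => `|hfun n p.2| * normc z ^+ n * (normc (SB_kernel z p.1) * normc (phi p)))).
    rewrite -mulr_suml mulrAC mulrC ler_pM//.
    + by rewrite mulr_ge0// normc_ge0.
    + by apply: sumr_ge0 => m _; rewrite mulr_ge0// exprn_ge0// normc_ge0.
    + by rewrite ler_wpM2r ?normc_ge0// normc_SB_kernel_le.
    + exact: hfun_series_le (normc_ge0 _).
  by move=> m _; rewrite /f_ !normcM normcX !normc_real normc_conjc; ring.
- split=> //; move: h3; congr ctends; congr series; apply/funext => n.
  rewrite /f_ /hrow -cintegralZ//.
  apply: cintegrable_le (rintegrable_hbound2 (normc z) 1) _ => // p.
  rewrite (normcM (_ * _)) (normcM (SB_kernel z p.1)) (normc_real (hfun n p.2)).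
  rewrite ler_wpM2r ?normc_ge0// ler_pM// ?normc_ge0//.
    exact: normc_SB_kernel_le.
  exact: hfun_le.
Qed.

Lemma hcoef_Re m n : \int[leb2]_p (complex.Re (phi p) * herm2 (m, n) p) =
  Num.sqrt (m`!%:R * n`!%:R) * complex.Re (hcoef n m).
Proof.
have [h1 _] := hcoef_cintegrable m n.
rewrite /hcoef/= -RintegralZl//; apply: eq_Rintegral => p _.
by rewrite /herm2 cReM/= mul0r subr0 mulrC mulrA.
Qed.

Lemma hcoef_Im m n : \int[leb2]_p (complex.Im (phi p) * herm2 (m, n) p) =
  Num.sqrt (m`!%:R * n`!%:R) * complex.Im (hcoef n m).
Proof.
have [_ h1] := hcoef_cintegrable m n.
rewrite /hcoef/= -RintegralZl//; apply: eq_Rintegral => p _.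
by rewrite /herm2 cImM/= mul0r addr0 mulrC mulrA.
Qed.

Lemma wsq2_hcoef q : wsq2 hcoef q = (\int[leb2]_p (complex.Re (phi p) * herm2 q p)) ^+ 2
  + (\int[leb2]_p (complex.Im (phi p) * herm2 q p)) ^+ 2.
Proof.
case: q => m n; rewrite hcoef_Re hcoef_Im !exprMn sqr_sqrtr ?mulr_ge0//.
by rewrite /wsq2 sqr_normcE mulrDr.
Qed.

(** The Hermite system is real, so Bessel's inequality for the real and the imaginary part of [phi]
    adds up to a bound for the weighted double sum. Each row is then in the Fock space by
    [taylor_fock]. *)
Lemma L2_to_SF : SF_expansion (SB_transform phi) hrow.
Proof.
have ON := herm2_orthonormal R.
have [hR hI] := (L2_ReIm phi).1 phiL2.
have cw : cvgn (series (wsq2 hcoef \o npair)).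
  apply: nondecreasing_is_cvgn; first by apply: nondecreasing_series => k _ _; exact: wsq2_ge0.
  exists (\int[leb2]_p (complex.Re (phi p) ^+ 2) + \int[leb2]_p (complex.Im (phi p) ^+ 2)).
  move=> _ [n _ <-]; rewrite /series/=.
  rewrite (eq_bigr (fun k => (\int[leb2]_p (complex.Re (phi p) * (herm2 (npair k)) p)) ^+ 2 +
    (\int[leb2]_p (complex.Im (phi p) * (herm2 (npair k)) p)) ^+ 2)); last first.
    by move=> k _; rewrite wsq2_hcoef.
  rewrite big_split/= lerD//; exact: (bessel ON).
have tf n := @taylor_fock R (hcoef n) (hrow n) (@cvgn_wsq2_row R hcoef n cw) (@ctends_hrow n).
split.
- by move=> n; case: (tf n).
- rewrite (@SF_coef_normsqE _ _ hcoef).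
  + by rewrite nneseries_EFin ?ltry.
  + by move=> n; exact: cvgn_wsq2_row.
  + by move=> n; case: (tf n).
- by move=> z; apply/ctendsP; case: (SB_integrable z).
Qed.

End Coefficients.

(** Riesz-Fischer is applied to the real and to the imaginary parts of sqrt(m! n!) times the Taylor
    coefficients of [c]. The function obtained has [c] as its rows, hence transform f. As [c] is any
    expansion of f, the lemma also applies to the one chosen by [SF_coef]. *)
Lemma SF_to_L2 f c : SF_expansion f c ->
  exists phi, [/\ L2 leb2 phi, SB_transform phi = f & L2_normsq leb2 phi = SF_coef_normsq c].
Proof.
move=> [fc coo cf].
pose a n := fcoef (c n).
have ca n : cvgn (series (wsq (a n))) by case: (fock_taylor (fc n)).
have cE n : fock_normsq (c n) = (limn (series (wsq (a n))))%:E by case: (fock_taylor (fc n)).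
have cz n z : ctends (series (fun m => a n m * z ^+ m)) (c n z) by case: (fock_taylor (fc n)).
have SFE := SF_coef_normsqE ca cE.
pose s (q : nat * nat) : R := Num.sqrt (q.1`!%:R * q.2`!%:R).
have s0 q : 0 < s q by rewrite sqrtr_gt0 mulr_gt0// ltr0n fact_gt0.
have ssq q : s q ^+ 2 = q.1`!%:R * q.2`!%:R by rewrite sqr_sqrtr// mulr_ge0.
pose d k := s (npair k) * complex.Re (a (npair k).2 (npair k).1).
pose e k := s (npair k) * complex.Im (a (npair k).2 (npair k).1).
have de k : d k ^+ 2 + e k ^+ 2 = wsq2 a (npair k).
  by rewrite /d /e !exprMn -mulrDr ssq -sqr_normcE.
have cw : cvgn (series (wsq2 a \o npair)).
  by apply: nneseries_cvgn => [k|]; [exact: wsq2_ge0|rewrite -SFE].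
have cd : cvgn (series (fun k => d k ^+ 2)).
  apply: series_le_cvg cw => k /=; rewrite ?sqr_ge0 ?wsq2_ge0//.
  by rewrite -de lerDl sqr_ge0.
have ce : cvgn (series (fun k => e k ^+ 2)).
  apply: series_le_cvg cw => k /=; rewrite ?sqr_ge0 ?wsq2_ge0//.
  by rewrite -de lerDr sqr_ge0.
have [fr [frL2 frc frn]] := riesz_fischer (herm2_orthonormal R) cd.
have [fi [fiL2 fic fin]] := riesz_fischer (herm2_orthonormal R) ce.
pose phi p := fr p +i* fi p.
have phiL2 : L2 leb2 phi by apply/L2_ReIm.
have hc n m : hcoef phi n m = a n m.
  have [k kE] : exists k, npair k = (m, n).
    by case: npair_bij => g _ gK; exists (g (m, n)); exact: gK.
  have hR : \int[leb2]_p (complex.Re (phi p) * herm2 (m, n) p) = d k by rewrite -frc /= kE.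
  have hI : \int[leb2]_p (complex.Im (phi p) * herm2 (m, n) p) = e k by rewrite -fic /= kE.
  rewrite (hcoef_Re phiL2) /d kE in hR; rewrite (hcoef_Im phiL2) /e kE in hI.
  have h x y : s (m, n) * x = s (m, n) * y -> x = y by apply: mulfI; rewrite gt_eqF.
  by apply/eqP; rewrite eq_complex; apply/andP; split; apply/eqP; exact: h.
have hr n : hrow phi n = c n.
  apply/funext => z; apply: (ctends_unique (@ctends_hrow phi phiL2 n z)).
  by move: (cz n z); congr ctends; congr series; apply/funext => m; rewrite hc.
exists phi; split => //.
- apply/funext => z; have [_ h] := SB_integrable phiL2 z.
  apply: (ctends_unique h); apply/ctendsP; move: (cf z).
  by have -> : c = hrow phi by apply/funext => n; rewrite hr.
- rewrite L2_normsqE//= frn fin SFE nneseries_EFin//; congr EFin.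
  rewrite -limD//; congr (lim (_ @ \oo)); apply/funext => n.
  rewrite [LHS](_ : _ = series (fun k => d k ^+ 2) n + series (fun k => e k ^+ 2) n)//.
  by rewrite /series/= -big_split; apply: eq_bigr => k _; rewrite /= de.
Qed.

End Transform.

(** * Fourier uniqueness and injectivity *)

Section BumpLimits.
Variable R : realType.
Implicit Types (x y t : R).

Lemma cvg_natr_expr y : 0 <= y -> y < 1 -> (fun n => n%:R * y ^+ n) @ \oo --> (0 : R).
Proof.
(* With w the square root of y, n w^n is at most the sum of the w^k for k < n, hence at most 1 / (1
   - w); the second factor w^n then tends to 0. *)
move=> y0 y1; pose w := Num.sqrt y.
have w0 : 0 <= w by exact: sqrtr_ge0.
have wy : w ^+ 2 = y by rewrite sqr_sqrtr.
have w1 : w < 1 by rewrite -(@ltr_pXn2r _ 2)// ?nnegrE// wy expr1n.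
have d0 : 0 < 1 - w by rewrite subr_gt0.
have b n : n%:R * w ^+ n * (1 - w) <= 1.
  apply: (@le_trans _ _ ((1 - w) * \sum_(k < n) w ^+ k)).
    rewrite mulrC ler_wpM2l ?(ltW d0)// mulr_natl -[X in _ *+ X]card_ord -sumr_const.
    by apply: ler_sum => k _; apply: ler_wiXn2l; rewrite ?(ltW w1)// ltnW.
  by rewrite -opprB mulNr -subrX1 opprB lerBlDr lerDl exprn_ge0.
apply: (@squeeze0 _ _ (fun n => w ^+ n / (1 - w))).
  move=> n; rewrite mulr_ge0 ?exprn_ge0//= ler_pdivlMr// -wy exprAC expr2.
  by rewrite mulrA mulrAC ler_piMl// exprn_ge0.
rewrite -(mul0r (1 - w)^-1); apply: cvgM; last exact: cvg_cst.
by apply: cvg_expr; rewrite ger0_norm.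
Qed.

Lemma bernoulli_le x k : 0 <= x -> x <= 1 -> 1 - k%:R * x <= (1 - x) ^+ k.
Proof.
move=> x0 x1; elim: k => [|k IH]; first by rewrite mul0r subr0.
rewrite exprS (@le_trans _ _ ((1 - x) * (1 - k%:R * x)))//; last by rewrite ler_wpM2l// subr_ge0.
by rewrite -natr1; have := mulr_ge0 (ler0n R k) (sqr_ge0 x); nra.
Qed.

(* The exponent is chosen so that n 2^n t^n tends to 0 for t < 1/2 and to +oo for t >= 1/2. *)
Definition bump n t : R := (1 - t ^+ n) ^+ (n * 2 ^ n).

Lemma bump01 n t : 0 <= t -> t <= 1 -> 0 <= bump n t <= 1.
Proof.
move=> t0 t1; have h1 : t ^+ n <= 1 by exact: exprn_ile1.
have h0 : 0 <= t ^+ n by exact: exprn_ge0.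
by rewrite /bump exprn_ge0 ?subr_ge0//= exprn_ile1// ?subr_ge0// lerBlDr lerDl.
Qed.

(** Below 1/2, Bernoulli's inequality gives the lower bound 1 - n (2t)^n. From 1/2 on, 1 - x <=
    e^(-x) gives the upper bound exp(-n (2t)^n), which is at most e^(-n). *)
Lemma cvg_bump t : 0 <= t -> t <= 1 -> bump ^~ t @ \oo --> ((t < 2^-1)%R%:R : R).
Proof.
move=> t0 t1; have [t2|t2] := ltP t 2^-1.
  have y1 : 2 * t < 1 by rewrite mulrC -ltr_pdivlMr// mul1r.
  have h := @cvg_natr_expr (2 * t) (mulr_ge0 (ler0n _ 2) t0) y1.
  apply: (@squeeze_cvgr _ _ _ _ (fun n => 1 - n%:R * (2 * t) ^+ n) (fun=> 1)).
  - apply: nearW => n; have /andP[_ ->] := bump01 n t0 t1; rewrite andbT.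
    apply: le_trans (bernoulli_le _ _ _); [|exact: exprn_ge0|exact: exprn_ile1].
    by rewrite natrM natrX exprMn mulrA.
  - by rewrite -[X in _ --> X]subr0; apply: cvgB => //; exact: cvg_cst.
  - exact: cvg_cst.
apply: (@squeeze0 _ _ (fun n => expR (-1) ^+ n)).
  move=> n; have /andP[-> _] /= := bump01 n t0 t1.
  rewrite -expRM_natl /bump.
  apply: (@le_trans _ _ (expR (- t ^+ n) ^+ (n * 2 ^ n))).
    by rewrite lerXn2r ?nnegrE ?expR_ge0 ?subr_ge0 ?exprn_ile1// expR_ge1Dx.
  rewrite -expRM_natl ler_expR !mulrN mulr1 lerN2 natrM natrX -mulrA -exprMn.
  by rewrite ler_peMr// exprn_ege1// mulrC -ler_pdivrMr// mul1r.
by apply: cvg_expr; rewrite ger0_norm ?expR_ge0// expR_lt1 ltrN10.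
Qed.

Lemma sin_gt0_small t : `|t| < 1 -> (0 < sin t) = (0 < t).
Proof.
rewrite ltr_norml => /andP[tN t1].
have pi1 : 1 < pi :> R by rewrite (lt_le_trans _ (pi_ge2 R))// ltr1n.
have [t0|t0|<-] := ltgtP 0 t; last by rewrite sin0 ltxx.
- by rewrite sin_gt0_pi// t0/= (lt_trans t1).
- apply/negbTE; rewrite -leNgt -oppr_ge0 -sinN ltW// sin_gt0_pi// oppr_gt0 t0/=.
  by rewrite (lt_trans _ pi1)// ltrNl.
Qed.

End BumpLimits.

Section FourierUniqueness.
Variable R : realType.
Notation RR := (measurableTypeR R).
Notation leb2 := (leb2 R).

(** The product structure is generated by preimages under the two coordinates, and the Borel sets of
    the line by open rays. *)
Lemma plane_measurable_ind (M : set (set (RR * RR))) : sigma_algebra setT M ->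
  (forall a, M [set p | a < p.1]) -> (forall a, M [set p | a < p.2]) ->
  forall A, measurable A -> M A.
Proof.
move=> Msa M1 M2.
have key (pr : (RR * RR)%type -> RR) : (forall a, M [set p | a < pr p]) ->
    forall B, measurable B -> M (pr @^-1` B).
  move=> Mpr B; rewrite [measurable]RGenOInfty.measurableE.
  apply: (@smallest_sub _ _ _ [set B | M (pr @^-1` B)]).
    case: Msa => M0 MC MU; split => /= [|A MA|F MF].
    - by rewrite preimage_set0.
    - exact: (MC _ MA).
    - by rewrite preimage_bigcup; exact: MU.
  move=> _ [a ->] /=; rewrite (_ : _ @^-1` _ = [set p | a < pr p])//.
  by apply/seteqP; split => p /=; rewrite in_itv/= andbT.
apply: smallest_sub => // _ [|] [B mB <-]; rewrite setTI; exact: key.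
Qed.

Definition cis (t : R) : R[i] := cexp (0 +i* t).

Lemma cisD s t : cis (s + t) = cis s * cis t.
Proof. by rewrite /cis -cexpD; congr cexp; apply/eqP; rewrite eq_complex/= addr0 !eqxx. Qed.

Lemma normc_cis t : normc (cis t) = 1.
Proof. by rewrite normc_cexp expR0. Qed.

Lemma sin_cis t : (sin t)%:C = (0 -i* 2^-1) * cis t + (0 +i* 2^-1) * cis (- t).
Proof.
rewrite /cis /cexp/= expR0 cosN sinN.
by apply/eqP; rewrite eq_complex/=; apply/andP; split; apply/eqP; field.
Qed.

Lemma cmeasurable_cis (f : RR * RR -> R) : measurable_fun setT f -> cmeasurable (fun p => cis (f p)).
Proof. by move=> mf; apply: cmeasurable_cexp; split => //=; exact: measurable_cst. Qed.

Variable G : (RR * RR)%type -> R[i].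
Hypothesis iG : cintegrable leb2 G.

(* Stable under multiplication by exponentials and under bounded limits, hence
   under multiplication by indicators of half-planes and then of Borel sets. *)
Definition annih (q : (RR * RR)%type -> R[i]) := [/\ cmeasurable q,
  exists C, forall p, normc (q p) <= C &
  forall a b, cintegral leb2 (fun p => G p * q p * cis (a * p.1 + b * p.2)) = 0].

Lemma measurable_linform (a b : R) : measurable_fun setT (fun p : RR * RR => a * p.1 + b * p.2).
Proof.
apply: measurable_funD; apply: measurable_funM => //.
Qed.

Lemma cintegrable_bounded (C : R) q a b : cmeasurable q -> (forall p, normc (q p) <= C) ->
  cintegrable leb2 (fun p => G p * q p * cis (a * p.1 + b * p.2)).
Proof.
move=> mq qC; apply: cintegrable_le (rintegrableZ C (cintegrable_normc iG)) _.
  apply: cmeasurableM; last by apply: cmeasurable_cis; exact: measurable_linform.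
  by apply: cmeasurableM => //; exact: cintegrable_measurable iG.
by move=> p; rewrite !normcM normc_cis mulr1 mulrC ler_wpM2r// normc_ge0.
Qed.

Lemma annihZ c q : annih q -> annih (fun p => c * q p).
Proof.
move=> [mq [C qC] q0]; split.
- by apply: cmeasurableM => //; exact: cmeasurable_cst.
- by exists (normc c * C) => p; rewrite normcM ler_wpM2l// normc_ge0.
- move=> a b; rewrite -[RHS](mulr0 c) -(q0 a b) -cintegralZ; last exact: cintegrable_bounded qC.
  by congr cintegral; apply/funext => p; ring.
Qed.

Lemma annihD q1 q2 : annih q1 -> annih q2 -> annih (fun p => q1 p + q2 p).
Proof.
move=> [mq [C qC] q0] [mq' [C' qC'] q0']; split.
- exact: cmeasurableD.
- by exists (C + C') => p; rewrite (le_trans (le_normcD _ _))// lerD.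
- move=> a b; rewrite -[RHS](addr0 0) -{1}(q0 a b) -(q0' a b) -cintegralD.
  + by congr cintegral; apply/funext => p; ring.
  + exact: cintegrable_bounded qC.
  + exact: cintegrable_bounded qC'.
Qed.

Lemma annihB q1 q2 : annih q1 -> annih q2 -> annih (fun p => q1 p - q2 p).
Proof.
move=> h1 /(annihZ (-1)) h2; move: (annihD h1 h2).
by congr annih; apply/funext => p; rewrite mulN1r.
Qed.

Lemma annihM_cis a b c q : annih q -> annih (fun p => q p * cis (a * p.1 + b * p.2 + c)).
Proof.
move=> [mq [C qC] q0]; split.
- apply: cmeasurableM => //; apply: cmeasurable_cis; apply: measurable_funD => //.
  exact: measurable_linform.
- by exists C => p; rewrite normcM normc_cis mulr1.
- move=> a' b'; rewrite -[RHS](mulr0 (cis c)) -(q0 (a + a') (b + b')) -cintegralZ; last first.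
    exact: cintegrable_bounded qC.
  congr cintegral; apply/funext => p; rewrite -!mulrA -cisD.
  rewrite (_ : _ + c + _ = c + ((a + a') * p.1 + (b + b') * p.2)); last by ring.
  by rewrite cisD; ring.
Qed.

Lemma annih_lim (C : R) (q_ : nat -> (RR * RR)%type -> R[i]) q : (forall n, annih (q_ n)) ->
  (forall n p, normc (q_ n p) <= C) -> (forall p, ctends (q_ ^~ p) (q p)) -> annih q.
Proof.
move=> hq qC qq.
have qC' p : normc (q p) <= C.
  have h := ctends_normc (qq p); rewrite -(cvg_lim _ h)//.
  by apply: limr_le; [apply/cvg_ex; eexists; exact: h|exact: nearW].
have mq : cmeasurable q by apply: cmeasurable_lim qq => n; case: (hq n).
split => //; first by exists C.
move=> a b.
have [n|p||n p|_] := @cintegral_dct _ (RR * RR)%type R leb2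
   (fun n p => G p * q_ n p * cis (a * p.1 + b * p.2))
   (fun p => G p * q p * cis (a * p.1 + b * p.2)) (fun p => C * normc (G p)).
- by apply: (@cintegrable_measurable _ _ _ leb2); apply: (@cintegrable_bounded C) => //; case: (hq n).
- have := ctendsMl (G p * cis (a * p.1 + b * p.2)) (qq p).
  by congr ctends; [apply/funext => n; ring|ring].
- exact/rintegrableZ/cintegrable_normc.
- by rewrite !normcM normc_cis mulr1 mulrC ler_wpM2r// normc_ge0.
- rewrite (_ : (fun n => cintegral _ _) = fun=> 0); last first.
    by apply/funext => n; case: (hq n).
  by move=> h; apply/esym; apply: ctends_unique h; exact: ctends_cst.
Qed.

Section HalfPlane.
Variables (a b c : R).
(** Up to scale, [lin] measures the signed position relative to the line a x + b y = c. The
    trigonometric polynomial [tt] has values in [0, 1] and is below 1/2 exactly where sin(lin) > 0,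
    so bumps of [tt] converge to the indicator of that set. Dividing by n + 1 eventually brings
    [lin] into (-1, 1), where sine has the sign of its argument. *)
Let lin n (p : RR * RR) : R := (a * p.1 + b * p.2 - c) / n.+1%:R.
Let tt n p : R := (1 - sin (lin n p)) / 2.

Let tt01 n p : 0 <= tt n p <= 1.
Proof.
rewrite /tt; have := sin_geN1 (lin n p); have := sin_le1 (lin n p) => h1 h2.
by apply/andP; split; lra.
Qed.

Lemma annihM_tt n q : annih q -> annih (fun p => q p * (tt n p)%:C).
Proof.
move=> hq.
have h1 := annihZ (- (0 -i* 2^-1) * 2^-1) (annihM_cis (a / n.+1%:R) (b / n.+1%:R) (- c / n.+1%:R) hq).
have h2 := annihZ (- (0 +i* 2^-1) * 2^-1) (annihM_cis (- a / n.+1%:R) (- b / n.+1%:R) (c / n.+1%:R) hq).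
move: (annihD (annihZ (2^-1) hq) (annihD h1 h2)); congr annih; apply/funext => p.
rewrite (_ : a / n.+1%:R * p.1 + b / n.+1%:R * p.2 + - c / n.+1%:R = lin n p); last first.
  by rewrite /lin; field.
rewrite (_ : - a / n.+1%:R * p.1 + - b / n.+1%:R * p.2 + c / n.+1%:R = - lin n p); last first.
  by rewrite /lin; field.
have E (s : R) : ((1 - s) / 2)%:C = (1 - s%:C) / 2.
  by rewrite rmorphM fmorphV rmorph_nat rmorphB rmorph1.
rewrite /tt E sin_cis; ring.
Qed.

Lemma annihM_ttX n k q : annih q -> annih (fun p => q p * (tt n p ^+ k)%:C).
Proof.
move=> hq; elim: k => [|k IH].
  by move: hq; congr annih; apply/funext => p; rewrite expr0 mulr1.
move: (annihM_tt n IH); congr annih; apply/funext => p.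
by rewrite exprSr [in RHS]rmorphM mulrA.
Qed.

Lemma annihM_bump n m k q : annih q -> annih (fun p => q p * ((1 - tt n p ^+ m) ^+ k)%:C).
Proof.
move=> hq; elim: k => [|k IH].
  by move: hq; congr annih; apply/funext => p; rewrite expr0 mulr1.
move: (annihB IH (annihM_ttX n m IH)); congr annih; apply/funext => p.
by rewrite exprSr [in RHS]rmorphM rmorphB rmorph1 /=; ring.
Qed.

Lemma annihM_halfplane q : annih q -> annih (fun p => q p * ((c < a * p.1 + b * p.2)%R%:R)%:C).
Proof.
move=> hq; have [_ [C qC] _] := hq.
have C0 : 0 <= C by rewrite (le_trans (normc_ge0 _) (qC (0, 0))).
have bd (u : R) p : 0 <= u <= 1 -> normc (q p * u%:C) <= C.
  move=> /andP[u0 u1]; rewrite normcM normc_real ger0_norm//.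
  by rewrite (le_trans _ (qC p))// ler_piMr// normc_ge0.
have h n : annih (fun p => q p * ((0 < sin (lin n p))%R%:R)%:C).
  apply: (@annih_lim C (fun m p => q p * (bump m (tt n p))%:C)).
  - by move=> m; exact: annihM_bump.
  - by move=> m p; apply: bd; have /andP[? ?] := tt01 n p; exact: bump01.
  - move=> p; apply: ctendsMl; apply: ctends_real; have /andP[t0 t1] := tt01 n p.
    have := cvg_bump t0 t1; rewrite (_ : (tt n p < 2^-1) = (0 < sin (lin n p)))//.
    by rewrite /tt; apply/idP/idP => ?; lra.
(* Second limit, in the scale n: at each point the indicators obtained above are eventually equal to
   that of the half-plane. *)
apply: (@annih_lim C (fun n p => q p * ((0 < sin (lin n p))%R%:R)%:C)) => //.
  by move=> n p; apply: bd; rewrite ler0n lern1 leq_b1.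
move=> p; apply: ctendsMl; apply: ctends_real; apply: cvg_near_cst.
have [N _ hN] : \forall n \near \oo, `|a * p.1 + b * p.2 - c| < n.+1%:R.
  have := @nbhs_infty_gtr R `|a * p.1 + b * p.2 - c|; apply: filterS => n /lt_trans; apply.
  by rewrite ltr_nat.
exists N => // n /hN /= Hn.
rewrite sin_gt0_small; last by rewrite normrM normfV (@ger0_norm _ n.+1%:R)// ltr_pdivrMr// mul1r.
by rewrite /lin pmulr_lgt0 ?invr_gt0// subr_gt0.
Qed.

End HalfPlane.

Hypothesis fourier0 : forall a b, cintegral leb2 (fun p => G p * cis (a * p.1 + b * p.2)) = 0.

Lemma annih1 : annih (fun=> 1).
Proof.
split; first exact: cmeasurable_cst.
  by exists 1 => p; rewrite (_ : 1 = (1 : R)%:C)// normc_real normr1.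
by move=> a b; rewrite -[RHS](fourier0 a b); congr cintegral; apply/funext => p; rewrite mulr1.
Qed.

(** Keeping [q] universally quantified in the induction predicate allows multiplication by several
    indicators in turn. The sets satisfying the predicate thereby form a sigma-algebra, not merely a
    Dynkin class. *)
Lemma annihM_indic A : measurable A -> forall q, annih q -> annih (fun p => q p * (\1_A p)%:C).
Proof.
have indicP (P : pred (RR * RR)) p : \1_[set p | P p] p = (P p)%:R :> R.
  by rewrite indicE (_ : (p \in _) = P p)//; apply/idP/idP; rewrite inE.
move: A; apply: plane_measurable_ind; first last.
- move=> c q /(@annihM_halfplane 0 1 c); congr annih; apply/funext => p.
  by rewrite mul0r add0r mul1r (indicP (fun p => c < p.2)).
- move=> c q /(@annihM_halfplane 1 0 c); congr annih; apply/funext => p.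
  by rewrite mul0r addr0 mul1r (indicP (fun p => c < p.1)).
split => [q /(annihZ 0)|A hA q hq|F hF q hq].
- by congr annih; apply/funext => p; rewrite indic0 mul0r mulr0.
- move: (annihB hq (hA q hq)); congr annih; apply/funext => p.
  rewrite !indicE in_setD in_setT/=; case: (p \in A); rewrite ?mulr1 ?mulr0 ?subrr ?subr0//.
(* The indicator of the complement of the first n sets; its bounded limit handles the complement of
   the union. *)
pose r n p : R := \prod_(k < n) (1 - \1_(F k) p).
have [_ [C qC] _] := hq.
have C0 : 0 <= C by rewrite (le_trans (normc_ge0 _) (qC (0, 0))).
have hr n : annih (fun p => q p * (r n p)%:C).
  elim: n => [|n IH].
    by move: hq; congr annih; apply/funext => p; rewrite /r big_ord0 mulr1.
  move: (annihB IH (hF n _ IH)); congr annih; apply/funext => p.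
  by rewrite /r big_ord_recr/= -/(r n p) [in RHS]rmorphM rmorphB rmorph1/=; ring.
have r01 n p : 0 <= r n p <= 1.
  rewrite /r; elim/big_ind: _ => [|x y /andP[x0 x1] /andP[y0 y1]|k _].
  - by rewrite ler01 lexx.
  - by rewrite mulr_ge0// mulr_ile1.
  - by rewrite indicE; case: (p \in F k); rewrite ?subrr ?subr0 ?lexx ?ler01.
have hq' : annih (fun p => q p * (1 - \1_(\bigcup_k F k) p)%:C).
  apply: (@annih_lim C (fun n p => q p * (r n p)%:C)) => //.
    move=> n p; have /andP[u0 u1] := r01 n p; rewrite normcM normc_real ger0_norm//.
    by rewrite (le_trans _ (qC p))// ler_piMr// normc_ge0.
  move=> p; apply: ctendsMl; apply: ctends_real; apply: cvg_near_cst.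
  have [[k _ Fk]|nF] := pselect ((\bigcup_k F k) p).
    exists k.+1 => // n /= kn; rewrite /r (bigD1 (Ordinal kn))//= !indicE.
    by rewrite mem_set// mem_set ?subrr ?mul0r//; exists k.
  apply: nearW => n; rewrite /r big1 ?indicE ?memNset ?subr0// => k _.
  by rewrite indicE memNset ?subr0// => Fk; apply: nF; exists k.
move: (annihB hq hq'); congr annih; apply/funext => p.
by rewrite rmorphB rmorph1 mulrBr mulr1 opprB addrC subrK.
Qed.

(** At frequency 0 the preceding lemma says that G has zero integral over every Borel set, and so do
    its real and imaginary parts. *)
Lemma fourier_unique : {ae leb2, forall p, G p = 0}.
Proof.
have h0 A : measurable A -> cintegral leb2 (fun p => G p * (\1_A p)%:C) = 0.
  move=> mA; have [_ _ /(_ 0 0)] := annihM_indic mA annih1.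
  rewrite (_ : (fun p => _) = fun p => G p * (\1_A p)%:C)//.
  apply/funext => p; rewrite !mul0r addr0 mul1r (_ : cis 0 = 1) ?mulr1//.
  by rewrite /cis (_ : 0 +i* 0 = 0 :> R[i])// cexp0.
have i0 A : measurable A -> cintegrable leb2 (fun p => G p * (\1_A p)%:C).
  move=> mA; apply: cintegrable_le (cintegrable_normc iG) _.
    apply: cmeasurableM; first exact: (cintegrable_measurable iG).
    by apply: cmeasurable_real; exact: measurable_indic.
  move=> p; rewrite normcM normc_real ger0_norm; last by rewrite indicE ler0n.
  by rewrite ler_piMr ?normc_ge0// indicE lern1 leq_b1.
have key (u : (RR * RR)%type -> R) : rintegrable leb2 u ->
    (forall A, measurable A -> rintegrable leb2 (fun p => u p * \1_A p) /\
       \int[leb2]_p (u p * \1_A p) = 0) -> {ae leb2, forall p, u p = 0}.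
  move=> iu uA; have := @integral_ae_eq _ _ R leb2 setT measurableT (fun=> 0%E) (fun p => (u p)%:E) iu.
  have h1 : measurable_fun [set: (RR * RR)%type] (fun=> 0%E : \bar R) by exact: measurable_cst.
  move=> /(_ h1) h.
  have : ae_eq leb2 setT (fun p => (u p)%:E) (fun=> 0%E).
    apply: h => E _ mE; have [iE uE] := uA E mE.
    rewrite integral0 integral_mkcond.
    rewrite (_ : _ \_ E = fun p => (u p * \1_E p)%:E); last first.
      apply/funext => p; rewrite patchE indicE; case: (p \in E); rewrite ?mulr1 ?mulr0//.
    by rewrite -EFin_Rintegral// uE.
  by apply: filterS => p /(_ I) [].
have [iR iI] := iG.
have hR : {ae leb2, forall p, complex.Re (G p) = 0}.
  apply: key => // A mA; have [i1 _] := i0 A mA; have := h0 A mA => /(congr1 (@complex.Re R)) e1.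
  have E : (fun p => complex.Re (G p * (\1_A p)%:C)) = fun p => complex.Re (G p) * \1_A p.
    by apply/funext => p; rewrite cReM/= mulr0 subr0.
  by move: i1 e1; rewrite /cintegral/= E; split => //; move: i1; under eq_fun do rewrite cReM/= mulr0 subr0.
have hI : {ae leb2, forall p, complex.Im (G p) = 0}.
  apply: key => // A mA; have [_ i1] := i0 A mA; have := h0 A mA => /(congr1 (@complex.Im R)) e1.
  have E : (fun p => complex.Im (G p * (\1_A p)%:C)) = fun p => complex.Im (G p) * \1_A p.
    by apply/funext => p; rewrite cImM/= mulr0 add0r.
  by move: i1 e1; rewrite /cintegral/= E; split => //; move: i1; under eq_fun do rewrite cImM/= mulr0 add0r.
apply: filterS2 hR hI => p h1 h2.
by apply/eqP; rewrite eq_complex h1 h2 !eqxx.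
Qed.

End FourierUniqueness.

(** * Injectivity of the transform through a Laplace transform *)

Section Injectivity.
Variable R : realType.
Notation RR := (measurableTypeR R).
Notation leb := (@lebesgue_measure R).
Notation leb2 := (leb2 R).
Implicit Types (z w : R[i]) (s t : R).

(** The square root of [gauss_abs (2 * c)], hence square integrable and ready to be paired with
    [phi]. *)
Definition khalf (c x : R) := expR (- x ^+ 2 / 2 + c * `|x|).

Lemma rL2_khalf c : rL2 leb (khalf c).
Proof.
split.
  apply: measurableT_comp => //; apply: measurable_funD; apply: measurable_funM => //.
  by apply: measurableT_comp => //; apply: measurable_funX; exact: measurable_id.
have := rintegrable_gauss_abs (2 * c); congr rintegrable; apply/funext => x.
rewrite /gauss_abs /khalf -expRM_natl; congr expR; by field.
Qed.

Variable phi : (RR * RR)%type -> R[i].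
Hypothesis phiL2 : L2 leb2 phi.

Definition gphi (p : RR * RR) : R[i] := phi p * (khalf 0 p.1 * khalf 0 p.2)%:C.

Definition expdom c (p : RR * RR) : R := khalf c p.1 * khalf c p.2 * normc (phi p).

Lemma rintegrable_expdom c : rintegrable leb2 (expdom c).
Proof.
apply: rintegrableM; last exact: rL2_normc.
by apply: rL2_prod; exact: rL2_khalf.
Qed.

Lemma normc_gphi p : normc (gphi p) = expdom 0 p.
Proof.
by rewrite normcM normc_real ger0_norm ?mulr_ge0 ?expR_ge0// mulrC.
Qed.

Lemma gphi_expdom c p : 0 <= c -> normc (gphi p) * expR (c * `|p.1 + p.2|) <= expdom c p.
Proof.
move=> c0; rewrite normc_gphi /expdom mulrAC ler_wpM2r ?normc_ge0//.
rewrite /khalf -!expRD ler_expR.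
have := ler_wpM2l c0 (ler_normD p.1 p.2); lra.
Qed.

Lemma cmeasurable_gphi : cmeasurable gphi.
Proof.
apply: cmeasurableM; first by case: phiL2.
apply: cmeasurable_real; exact: (rL2_prod (rL2_khalf 0) (rL2_khalf 0)).1.
Qed.

Lemma cintegrable_gphi : cintegrable leb2 gphi.
Proof.
apply: cintegrable_le (rintegrable_expdom 0) _; first exact: cmeasurable_gphi.
by move=> p; rewrite normc_gphi.
Qed.

Definition laplace t w : R[i] :=
  cintegral leb2 (fun p => gphi p * cis (t * (p.1 - p.2)) * cexp (w * (p.1 + p.2)%:C)).

Definition moment t m : R[i] :=
  cintegral leb2 (fun p => gphi p * cis (t * (p.1 - p.2)) * ((p.1 + p.2) ^+ m / m`!%:R)%:C).

(** The transform is entire in w with the moments as coefficients: the Gaussian factor in [gphi]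
    dominates exponentials of every rate. *)
Lemma ctends_laplace t w : ctends (series (fun m => moment t m * w ^+ m)) (laplace t w).
Proof.
pose f_ m (p : RR * RR) := gphi p * cis (t * (p.1 - p.2)) * cexp_term (w * (p.1 + p.2)%:C) m.
have mt : cmeasurable (fun p : RR * RR => cis (t * (p.1 - p.2))).
  by apply: cmeasurable_cis; apply: measurable_funM => //; exact: measurable_funB.
have mg := cmeasurable_gphi.
have ms m : cmeasurable (fun p : RR * RR => ((p.1 + p.2) ^+ m / m`!%:R)%:C).
  by apply: cmeasurable_real; apply: measurable_funM => //; apply: measurable_funX; exact: measurable_funD.
have fE m p : f_ m p = w ^+ m * (gphi p * cis (t * (p.1 - p.2)) * ((p.1 + p.2) ^+ m / m`!%:R)%:C).
  rewrite /f_ /cexp_term exprMn -rmorphXn/= [((_ / m`!%:R))%:C]rmorphM fmorphV rmorph_nat/=; ring.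
have [m|p||n p|_ h1 h2] := @cintegral_series _ (RR * RR)%type R leb2 f_
  (fun p => gphi p * cis (t * (p.1 - p.2)) * cexp (w * (p.1 + p.2)%:C)) (expdom (normc w)).
- rewrite (_ : f_ m = fun p => w ^+ m * (gphi p * cis (t * (p.1 - p.2)) * ((p.1 + p.2) ^+ m / m`!%:R)%:C)); last first.
    by apply/funext => p; exact: fE.
  by apply: cmeasurableM; [exact: cmeasurable_cst|apply: cmeasurableM => //; exact: cmeasurableM].
- have := ctendsMl (gphi p * cis (t * (p.1 - p.2))) (@ctends_cexp R (w * (p.1 + p.2)%:C)).
  by congr ctends; apply/funext => n; rewrite /series/= mulr_sumr.
- exact: rintegrable_expdom.
- apply: le_trans (gphi_expdom p (normc_ge0 w)).
  rewrite (eq_bigr (fun m => normc (gphi p) * exp_coeff (normc w * `|p.1 + p.2|) m)); last first.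
    by move=> m _; rewrite /f_ (normcM (gphi p * _)) (normcM (gphi p)) normc_cis mulr1 normc_cexp_term (normcM w) normc_real.
  rewrite -mulr_sumr ler_wpM2l ?normc_ge0//.
  apply: (nondecreasing_cvgn_le _ (is_cvg_series_exp_coeff _)).
  apply: nondecreasing_series => k _ _.
  by rewrite /exp_coeff/= mulr_ge0 ?invr_ge0// exprn_ge0// mulr_ge0// normc_ge0.
- move: h2; congr ctends; congr series; apply/funext => m.
  rewrite /moment mulrC -cintegralZ.
    by congr cintegral; apply/funext => p; rewrite fE.
  apply: cintegrable_le (rintegrable_expdom 1) _.
    by apply: cmeasurableM => //; exact: cmeasurableM.
  move=> p; rewrite (normcM (gphi p * _)) (normcM (gphi p)) normc_cis mulr1 normc_real normrM normrX.
  rewrite (@ger0_norm _ (_^-1)) ?invr_ge0//.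
  apply: le_trans (gphi_expdom p ler01); rewrite mul1r ler_wpM2l ?normc_ge0//.
  by rewrite ler_pdivrMr ?ltr0n ?fact_gt0// mulrC pow_le_expR.
Qed.

(** At z = (s + i t) / sqrt 2 the linear exponents of the two kernels add up to s (x + y) + i t (x -
    y), and the quadratic ones to -(s^2 - t^2) / 2. *)
Lemma SB_transform_laplace s t : SB_transform phi ((s / Num.sqrt 2) +i* (t / Num.sqrt 2)) =
  (gcst R ^+ 2)%:C * cexp (- ((s ^+ 2 - t ^+ 2) / 2)%:C) * laplace t s%:C.
Proof.
set z := _ +i* _.
have q2 : Num.sqrt 2 != 0 :> R by rewrite gt_eqF// sqrtr_gt0.
have qq : (Num.sqrt 2)%:C ^+ 2 = 2 :> R[i] by rewrite -rmorphXn sqr_sqrtr// rmorph_nat.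
have zE : z * (Num.sqrt 2)%:C = s +i* t.
  by apply/eqP; rewrite eq_complex/= !mulr0 subr0 add0r !divfK// !eqxx.
have mt : cmeasurable (fun p : RR * RR => cis (t * (p.1 - p.2))).
  by apply: cmeasurable_cis; apply: measurable_funM => //; exact: measurable_funB.
have ms : cmeasurable (fun p : RR * RR => cexp (s%:C * (p.1 + p.2)%:C)).
  apply: cmeasurable_cexp; apply: cmeasurableM; first exact: cmeasurable_cst.
  by apply: cmeasurable_real; exact: measurable_funD.
rewrite /SB_transform /laplace -cintegralZ; last first.
  apply: cintegrable_le (rintegrable_expdom `|s|) _.
    by apply: cmeasurableM => //; apply: cmeasurableM => //; exact: cmeasurable_gphi.
  move=> p; apply: le_trans (gphi_expdom p (normr_ge0 s)).
  rewrite (normcM (gphi p * _)) (normcM (gphi p)) normc_cis mulr1 ler_wpM2l ?normc_ge0// normc_cexp.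
  by rewrite cReM/= !mul0r subr0 ler_expR -normrM ler_norm.
congr cintegral; apply/funext => p.
rewrite /SB_integrand !SB_kernelE /gphi.
have E1 : (gcst R * expR (- p.1 ^+ 2 / 2))%:C * (gcst R * expR (- p.2 ^+ 2 / 2))%:C =
    (gcst R ^+ 2)%:C * (khalf 0 p.1 * khalf 0 p.2)%:C.
  by rewrite -!rmorphM /khalf !mul0r !addr0; congr (_%:C); ring.
have E2 : cexp ((Num.sqrt 2)%:C * z * (p.1)%:C - z ^+ 2 / 2) *
    cexp ((Num.sqrt 2)%:C * conjc z * (p.2)%:C - conjc z ^+ 2 / 2) =
    cexp (- ((s ^+ 2 - t ^+ 2) / 2)%:C) * (cis (t * (p.1 - p.2)) * cexp (s%:C * (p.1 + p.2)%:C)).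
  rewrite /cis -!cexpD; congr cexp.
  have -> : z ^+ 2 / 2 = ((s +i* t) ^+ 2 / 4%:R).
    rewrite -zE exprMn qq; by field.
  have -> : conjc z ^+ 2 / 2 = ((s -i* t) ^+ 2 / 4%:R).
    rewrite (_ : s -i* t = conjc (s +i* t))// -zE conjcM exprMn.
    rewrite (_ : conjc (Num.sqrt 2)%:C = (Num.sqrt 2)%:C); last by rewrite /conjc/= oppr0.
    rewrite qq; by field.
  have -> : (Num.sqrt 2)%:C * z = s +i* t by rewrite mulrC.
  have -> : (Num.sqrt 2)%:C * conjc z = s -i* t.
    rewrite (_ : s -i* t = conjc (s +i* t))// -zE conjcM mulrC.
    by rewrite (_ : conjc (Num.sqrt 2)%:C = (Num.sqrt 2)%:C)// /conjc/= oppr0.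
  have q4 : (4%:R : R[i])^-1 = (4^-1 : R)%:C by rewrite fmorphV rmorph_nat.
  rewrite q4; apply/eqP; rewrite eq_complex /=; apply/andP; split; apply/eqP; by field.
rewrite mulrACA E1 E2; ring.
Qed.

Hypothesis T0 : forall z, SB_transform phi z = 0.

(** The prefactor relating the two transforms never vanishes, so [laplace t] is 0 on the real axis.
    Its moments are then all 0, and hence its values at complex w. *)
Lemma laplace0 t w : laplace t w = 0.
Proof.
have h s : laplace t s%:C = 0.
  apply/eqP; have /eqP := T0 ((s / Num.sqrt 2) +i* (t / Num.sqrt 2)).
  rewrite SB_transform_laplace mulf_eq0 => /orP[|//].
  rewrite mulf_eq0 => /orP[/eqP/(congr1 (@normc R))|/eqP/(congr1 (@normc R))].
    rewrite normc0 normc_real => /eqP; rewrite normr_eq0 expf_eq0/= gt_eqF//; exact: gcst_gt0.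
  by rewrite normc0 normc_cexp => /eqP; rewrite gt_eqF// expR_gt0.
have m0 m : moment t m = 0.
  by move: m; apply: ctends_powers_unique => x x0; rewrite -(h x); exact: ctends_laplace.
apply: (ctends_unique (@ctends_laplace t w)).
rewrite (_ : series _ = fun=> 0); first exact: ctends_cst.
by apply/funext => n; rewrite /series/= big1// => m _; rewrite m0 mul0r.
Qed.

Lemma SB_transform_inj : {ae leb2, forall p, phi p = 0}.
Proof.
have : {ae leb2, forall p, gphi p = 0}.
  apply: fourier_unique; first exact: cintegrable_gphi.
  (* This is a x + b y = ((a - b) / 2) (x - y) + ((a + b) / 2) (x + y), the second summand being
     supplied by an imaginary w. *)
  move=> a b; rewrite -[RHS](laplace0 ((a - b) / 2) (0 +i* ((a + b) / 2))).
  congr cintegral; apply/funext => p; rewrite -mulrA; congr (_ * _).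
  rewrite /cis -cexpD; congr cexp.
  by apply/eqP; rewrite eq_complex/=; apply/andP; split; apply/eqP; by field.
apply: filterS => p /eqP; rewrite mulf_eq0 => /orP[/eqP//|].
move=> /eqP/(congr1 (@normc R)); rewrite normc0 normc_real => /eqP.
by rewrite normr_eq0 gt_eqF// mulr_gt0// expR_gt0.
Qed.

End Injectivity.

(** * From injectivity to the isometry *)

Section Isometry.
Variable R : realType.
Notation RR := (measurableTypeR R).
Notation leb2 := (leb2 R).
Implicit Types (phi psi : (RR * RR)%type -> R[i]).

Lemma L2B phi psi : L2 leb2 phi -> L2 leb2 psi -> L2 leb2 (fun p => phi p - psi p).
Proof.
move=> /L2_ReIm[h1 h2] /L2_ReIm[h3 h4]; apply/L2_ReIm; split.
  by rewrite (_ : (fun p => _) = fun p => complex.Re (phi p) - complex.Re (psi p));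
    [exact: rL2B|apply/funext => p; rewrite cReD cReN].
by rewrite (_ : (fun p => _) = fun p => complex.Im (phi p) - complex.Im (psi p));
  [exact: rL2B|apply/funext => p; rewrite cImD cImN].
Qed.

Lemma SB_transform_linear a phi psi z : L2 leb2 phi -> L2 leb2 psi ->
  SB_transform (fun p => a * phi p + psi p) z = a * SB_transform phi z + SB_transform psi z.
Proof.
move=> hphi hpsi; have [i1 _] := SB_integrable hphi z; have [i2 _] := SB_integrable hpsi z.
rewrite /SB_transform -cintegralZ// -cintegralD//; last exact: cintegrableZ.
by congr cintegral; apply/funext => p; rewrite /SB_integrand; ring.
Qed.

Lemma SB_transform_ae phi psi : L2 leb2 phi -> L2 leb2 psi ->
  {ae leb2, forall p, phi p = psi p} -> SB_transform phi = SB_transform psi.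
Proof.
move=> hphi hpsi e; apply/funext => z.
apply: cintegral_ae_eq; first by case: (SB_integrable hphi z).
  by case: (SB_integrable hpsi z) => /cintegrable_measurable.
by move: e; apply: filterS => p e; rewrite /SB_integrand e.
Qed.

Lemma SB_transform_ae_eq phi psi : L2 leb2 phi -> L2 leb2 psi ->
  SB_transform phi = SB_transform psi -> {ae leb2, forall p, phi p = psi p}.
Proof.
move=> hphi hpsi e.
have : {ae leb2, forall p, psi p - phi p = 0}.
  apply: SB_transform_inj; first exact: L2B.
  move=> z; rewrite (_ : (fun p => psi p - phi p) = fun p => -1 * phi p + psi p); last first.
    by apply/funext => p; ring.
  by rewrite SB_transform_linear// e mulN1r addNr.
by apply: filterS => p /eqP; rewrite subr_eq0 => /eqP.
Qed.

Lemma L2_normsq_ae phi psi : L2 leb2 phi -> L2 leb2 psi ->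
  {ae leb2, forall p, phi p = psi p} -> L2_normsq leb2 phi = L2_normsq leb2 psi.
Proof.
move=> hphi hpsi e; rewrite !L2_normsqE//; congr (_ + _)%:E.
  move/L2_ReIm: hphi => [[_ h1] _]; move/L2_ReIm: hpsi => [[_ h2] _].
  apply: (Rintegral_ae_eq h1 (rintegrable_measurable h2) _).2.
  by move: e; apply: filterS => p ->.
move/L2_ReIm: hphi => [_ [_ h1]]; move/L2_ReIm: hpsi => [_ [_ h2]].
apply: (Rintegral_ae_eq h1 (rintegrable_measurable h2) _).2.
by move: e; apply: filterS => p ->.
Qed.

(** The coefficients picked by [SF_coef] have, by [SF_to_L2], a preimage [psi] of the same norm.
    Since [psi] and [phi] have the same transform, they agree almost everywhere and have equal
    norms. *)
Lemma SB_transform_isometry phi : L2 leb2 phi -> SF_norm (SB_transform phi) = L2_norm leb2 phi.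
Proof.
move=> hphi.
have hc : SF_expansion (SB_transform phi) (SF_coef (SB_transform phi)).
  apply: (@xgetPex _ (fun _ _ => 0) [set c | SF_expansion (SB_transform phi) c]).
  by exists (hrow phi); exact: L2_to_SF.
have [psi [hpsi Tpsi npsi]] := SF_to_L2 hc.
rewrite /SF_norm /L2_norm -npsi; congr (Num.sqrt (fine _)).
by apply: L2_normsq_ae => //; exact: SB_transform_ae_eq.
Qed.

End Isometry.

Theorem theorem4p7 (R : realType) :
  [/\ (* the integral defining T phi converges, and T maps L^2 into SF
         isometrically *)
      forall phi : R * R -> R[i], L2 (leb2 R) phi ->
        [/\ forall z : R[i], cintegrable (leb2 R) (SB_integrand phi z),
            SF (SB_transform phi) &
            SF_norm (SB_transform phi) = L2_norm (leb2 R) phi],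
      (* T is linear *)
      forall (a : R[i]) (phi psi : R * R -> R[i]),
        L2 (leb2 R) phi -> L2 (leb2 R) psi ->
        forall z : R[i],
          SB_transform (fun p => a * phi p + psi p) z =
          a * SB_transform phi z + SB_transform psi z,
      (* T is well defined and injective on classes modulo a.e. equality *)
      forall phi psi : R * R -> R[i], L2 (leb2 R) phi -> L2 (leb2 R) psi ->
        (SB_transform phi = SB_transform psi <->
         {ae leb2 R, forall p, phi p = psi p}) &
      (* T is onto *)
      forall f : R[i] -> R[i], SF f ->
        exists2 phi : R * R -> R[i], L2 (leb2 R) phi & SB_transform phi = f].
Proof.
split.
- move=> phi hphi; split.
  + by move=> z; case: (SB_integrable hphi z).
  + by exists (hrow phi); exact: L2_to_SF.
  + exact: SB_transform_isometry.
- by move=> a phi psi hphi hpsi z; exact: SB_transform_linear.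
- move=> phi psi hphi hpsi; split; first exact: SB_transform_ae_eq.
  exact: SB_transform_ae.
- by move=> f [c /SF_to_L2[phi [hphi Tphi _]]]; exists phi.
Qed.
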